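(* Let $D\in\mathbb R\cup\{+\infty\}$. The following are equivalent. (A) Whenever even Borel functions $f_i:E_i\to\mathbb R\cup\{+\infty\}$ satisfy $e^{-f_i}\in L^1(E_i)$ and $\sum_{i=1}^nc_if_i(x_i)\ge\langle x,Qx\rangle$ for all $x=(x_1,\dots,x_n)\in E$, one has $\prod_{i=1}^n\big(\int_{E_i}e^{-f_i}dx_i\big)^{c_i}\le e^D$. (B) Whenever $\mu_i\in\mathcal P(E_i)$, $i=1,\dots,n$, are symmetric, one has $\sum_{i=1}^nc_ih(\mu_i)\le\sup_{\mu\in\Pi(\mu_1,\dots,\mu_n)}\int_E\langle x,Qx\rangle d\mu+D$. Moreover, $D_s(\mathbf c,Q)$ equals the smallest constant $D$ such that the inequality in (B) holds for all symmetric log-concave $\mu_i\in\mathcal P(E_i)$; i.e., symmetric log-concave measures suffice to saturate (B) with its sharp constant.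
   Context: Let $E_i=\mathbb{R}^{d_i}$, $E=\bigoplus_{i=1}^n E_i$, $\pi_i:E\to E_i$ the coordinate projection, $x_i=\pi_i(x)$. Fix a symmetric linear map $Q$ on $E$ and positive reals $\mathbf c=(c_i)_{i=1}^n$. $\mathcal P(E_i)$: Borel probability measures on $E_i$ absolutely continuous w.r.t. Lebesgue with finite second moments; $h(\mu_i)=-\int\rho_i\log\rho_i$ for density $\rho_i$. $\Pi(\mu_1,\dots,\mu_n)$: probability measures $\mu$ on $E$ with $\pi_i\sharp\mu=\mu_i$. A measure $\mu_i$ is symmetric if $\mu_i(B)=\mu_i(-B)$ for all Borel $B$; a function is even if $f(-x)=f(x)$. $D_s(\mathbf c,Q)\in\mathbb R\cup\{+\infty\}$ is the smallest $D$ such that the inequality in (B) holds for all symmetric $\mu_i\in\mathcal P(E_i)$. *)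

(* Defs.v *)
From HB Require Import structures.
From mathcomp Require Import all_boot all_order all_algebra.
From mathcomp Require Import all_classical all_reals all_analysis measurable_realfun.
Set Implicit Arguments. Unset Strict Implicit. Unset Printing Implicit Defensive.
Import Order.TTheory GRing.Theory Num.Theory.
Local Open Scope classical_set_scope.
Local Open Scope ring_scope.

Section Defs.
Variable R : realType.

(* E_i = R^k is represented by k.-tuple R, with its product (= Borel) sigma-algebra. *)

(* Lebesgue integral over R^k of a nonnegative function, as the iterated
   integral w.r.t. the one-dimensional Lebesgue measure (Tonelli). *)
Fixpoint leb_int (k : nat) : (k.-tuple R -> \bar R) -> \bar R :=
  match k return (k.-tuple R -> \bar R) -> \bar R with
  | 0 => fun f => f [tuple]
  | k'.+1 => fun f =>
      (\int[@lebesgue_measure R]_(x in [set: R])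
         leb_int (fun t : k'.-tuple R => f (cons_tuple x t)))%E
  end.

Definition dens_meas (k : nat) (rho : k.-tuple R -> R) (A : set (k.-tuple R)) : \bar R :=
  leb_int (fun x => (\1_A x * rho x)%:E).

Definition tneg (k : nat) (x : k.-tuple R) : k.-tuple R := map_tuple (fun r => - r) x.

Definition sqnorm (k : nat) (x : k.-tuple R) : R := \sum_(j < k) tnth x j ^+ 2.

(* rho is the (real-valued) density of an element of P(R^k): a Borel probability
   density with finite second moment *)
Definition is_Pdens (k : nat) (rho : k.-tuple R -> R) : Prop :=
  [/\ measurable_fun [set: k.-tuple R] rho,
      (forall x, 0 <= rho x),
      leb_int (fun x => (rho x)%:E) = 1%E &
      (leb_int (fun x => (rho x * sqnorm x)%:E) < +oo)%E].

Definition symm_dens (k : nat) (rho : k.-tuple R -> R) : Prop :=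
  forall A : set (k.-tuple R), measurable A -> dens_meas rho A = dens_meas rho (@tneg k @` A).

(* h(mu) = - \int rho log rho   (with 0 log 0 = 0; ln 0 = 0 in the library),
   the Lebesgue integral being \int f^+ - \int f^- *)
Definition entropy (k : nat) (rho : k.-tuple R -> R) : \bar R :=
  (leb_int (fun x => (Num.max (- (rho x * ln (rho x))) 0)%:E)
   - leb_int (fun x => (Num.max (rho x * ln (rho x)) 0)%:E))%E.

Definition log_concave_fun (k : nat) (g : k.-tuple R -> R) : Prop :=
  forall (x y : k.-tuple R) (t : R), 0 <= t <= 1 ->
    g x `^ t * g y `^ (1 - t) <= g [tuple t * tnth x j + (1 - t) * tnth y j | j < k].

Definition logconcave_dens (k : nat) (rho : k.-tuple R -> R) : Prop :=
  exists g : k.-tuple R -> R,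
    [/\ measurable_fun [set: k.-tuple R] g, (forall x, 0 <= g x), log_concave_fun g &
        forall A, measurable A -> dens_meas g A = dens_meas rho A].

Variables (n : nat) (d : 'I_n -> nat).

(* E = E_1 (+) ... (+) E_n = R^N, N = sum d_i; E_i is the i-th block of coordinates *)
Definition dimE : nat := \sum_(i < n) d i.
Definition Espace := (dimE.-tuple R).

Definition offset (i : 'I_n) : nat := \sum_(j < n | (j < i)%N) d j.

Definition proj (i : 'I_n) (x : Espace) : (d i).-tuple R :=
  [tuple nth 0 x (offset i + j) | j < d i].

Definition quad (Q : 'M[R]_dimE) (x : Espace) : R :=
  \sum_(j < dimE) \sum_(l < dimE) tnth x j * Q j l * tnth x l.

Definition coupling (rho : forall i : 'I_n, (d i).-tuple R -> R)
  (mu : probability Espace R) : Prop :=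
  forall (i : 'I_n) (A : set ((d i).-tuple R)), measurable A ->
    mu (proj i @^-1` A) = dens_meas (rho i) A.

Variables (c : 'I_n -> R) (Q : 'M[R]_dimE).

Definition Bineq (rho : forall i : 'I_n, (d i).-tuple R -> R) (D : \bar R) : Prop :=
  (\sum_(i < n) (c i)%:E * entropy (rho i) <=
   ereal_sup [set \int[mu]_(x in [set: Espace]) (quad Q x)%:E
             | mu in [set mu : probability Espace R | coupling rho mu]] + D)%E.

Definition condB (D : \bar R) : Prop :=
  forall rho : forall i : 'I_n, (d i).-tuple R -> R,
    (forall i, is_Pdens (rho i)) -> (forall i, symm_dens (rho i)) -> Bineq rho D.

Definition condB_lc (D : \bar R) : Prop :=
  forall rho : forall i : 'I_n, (d i).-tuple R -> R,
    (forall i, is_Pdens (rho i)) -> (forall i, symm_dens (rho i)) ->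
    (forall i, logconcave_dens (rho i)) -> Bineq rho D.

Definition condA (D : \bar R) : Prop :=
  forall f : forall i : 'I_n, (d i).-tuple R -> \bar R,
    (forall i, measurable_fun [set: (d i).-tuple R] (f i)) ->
    (forall i x, f i x != -oo%E) ->
    (forall i x, f i (tneg x) = f i x) ->
    (forall i, leb_int (fun x => expeR (- f i x)) < +oo)%E ->
    (forall x : Espace, (quad Q x)%:E <= \sum_(i < n) (c i)%:E * f i (proj i x))%E ->
    ((\prod_(i < n) (fine (leb_int (fun x => expeR (- f i x)))) `^ (c i))%:E
       <= expeR D)%E.

Definition D_s : \bar R := ereal_inf [set D : \bar R | D != -oo%E /\ condB D].

End Defs.

(* Main.v *)
(* (A) => (B). Kantorovich duality, up to an error e: there are a coupling mu and
   even potentials f_i, growing at least quadratically, with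
   <x, Qx> <= sum_i c_i f_i(x_i) and
   sum_i c_i int f_i dmu_i <= int <x, Qx> dmu + e.
   It follows from finite linear programming duality, i.e. from Farkas' lemma, on
   a cell decomposition of each E_i, the discretization error being absorbed into
   the potentials. Then (A) applies to the f_i, and Gibbs' inequality
   h(mu_i) <= int f_i dmu_i + log int exp (- f_i) turns it into (B).

   (B) for log-concave densities => (A). If <v, Qv> < 0 for some v in one block
   E_i, the uniform densities on long slabs in the direction v contradict (B):
   their entropies do not decrease while the right-hand side tends to -oo. So
   x_i |-> <x, Qx> is convex for each i. Truncate each exp (- f_i) to a cube, and
   replace them one at a time by the largest function on the cube that satisfies
   the constraint with the others: an infimum of log-concave functions, hence
   log-concave. For the normalized densities of these functions (B) bounds the
   product of the masses by exp D, and one lets the cube grow. *)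
From Pilot Require Import Defs.
From HB Require Import structures.
From mathcomp Require Import all_boot all_order all_algebra finmap.
From mathcomp Require Import ring lra.
From mathcomp Require Import all_classical all_reals all_analysis measurable_realfun.
Import Order.TTheory GRing.Theory Num.Theory numFieldNormedType.Exports.
Local Open Scope classical_set_scope.
Local Open Scope ring_scope.
Set Implicit Arguments. Unset Strict Implicit. Unset Printing Implicit Defensive.
(* [proj] also names the projections of product topologies. *)
Local Notation proj := Pilot.Defs.proj.

(** * Lebesgue measure on tuples *)

(** An approximate duality suffices, since the error [e] is arbitrary; no compactness and no optimal
    potentials are needed. What (A) demands of the potentials is evenness and integrability of
    [exp (- f i)]. Evenness comes from averaging with the reflection, which changes neither the cost
    nor symmetric marginals. Integrability comes from the discretization itself: its error bound
    contains a small multiple of the squared norm, and adding this bound makes the potentials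
    coercive. Finite second moments keep it cheap. In the other direction the obstacle is convexity
    of the cost along a block: without it the constraints on one function would not be log-concave.
    Only a finite constant in (B) excludes a negative direction. The cube makes supports and
    majorants bounded, so that moments and entropies are finite and the integrals of the logarithms
    cancel. A replacement never lowers a function, because the old one satisfies the constraint, so
    the masses can only grow. As (B) contains its log-concave case, the three conditions form a
    cycle: the sets of constants agree, not only their infima. *)

Section image_product_measure.
Local Open Scope ereal_scope.
Context d1 d2 d3 (T1 : measurableType d1) (T2 : measurableType d2)
  (T3 : measurableType d3) (R : realType).
Variables (m1 : {sigma_finite_measure set T1 -> \bar R})
  (m2 : {sigma_finite_measure set T2 -> \bar R}).
Variables (f : T1 * T2 -> T3) (g : T3 -> T1 * T2).
Hypotheses (mf : measurable_fun setT f) (mg : measurable_fun setT g).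
Hypotheses (fK : cancel f g) (gK : cancel g f).

(* The last four arguments only serve to make them available to the instances
   declared below. *)
Definition image_product of measurable_fun setT f & measurable_fun setT g
    & cancel f g & cancel g f :=
  fun A : set T3 => (m1 \x m2) (f @^-1` A).

Local Notation nu := (image_product mf mg fK gK).

Let mpre A : measurable A -> measurable (f @^-1` A).
Proof. by move=> mA; rewrite -[X in measurable X]setTI; exact: mf. Qed.

Let nu0 : nu set0 = 0.
Proof. by rewrite /image_product preimage_set0 measure0. Qed.

Let nu_ge0 A : 0 <= nu A.
Proof. exact: measure_ge0. Qed.

Let nu_sigma_additive : semi_sigma_additive nu.
Proof.
move=> F mF tF mUF; rewrite /image_product preimage_bigcup.
apply: measure_semi_sigma_additive => [n||].
- exact: mpre.
- apply/trivIsetP => /= i j _ _ ij; rewrite -preimage_setI.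
  by move/trivIsetP : tF => /(_ _ _ _ _ ij) ->//; rewrite preimage_set0.
- by rewrite -preimage_bigcup; exact: mpre.
Qed.

HB.instance Definition _ := isMeasure.Build _ _ _ nu
  nu0 nu_ge0 nu_sigma_additive.

Let nu_sigma_finite : sigma_finite setT nu.
Proof.
have /sigma_finiteP[F [TF ndF Foo]] := sigma_finiteT m1.
have /sigma_finiteP[G [TG ndG Goo]] := sigma_finiteT m2.
exists (fun n => g @^-1` (F n `*` G n)).
  apply/seteqP; split => // t _.
  have [i _ Fi] : (\bigcup_i F i) (g t).1 by rewrite -TF.
  have [j _ Gj] : (\bigcup_j G j) (g t).2 by rewrite -TG.
  exists (maxn i j) => //; split.
  - by move: Fi; exact/subsetPset/ndF/leq_maxl.
  - by move: Gj; exact/subsetPset/ndG/leq_maxr.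
move=> n; have [mF Fn] := Foo n; have [mG Gn] := Goo n; split.
  by rewrite -[X in measurable X]setTI; apply: mg => //; exact: measurableX.
rewrite /image_product -comp_preimage (_ : g \o f = id) ?preimage_id.
  by rewrite product_measure1E// lte_mul_pinfty// ge0_fin_numE.
by apply/funext => x; exact: fK.
Qed.

HB.instance Definition _ := @Measure_isSigmaFinite.Build _ _ _ nu
  nu_sigma_finite.

Lemma integral_image_product (h : T3 -> \bar R) :
  measurable_fun setT h -> (forall x, 0 <= h x) ->
  \int[nu]_x h x = \int[m1]_x \int[m2]_y h (f (x, y)).
Proof.
move=> mh h0.
have -> : \int[nu]_x h x = \int[m1 \x m2]_p (h \o f) p.
  by rewrite -(@ge0_integral_pushforward _ _ _ _ _ _ mf (m1 \x m2) setT h).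
rewrite fubini_tonelli1//; last by move=> x; exact: h0.
exact: measurableT_comp.
Qed.

End image_product_measure.

Section leb.
Context {R : realType}.
Implicit Types k : nat.

Definition consp k (p : measurableTypeR R * k.-tuple R) : k.+1.-tuple R :=
  cons_tuple p.1 p.2.

Definition unconsp k (t : k.+1.-tuple R) : measurableTypeR R * k.-tuple R :=
  (thead t, behead_tuple t).

Lemma measurable_consp k : measurable_fun setT (@consp k).
Proof. exact: (measurable_cons measurable_fst measurable_snd). Qed.

Lemma measurable_unconsp k : measurable_fun setT (@unconsp k).
Proof.
apply: measurable_fun_pair; first exact: (measurable_tnth ord0).
exact: measurable_behead.
Qed.

Lemma conspK k : cancel (@consp k) (@unconsp k).
Proof. by case=> x t; rewrite /unconsp theadE; congr pair; apply/val_inj. Qed.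

Lemma unconspK k : cancel (@unconsp k) (@consp k).
Proof. by move=> t; rewrite [RHS]tuple_eta; apply/val_inj. Qed.

(** [leb_int] is only an iterated integral. This measure represents it on nonnegative measurable
    functions, which gives access to monotone convergence, null sets and densities. In dimension 0
    it is the unit mass at the empty tuple. *)
Fixpoint leb k : {sigma_finite_measure set (k.-tuple R) -> \bar R} :=
  match k with
  | 0 => \d_([tuple] : 0.-tuple R)
  | k'.+1 => image_product (@lebesgue_measure R) (leb k') (@measurable_consp k')
      (@measurable_unconsp k') (@conspK k') (@unconspK k')
  end.

Lemma measurable_fun_cons k d (T : measurableType d) (f : k.+1.-tuple R -> T) x :
  measurable_fun setT f ->
  measurable_fun setT (fun t : k.-tuple R => f (cons_tuple x t)).
Proof.
move=> mf; apply: (measurableT_comp mf).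
by apply: measurable_cons; [exact: measurable_cst|exact: measurable_id].
Qed.

Lemma leb_intE k (f : k.-tuple R -> \bar R) :
  measurable_fun setT f -> (forall x, 0 <= f x)%E ->
  leb_int f = (\int[leb k]_x f x)%E.
Proof.
elim: k f => [|k IH] f mf f0 /=.
  by rewrite integral_dirac// diracT mul1e.
rewrite integral_image_product//; apply: eq_integral => x _; apply: IH => //.
exact: measurable_fun_cons.
Qed.

End leb.

Section invariance.
Context {R : realType}.
Local Notation leb := (@leb R).

Lemma lebesgue_measureD (a : R) (A : set (measurableTypeR R)) : measurable A ->
  @lebesgue_measure R A =
  pushforward (@lebesgue_measure R) (fun x : measurableTypeR R => x + a : measurableTypeR R) A.
Proof.
move=> mA.
have mD : measurable_fun setT (fun x : measurableTypeR R => x + a : measurableTypeR R).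
  exact: measurable_funD.
apply: (@lebesgue_measure_unique R (pushforward (@lebesgue_measure R) _)) => //.
move=> _ [[b c]] _ <- /=.
transitivity (@lebesgue_measure R `](b - a), (c - a)]%classic).
  rewrite !lebesgue_measure_itv/= !lte_fin ltrD2r -!EFinB.
  by rewrite opprB addrA subrK.
congr lebesgue_measure; apply/seteqP.
by split => x /=; rewrite !in_itv /= ltrBlDr lerBrDr.
Qed.

(** Phrased with integrals and not with sets, so that it can be applied inside an iterated integral,
    one coordinate at a time. *)
Definition preserves_lebesgue (phi : R -> R) :=
  measurable_fun setT phi /\
  forall f : R -> \bar R, measurable_fun setT f -> (forall x, 0 <= f x)%E ->
  (\int[@lebesgue_measure R]_x f (phi x) = \int[@lebesgue_measure R]_x f x)%E.

Lemma preserves_lebesgueD a : preserves_lebesgue (fun x => x + a).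
Proof.
have mD : measurable_fun setT (fun x : measurableTypeR R => x + a : measurableTypeR R).
  exact: measurable_funD.
split => // f mf f0.
rewrite -[LHS](@ge0_integral_pushforward _ _ _ _ _ _ mD (@lebesgue_measure R) setT f)//.
by apply: eq_measure_integral => A mA _; exact/esym/lebesgue_measureD.
Qed.

Lemma preserves_lebesgueN : preserves_lebesgue -%R.
Proof.
have mN : measurable_fun setT (fun x : measurableTypeR R => - x : measurableTypeR R).
  exact: measurableT_comp.
split => // f mf f0.
rewrite -[LHS](@ge0_integral_pushforward _ _ _ _ _ _ mN (@lebesgue_measure R) setT f)//.
by apply: eq_measure_integral => A mA _; exact: lebesgue_measureN.
Qed.

Definition tuple_act k (phi : 'I_k -> R -> R) (t : k.-tuple R) : k.-tuple R :=
  [tuple phi j (tnth t j) | j < k].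

Lemma tuple_act_cons k (phi : 'I_k.+1 -> R -> R) x (t : k.-tuple R) :
  tuple_act phi (cons_tuple x t) =
  cons_tuple (phi ord0 x) (tuple_act (fun j => phi (lift ord0 j)) t).
Proof.
apply: eq_from_tnth => i; rewrite tnth_mktuple.
case: (unliftP ord0 i) => [j|] ->; last by rewrite !tnth0.
by rewrite !tnthS tnth_mktuple.
Qed.

Lemma measurable_tuple_act k (phi : 'I_k -> R -> R) :
  (forall j, measurable_fun setT (phi j)) -> measurable_fun setT (tuple_act phi).
Proof.
move=> mphi; apply/measurable_fun_tnthP => i.
rewrite (_ : _ \o _ = phi i \o (@tnth k R ^~ i)).
  by apply: measurableT_comp => //; exact: measurable_tnth.
by apply/funext => t /=; rewrite tnth_mktuple.
Qed.

Lemma measurable_fun_integral_leb_cons k (f : k.+1.-tuple R -> \bar R) :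
  measurable_fun setT f -> (forall x, 0 <= f x)%E ->
  measurable_fun setT (fun x : measurableTypeR R => \int[leb k]_t f (cons_tuple x t))%E.
Proof.
move=> mf f0.
apply: (@measurable_fun_fubini_tonelli_F _ _ _ _ _ (leb k) (f \o @consp R k)) => //.
  by apply: measurableT_comp => //; exact: measurable_consp.
by move=> x; exact: f0.
Qed.

Lemma integral_leb_cons k (f : k.+1.-tuple R -> \bar R) :
  measurable_fun setT f -> (forall x, 0 <= f x)%E ->
  (\int[leb k.+1]_x f x =
   \int[@lebesgue_measure R]_x \int[leb k]_t f (cons_tuple x t))%E.
Proof. by move=> mf f0; rewrite integral_image_product. Qed.

Lemma integral_tuple_act k (phi : 'I_k -> R -> R) (f : k.-tuple R -> \bar R) :
  (forall j, preserves_lebesgue (phi j)) ->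
  measurable_fun setT f -> (forall x, 0 <= f x)%E ->
  (\int[leb k]_t f (tuple_act phi t) = \int[leb k]_t f t)%E.
Proof.
elim: k phi f => [|k IH] phi f hphi mf f0.
  by apply: eq_integral => t _; congr f; rewrite [RHS]tuple0 [LHS]tuple0.
have mact : measurable_fun setT (tuple_act phi).
  by apply: measurable_tuple_act => j; have [] := hphi j.
rewrite !integral_leb_cons//; last by apply: measurableT_comp.
under eq_integral do under eq_integral do rewrite tuple_act_cons.
under eq_integral => x _.
  rewrite (IH _ (fun t => f (cons_tuple (phi ord0 x) t)))//; last first.
    exact: measurable_fun_cons.
  over.
have [_ /(_ (fun x => \int[leb k]_t f (cons_tuple x t))%E) -> //] := hphi ord0.
  exact: measurable_fun_integral_leb_cons.
by move=> x; apply: integral_ge0.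
Qed.

(** With an indicator as factor this gives the volume of a cube, with a Gaussian factor the
    integrability of [exp (- f)] for a coercive [f]. *)
Lemma integral_leb_prod k (g : R -> R) (r : R) :
  measurable_fun setT g -> (forall x, 0 <= g x) ->
  (\int[@lebesgue_measure R]_x (g x)%:E = r%:E)%E ->
  (\int[leb k]_t (\prod_(j < k) g (tnth t j))%:E = (r ^+ k)%:E)%E.
Proof.
move=> mg g0 gr; elim: k => [|k IH].
  under eq_integral do rewrite big_ord0.
  by rewrite integral_dirac// diracT mul1e.
rewrite integral_leb_cons; last 2 first.
- apply/measurable_EFinP; apply: measurable_prod => j _.
  by apply: measurableT_comp => //; exact: measurable_tnth.
- by move=> t; rewrite lee_fin prodr_ge0.
under eq_integral => x _.
  under eq_integral => t _.
    rewrite big_ord_recl tnth0.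
    under eq_bigr do rewrite tnthS.
    rewrite EFinM; over.
  rewrite ge0_integralZl_EFin//; last 2 first.
  - by move=> t _; rewrite lee_fin prodr_ge0.
  - apply/measurable_EFinP; apply: measurable_prod => j _.
    by apply: measurableT_comp => //; exact: measurable_tnth.
  rewrite IH; over.
rewrite ge0_integralZr//; last 3 first.
- by apply/measurable_EFinP.
- by move=> x _; rewrite lee_fin.
- rewrite lee_fin exprn_ge0//.
  by rewrite -lee_fin -gr; apply: integral_ge0 => x _; rewrite lee_fin.
by rewrite gr -EFinM exprS.
Qed.

End invariance.

(** * Densities and mixtures *)

Lemma cvg_integral_nondecreasing d (T : measurableType d) (R : realType)
    (m : {measure set T -> \bar R}) (g_ : (T -> \bar R)^nat) (g : T -> \bar R) :
  (forall n, measurable_fun setT (g_ n)) -> (forall n x, 0 <= g_ n x)%E ->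
  (forall x, {homo g_ ^~ x : p q / (p <= q)%N >-> (p <= q)%E}) ->
  (forall x, g_ n x @[n --> \oo] --> g x) ->
  (\int[m]_x g_ n x @[n --> \oo] --> \int[m]_x g x)%E.
Proof.
move=> mg g0 ndg gcvg.
have -> : g = fun x => limn (g_ ^~ x).
  by apply/funext => x; apply/esym/cvg_lim => //; exact: gcvg.
by apply: cvg_monotone_convergence => // x _; exact: ndg.
Qed.

Section nonneg_measurable_ind.
Local Open Scope ereal_scope.
Context d (T : measurableType d) (R : realType).
Implicit Types f g : T -> \bar R.

Import HBNNSimple.

(** Every nonnegative measurable function is an increasing limit of simple functions, and these are
    finite sums of multiples of indicators. The integral formulas for densities and for mixtures
    follow by this principle, because both sides respect these constructions. *)
Lemma nonneg_measurable_ind (K : (T -> \bar R) -> Prop) :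
  (forall A, measurable A -> K (fun x => (\1_A x)%:E)) ->
  (forall (k : R) f, (0 <= k)%R -> measurable_fun setT f ->
    (forall x, 0 <= f x) -> K f -> K (fun x => k%:E * f x)) ->
  (forall f g, measurable_fun setT f -> measurable_fun setT g ->
    (forall x, 0 <= f x) -> (forall x, 0 <= g x) ->
    K f -> K g -> K (fun x => f x + g x)) ->
  (forall (f_ : (T -> \bar R)^nat) f, (forall n, measurable_fun setT (f_ n)) ->
    (forall n x, 0 <= f_ n x) ->
    (forall x, {homo f_ ^~ x : p q / (p <= q)%N >-> p <= q}) ->
    (forall n, K (f_ n)) -> (forall x, f_ n x @[n --> \oo] --> f x) -> K f) ->
  forall f, measurable_fun setT f -> (forall x, 0 <= f x) -> K f.
Proof.
move=> K1 KZ KD Klim f mf f0; pose f_ := nnsfun_approx measurableT mf.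
apply: (Klim (fun n x => (f_ n x)%:E)).
- by move=> n; exact/measurable_EFinP.
- by move=> n x; rewrite lee_fin.
- by move=> x p q pq; rewrite lee_fin; exact/lefP/nd_nnsfun_approx.
- move=> n; rewrite (_ : (fun x => _) = fun x => \sum_(r <- fset_set (range (f_ n)))
      (r * \1_(f_ n @^-1` [set r]) x)%:E); last first.
    apply/funext => x; rewrite fimfunE fsbig_finite//= sumEFin.
    by [].
  set s := fset_set _.
  have s0 r : r \in enum_fset s -> (0 <= r)%R.
    rewrite -[_ \in _]/(r \in s).
    by rewrite /s in_fset_set// inE => -[x _ <-].
  elim: (enum_fset s) s0 => [_|r s' IH s0].
    under eq_fun do rewrite big_nil.
    have := K1 set0 measurable0.
    by congr K; apply/funext => x; rewrite indic0.
  under eq_fun do rewrite big_cons.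
  have r0 : (0 <= r)%R by apply: s0; rewrite mem_head.
  have s'0 t : t \in s' -> (0 <= t)%R.
    by move=> ts; apply: s0; rewrite inE ts orbT.
  have mi t : measurable_fun setT (fun x => (t * \1_(f_ n @^-1` [set t]) x)%:E).
    exact/measurable_EFinP/measurable_funM.
  apply: KD => //.
  + exact: emeasurable_sum.
  + by move=> x; rewrite lee_fin mulr_ge0.
  + move=> x; rewrite big_seq; apply: sume_ge0 => t ts.
    by rewrite lee_fin mulr_ge0// s'0.
  + under eq_fun do rewrite EFinM.
    by apply: KZ => //; [exact/measurable_EFinP|exact: K1].
  + exact: IH.
- by move=> x; exact: cvg_nnsfun_approx.
Qed.

End nonneg_measurable_ind.

Section density.
Local Open Scope ereal_scope.
Context d (T : measurableType d) (R : realType).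
Variables (m : {measure set T -> \bar R}) (rho : T -> R).
Hypotheses (mrho : measurable_fun setT rho) (rho0 : forall x, (0 <= rho x)%R).

Let mrhoE (D : set T) : measurable_fun D (EFin \o rho).
Proof. exact/measurable_EFinP/measurable_funTS. Qed.

Lemma integral_density (nu : {measure set T -> \bar R}) (f : T -> \bar R) :
  (forall A, measurable A -> nu A = \int[m]_(x in A) (rho x)%:E) ->
  measurable_fun setT f -> (forall x, 0 <= f x) ->
  \int[nu]_x f x = \int[m]_x (f x * (rho x)%:E).
Proof.
move=> nuE; move: f; apply: nonneg_measurable_ind => [A mA|k g k0 mg g0 IH|g h mg mh g0 h0 IHg IHh|
    g_ g mg_ g_0 ndg IH gcvg].
- rewrite integral_indic// setIT nuE// integral_mkcond.
  apply: eq_integral => x _; rewrite patchE indicE.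
  by case: ifPn; rewrite ?mul1e ?mul0e.
- rewrite ge0_integralZl ?lee_fin// IH.
  under [in RHS]eq_integral do rewrite -muleA.
  rewrite ge0_integralZl ?lee_fin//; first exact: emeasurable_funM.
  by move=> x _; rewrite mule_ge0// lee_fin.
- rewrite ge0_integralD// IHg IHh -ge0_integralD//.
  + by apply: eq_integral => x _; rewrite ge0_muleDl.
  + by move=> x _; rewrite mule_ge0// lee_fin.
  + exact: emeasurable_funM.
  + by move=> x _; rewrite mule_ge0// lee_fin.
  + exact: emeasurable_funM.
- have /cvg_lim <- // := @cvg_integral_nondecreasing _ _ _ nu _ _ mg_ g_0 ndg gcvg.
  apply/cvg_lim => //.
  under eq_fun do rewrite IH.
  apply: cvg_integral_nondecreasing => [n|n x|x p q pq|x].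
  + exact: emeasurable_funM.
  + by rewrite mule_ge0// lee_fin.
  + by rewrite lee_wpmul2r ?lee_fin//; exact: ndg.
  + exact: cvgeZr.
Qed.

Lemma density_probability : \int[m]_x (rho x)%:E = 1 ->
  exists P : probability T R,
    forall A, P A = \int[m]_(x in A) (rho x)%:E.
Proof.
move=> rho1; pose nu (A : set T) : \bar R := \int[m]_(x in A) (rho x)%:E.
have nu0 : nu set0 = 0 by rewrite /nu integral_set0.
have nu_ge0 A : 0 <= nu A by apply: integral_ge0 => x _; rewrite lee_fin.
have nuS : semi_sigma_additive nu.
  move=> A mA tA mUA; rewrite /nu ge0_integral_bigcup//; last first.
    by move=> x _; rewrite lee_fin.
  by apply: is_cvg_ereal_nneg_natsum_cond => n _ _; exact: nu_ge0.
pose nuM := isMeasure.Build _ _ _ nu nu0 nu_ge0 nuS.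
pose N : {measure set T -> \bar R} := HB.pack nu nuM.
pose nuP := @Measure_isProbability.Build _ _ R N rho1.
pose P : probability T R := HB.pack (Measure.sort N) nuP.
by exists P.
Qed.

End density.

Section mixture.
Local Open Scope ereal_scope.
Context d (T : measurableType d) (R : realType) (I : finType).
Variables (a : I -> R) (P : I -> probability T R).
Hypotheses (a0 : forall i, (0 <= a i)%R) (a1 : (\sum_i a i = 1)%R).

Lemma mixture_probability : exists M : probability T R,
  forall A, measurable A -> M A = \sum_i (a i)%:E * P i A.
Proof.
pose nu (A : set T) : \bar R := \sum_i (a i)%:E * P i A.
have nu0 : nu set0 = 0.
  by rewrite /nu big1// => i _; rewrite measure0 mule0.
have nu_ge0 A : 0 <= nu A.
  by apply: sume_ge0 => i _; rewrite mule_ge0// lee_fin.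
have nuS : semi_sigma_additive nu.
  move=> A mA tA mUA; rewrite /nu.
  rewrite [X in X @ _ --> _](_ : _ = fun n => \sum_i
      ((a i)%:E * \sum_(0 <= k < n) P i (A k))); last first.
    apply/funext => n; rewrite exchange_big/=; apply: eq_bigr => i _.
    by rewrite ge0_sume_distrr.
  apply: cvg_nnesum => //.
    by move=> i _; near=> n; rewrite mule_ge0 ?lee_fin// sume_ge0.
  by move=> i _; apply: cvgeZl => //; exact: measure_semi_sigma_additive.
have nuT : nu setT = 1.
  rewrite /nu; under eq_bigr do rewrite probability_setT mule1.
  by rewrite sumEFin a1.
pose nuM := isMeasure.Build _ _ _ nu nu0 nu_ge0 nuS.
pose N : {measure set T -> \bar R} := HB.pack nu nuM.
pose nuP := @Measure_isProbability.Build _ _ R N nuT.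
pose M : probability T R := HB.pack (Measure.sort N) nuP.
by exists M.
Unshelve. all: by end_near.
Qed.

Lemma integral_mixture (M : {measure set T -> \bar R}) (f : T -> \bar R) :
  (forall A, measurable A -> M A = \sum_i (a i)%:E * P i A) ->
  measurable_fun setT f -> (forall x, 0 <= f x) ->
  \int[M]_x f x = \sum_i (a i)%:E * \int[P i]_x f x.
Proof.
move=> ME; move: f; apply: nonneg_measurable_ind => [A mA|k g k0 mg g0 IH|g h mg mh g0 h0 IHg IHh|
    g_ g mg_ g_0 ndg IH gcvg].
- rewrite integral_indic// setIT ME//; apply: eq_bigr => i _.
  by rewrite integral_indic// setIT.
- rewrite ge0_integralZl ?lee_fin// IH ge0_sume_distrr; last first.
    by move=> i _; rewrite mule_ge0 ?lee_fin// integral_ge0.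
  by apply: eq_bigr => i _; rewrite ge0_integralZl ?lee_fin// muleCA.
- rewrite ge0_integralD// IHg IHh -big_split/=; apply: eq_bigr => i _.
  by rewrite ge0_integralD//; apply/esym/ge0_muleDr; exact: integral_ge0.
- have /cvg_lim <- // := @cvg_integral_nondecreasing _ _ _ M _ _ mg_ g_0 ndg gcvg.
  apply/cvg_lim => //.
  under eq_fun do rewrite IH.
  apply: cvg_nnesum => i _.
    by near=> n; rewrite mule_ge0 ?lee_fin// integral_ge0.
  by apply: cvgeZl => //; exact: cvg_integral_nondecreasing.
Unshelve. all: by end_near.
Qed.

End mixture.

(** * Blocks and independent couplings *)

Section image_probability.
Context d d' (T : measurableType d) (T' : measurableType d') (R : realType).

Lemma image_probability (P : probability T R) (f : T -> T') :
  measurable_fun setT f ->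
  exists P' : probability T' R, forall A, P' A = P (f @^-1` A).
Proof.
move=> mf; pose F : {mfun T >-> T'} := HB.pack f (isMeasurableFun.Build _ _ _ _ f mf).
by exists (distribution P F).
Qed.

Lemma integral_image (P : {measure set T -> \bar R}) (P' : {measure set T' -> \bar R})
    (f : T -> T') (g : T' -> \bar R) :
  measurable_fun setT f -> (forall A, measurable A -> P' A = P (f @^-1` A)) ->
  measurable_fun setT g -> (forall x, 0 <= g x)%E ->
  (\int[P']_x g x = \int[P]_x g (f x))%E.
Proof.
move=> mf PE mg g0.
rewrite -[RHS](@ge0_integral_pushforward _ _ _ _ _ _ mf P setT g)//.
by apply: eq_measure_integral => A mA _; exact: PE.
Qed.

End image_probability.

Section blocks.
Context {R : realType} {n : nat} {d : 'I_n -> nat}.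
Local Notation E := (Espace R d).
Implicit Types (x : E) (i : 'I_n).

(** [tagnat] enumerates the pairs of a block and an index in it; [val_bidx] says that its
    enumeration is the one by [offset] behind [proj]. *)
Definition bidx i (j : 'I_(d i)) : 'I_(dimE d) := tagnat.Rank i j.

Lemma val_bidx i (j : 'I_(d i)) : bidx j = (offset d i + j)%N :> nat.
Proof. exact: tagnat.RankEsum. Qed.

Lemma tnth_proj i x (j : 'I_(d i)) : tnth (proj i x) j = tnth x (bidx j).
Proof. by rewrite tnth_mktuple (tnth_nth 0) val_bidx. Qed.

Lemma sum_blocks (V : nmodType) (F : 'I_(dimE d) -> V) :
  \sum_a F a = \sum_i \sum_(j < d i) F (bidx j).
Proof.
rewrite sig_big_dep/= (reindex _ tagnat.sig_bij_on)/=.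
by apply: eq_bigr => a _; rewrite /bidx tagnat.sig2K.
Qed.

Definition joint (y : forall i, (d i).-tuple R) : E :=
  [tuple tnth (y (tagnat.sig1 a)) (tagnat.sig2 a) | a < dimE d].

Lemma tnth_joint y i (j : 'I_(d i)) : tnth (joint y) (bidx j) = tnth (y i) j.
Proof.
rewrite tnth_mktuple /bidx /tagnat.sig1 /tagnat.sig2 /tagnat.Rank.
by rewrite tagnat.rankK.
Qed.

Lemma proj_joint y i : proj i (joint y) = y i.
Proof. by apply: eq_from_tnth => j; rewrite tnth_proj tnth_joint. Qed.

Lemma eq_proj x x' : (forall i, proj i x = proj i x') -> x = x'.
Proof.
move=> e; apply: eq_from_tnth => a; rewrite -(tagnat.sig2K a).
by rewrite -/(bidx _) -!tnth_proj e.
Qed.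

Lemma measurable_proj i : measurable_fun setT (@proj R n d i).
Proof.
apply/measurable_fun_tnthP => j.
rewrite (_ : _ \o _ = (@tnth _ R ^~ (bidx j))); first exact: measurable_tnth.
by apply/funext => x /=; rewrite tnth_proj.
Qed.

Lemma measurable_joint dT (T : measurableType dT) (y : T -> forall i, (d i).-tuple R) :
  (forall i, measurable_fun setT (fun t => y t i)) ->
  measurable_fun setT (fun t => joint (y t)).
Proof.
move=> my; apply/measurable_fun_tnthP => a.
rewrite (_ : _ \o _ = (@tnth _ R ^~ (tagnat.sig2 a)) \o (fun t => y t (tagnat.sig1 a))).
  apply: measurableT_comp; [exact: measurable_tnth|exact: my].
by apply/funext => t /=; rewrite tnth_mktuple.
Qed.

Definition upd x i (y : (d i).-tuple R) : E := joint (dfwith (fun k => proj k x) i y).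

Lemma proj_upd x i (y : (d i).-tuple R) : proj i (upd x y) = y.
Proof. by rewrite proj_joint dfwithin. Qed.

Lemma proj_upd_neq x i (y : (d i).-tuple R) k : i != k -> proj k (upd x y) = proj k x.
Proof. by move=> ik; rewrite proj_joint dfwithout. Qed.

Lemma measurable_upd i :
  measurable_fun setT (fun p : E * (d i).-tuple R => upd p.1 p.2).
Proof.
apply: measurable_joint => k; case: (eqVneq i k) => [ik|ik].
  case: k / ik.
  under eq_fun do rewrite dfwithin.
  exact: measurable_snd.
under eq_fun do rewrite dfwithout//.
by apply: measurableT_comp; [exact: measurable_proj|exact: measurable_fst].
Qed.

(** The blocks are made independent one at a time: the law obtained so far is multiplied by [nu i0],
    and the product is pushed forward by the map that overwrites block [i0]. Only binary products of
    measures occur, and the starting law is arbitrary, since all blocks get overwritten. *)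
Lemma independent_coupling (nu : forall i, probability ((d i).-tuple R) R) :
  exists P : probability E R,
    forall i A, measurable A -> P (proj i @^-1` A) = nu i A.
Proof.
suff H k : (k <= n)%N -> exists P : probability E R,
    forall i A, (i < k)%N -> measurable A -> P (proj i @^-1` A) = nu i A.
  by have [P HP] := H n (leqnn n); exists P => i A mA; exact: HP.
elim: k => [_|k IH kn].
  by exists (\d_(joint (fun i => [tuple 0 | j < d i]))).
have [P HP] := IH (ltnW kn).
pose i0 := Ordinal kn.
have [P' HP'] := image_probability (P \x nu i0)%E (@measurable_upd i0).
exists P' => i A; rewrite ltnS leq_eqVlt => ik mA.
rewrite HP'; case: (eqVneq i i0) => [ii0|ii0].
  move: ii0 A mA => -> A mA.
  rewrite (_ : _ @^-1` _ = setT `*` A); last first.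
    by apply/seteqP; split => -[x y]/=; rewrite proj_upd => // -[].
  rewrite [LHS](product_measure1E P (nu i0))//.
  by rewrite [X in (X * _)%E]probability_setT mul1e.
rewrite (_ : _ @^-1` _ = (proj i @^-1` A) `*` setT); last first.
  by apply/seteqP; split => -[x y]/=; rewrite proj_upd_neq ?(eq_sym i0)// => -[].
rewrite [LHS](product_measure1E P (nu i0))//; last first.
  by rewrite -[X in measurable X]setTI; exact: measurable_proj.
rewrite [X in (_ * X)%E]probability_setT mule1; apply: HP => //.
by case/orP: ik => // /eqP ik; case/eqP: ii0; exact/val_inj.
Qed.

End blocks.

(** * Farkas' lemma and finite transport duality *)

Section farkas.
Context {F : realFieldType} {V : lmodType F}.

Definition linear_form (f : V -> F) := forall a x y, f (a *: x + y) = a * f x + f y.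

Lemma linear_form0 f : linear_form f -> f 0 = 0.
Proof.
move=> lf; have := lf 1 0 0; rewrite scaler0 addr0 mul1r => e.
by apply: (addrI (f 0)); rewrite -e addr0.
Qed.

Lemma linear_formZ f a x : linear_form f -> f (a *: x) = a * f x.
Proof. by move=> lf; have := lf a x 0; rewrite addr0 (linear_form0 lf) addr0. Qed.

Lemma linear_formB f x y : linear_form f -> f (x - y) = f x - f y.
Proof. by move=> lf; rewrite addrC -scaleN1r lf mulN1r addrC. Qed.

(* Induction on [m]: if the first form is needed, project onto its kernel along a
   vector [h] on which the other forms are nonpositive and [gamma] is positive. *)
Lemma farkas_ord m (alpha : 'I_m -> V -> F) (gamma : V -> F) :
  (forall j, linear_form (alpha j)) -> linear_form gamma ->
  (forall x, (forall j, alpha j x <= 0) -> gamma x <= 0) ->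
  exists2 lambda : 'I_m -> F, (forall j, 0 <= lambda j) &
    forall x, gamma x = \sum_j lambda j * alpha j x.
Proof.
elim: m alpha gamma => [|m IH] alpha gamma la lg H.
  exists (fun=> 0) => // x; rewrite big_ord0; apply/eqP; rewrite eq_le.
  rewrite H ?andTb; last by case.
  rewrite -oppr_le0 -mulN1r -linear_formZ//.
  by apply: H; case.
case: (pselect (forall x, (forall j, alpha (lift ord0 j) x <= 0) -> gamma x <= 0)).
  move=> /(IH _ _ (fun j => la _) lg)[lam lam0 Hlam].
  exists (fun j => if unlift ord0 j is Some j' then lam j' else 0).
    by move=> j; case: unlift.
  move=> x; rewrite Hlam big_ord_recl unlift_none mul0r add0r.
  by apply: eq_bigr => j _; rewrite liftK.
move=> /existsNP[z /not_implyP[az /negP]]; rewrite -ltNge => gz.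
have a0z : 0 < alpha ord0 z.
  rewrite ltNge; apply/negP => a0z; move: gz; rewrite ltNge H// => j.
  by case: (unliftP ord0 j) => [j'|] ->.
pose h := (alpha ord0 z)^-1 *: z.
have a0h : alpha ord0 h = 1 by rewrite linear_formZ// mulVf// gt_eqF.
have gh : 0 <= gamma h by rewrite linear_formZ// mulr_ge0 ?invr_ge0 ?ltW.
have ah j : alpha (lift ord0 j) h <= 0.
  by rewrite linear_formZ// mulr_ge0_le0// invr_ge0 ltW.
pose P x := x - alpha ord0 x *: h.
have lP f : linear_form f -> linear_form (f \o P).
  move=> lf a x y; rewrite /= /P !linear_formB// !linear_formZ// !la !lf.
  ring.
have [lam lam0 Hlam] : exists2 lambda : 'I_m -> F, (forall j, 0 <= lambda j) &
    forall x, (gamma \o P) x = \sum_j lambda j * (alpha (lift ord0 j) \o P) x.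
  apply: IH => [j||x Hx]; [exact: lP|exact: lP|].
  apply: H => j; case: (unliftP ord0 j) => [j'|] ->; first exact: Hx.
  by rewrite linear_formB// linear_formZ// a0h mulr1 subrr.
(* The multiplier of the first form makes the identity hold at [h] too; it is nonnegative by the
   signs of [gamma] and of the other forms at [h]. *)
exists (fun j => if unlift ord0 j is Some j' then lam j' else
    gamma h - \sum_j lam j * alpha (lift ord0 j) h).
  move=> j; case: unlift => //=; rewrite subr_ge0 (le_trans _ gh)//.
  by apply: sumr_le0 => i _; rewrite mulr_ge0_le0.
move=> x; rewrite big_ord_recl /= unlift_none.
rewrite [X in _ = _ + X](eq_bigr (fun j => lam j * alpha (lift ord0 j) x)); last first.
  by move=> j _; rewrite liftK.
have := Hlam x; rewrite /= linear_formB// linear_formZ// => /eqP.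
rewrite subr_eq => /eqP ->.
under eq_bigr do rewrite linear_formB// linear_formZ// mulrBr mulrCA.
rewrite sumrB -mulr_sumr; ring.
Qed.

Lemma farkas (I : finType) (alpha : I -> V -> F) (gamma : V -> F) :
  (forall j, linear_form (alpha j)) -> linear_form gamma ->
  (forall x, (forall j, alpha j x <= 0) -> gamma x <= 0) ->
  exists2 lambda : I -> F, (forall j, 0 <= lambda j) &
    forall x, gamma x = \sum_j lambda j * alpha j x.
Proof.
move=> la lg H.
have [||lam lam0 Hlam] := @farkas_ord _ (fun k : 'I_#|I| => alpha (enum_val k)) gamma _ lg.
- by move=> j; exact: la.
- move=> x Hx; apply: H => j; have := Hx (enum_rank j); by rewrite enum_rankK.
exists (fun j => lam (enum_rank j)) => // x.
rewrite Hlam [RHS](reindex _ (onW_bij _ (@enum_val_bij I)))/=.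
by apply: eq_bigr => k _; rewrite enum_valK.
Qed.

End farkas.

Lemma sum_option (V : nmodType) (I : finType) (F : option I -> V) :
  \sum_o F o = F None + \sum_i F (Some i).
Proof.
rewrite (bigD1 None)//= (reindex_omap Some id)/=; last by case.
by congr (_ + _); apply: eq_bigl => i; rewrite eqxx.
Qed.

Section transport_duality.
Context {R : realType} {n : nat} {K : finType}.
Variables (m : 'I_n.+1 -> K -> R) (w : {ffun 'I_n.+1 -> K} -> R).
Hypotheses (m0 : forall i k, 0 <= m i k) (m1 : forall i, \sum_k m i k = 1).
Local Notation cell := {ffun 'I_n.+1 -> K}.
Implicit Types (phi : 'I_n.+1 -> K -> R) (c : cell).

Definition has_marginals (pi : cell -> R) :=
  forall i k, \sum_(c : cell | c i == k) pi c = m i k.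

Lemma sum_potentials pi phi : has_marginals pi ->
  \sum_c pi c * \sum_i phi i (c i) = \sum_i \sum_k phi i k * m i k.
Proof.
move=> mpi; under eq_bigr do rewrite mulr_sumr.
rewrite exchange_big/=; apply: eq_bigr => i _.
rewrite (partition_big (fun c : cell => c i) predT)//=; apply: eq_bigr => k _.
rewrite -mpi mulr_sumr; apply: eq_bigr => c /eqP ->.
by rewrite mulrC.
Qed.

(** Averaging the constraints on the potentials with these weights bounds the dual objective from
    below, so its infimum is finite. *)
Lemma prod_has_marginals : has_marginals (fun c => \prod_i m i (c i)).
Proof.
move=> i k.
(* [F] carries the restriction [c i == k] into the [i]-th factor, so that the sum runs over all
   cells and factorizes. *)
pose F j k' : R := if j == i then (if k' == k then m j k' else 0) else m j k'.
transitivity (\sum_(c : cell) \prod_j F j (c j)).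
  rewrite big_mkcond; apply: eq_bigr => c _.
  case: ifPn => cik.
    apply: eq_bigr => j _; rewrite /F; case: eqVneq => // ->.
    by rewrite cik.
  by rewrite (bigD1 i)//= /F eqxx (negbTE cik) mul0r.
rewrite -bigA_distr_bigA (bigD1 i)//= [X in _ * X]big1 ?mulr1.
  by rewrite /F eqxx -big_mkcond big_pred1_eq.
by move=> j ji; rewrite /F (negbTE ji) m1.
Qed.

(* Farkas' lemma for the form [(phi, t) |-> t * inf S - J phi], which is nonpositive
   on the cone [t * w c <= \sum_i phi i (c i)], [0 <= t]. *)
Theorem transport_duality (e : R) : 0 < e ->
  exists pi phi, [/\ forall c, 0 <= pi c, has_marginals pi,
    forall c, w c <= \sum_i phi i (c i) &
    \sum_i \sum_k phi i k * m i k <= \sum_c pi c * w c + e].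
Proof.
move=> e0.
pose feasible phi := forall c, w c <= \sum_i phi i (c i).
pose J phi := \sum_i \sum_k phi i k * m i k.
pose P c := \prod_i m i (c i).
have P0 c : 0 <= P c by apply: prodr_ge0.
have JP phi : J phi = \sum_c P c * \sum_i phi i (c i).
  by rewrite (sum_potentials _ prod_has_marginals).
pose S := [set J phi | phi in feasible].
have infS : has_inf S.
  split.
    (* A feasible choice: one potential is a constant above every [w c], the others vanish. *)
    exists (J (fun i _ => if i == ord0 then \sum_c `|w c| else 0)).
    exists (fun i _ => if i == ord0 then \sum_c `|w c| else 0) => // c.
    rewrite -big_mkcond big_pred1_eq (le_trans (ler_norm _))//.
    by rewrite (bigD1 c)//= lerDl sumr_ge0.
  exists (\sum_c P c * w c) => _ [phi phiF <-].
  by rewrite JP ler_sum// => c _; rewrite ler_wpM2l.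
pose V : lmodType R := ({ffun 'I_n.+1 * K -> R^o} * R^o)%type.
pose pot (v : V) i k : R := v.1 (i, k).
pose alpha (o : option cell) (v : V) : R :=
  if o is Some c then v.2 * w c - \sum_i pot v i (c i) else - v.2.
pose gamma (v : V) : R := v.2 * inf S - J (pot v).
have potE a x y i k : pot (a *: x + y) i k = a * pot x i k + pot y i k.
  by rewrite /pot /= !ffunE.
have sndE a (x y : V) : (a *: x + y).2 = a * (x.2 : R) + y.2 by [].
have la o : linear_form (alpha o).
  move=> a x y; case: o => [c|]; rewrite /alpha sndE; last by rewrite opprD mulrN.
  under eq_bigr do rewrite potE.
  rewrite big_split/= -mulr_sumr; ring.
have lg : linear_form gamma.
  move=> a x y; rewrite /gamma /J sndE.
  under eq_bigr do under eq_bigr do rewrite potE mulrDl -mulrA.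
  under eq_bigr do rewrite big_split/= -mulr_sumr.
  rewrite big_split/= -mulr_sumr; ring.
have [v Hv|lam lam0 Hlam] := farkas la lg.
  have v2 : 0 <= v.2 by have := Hv None; rewrite /= oppr_le0.
  rewrite /gamma subr_le0.
  have Hv' c : v.2 * w c <= \sum_i pot v i (c i).
    by have := Hv (Some c); rewrite /= subr_le0.
  (* For [v.2 = 0] the constraints say that the sums of potentials are nonnegative, hence so is
     their average [J]; for [v.2 > 0] one divides by it. *)
  move: v2; rewrite le_eqVlt => /predU1P[v20|v2].
    rewrite -v20 mul0r JP sumr_ge0// => c _; rewrite mulr_ge0//.
    by have := Hv' c; rewrite -v20 mul0r.
  rewrite -ler_pdivlMl//; apply: (ge_inf infS.2).
  exists (fun i k => (v.2)^-1 * pot v i k).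
    by move=> c; rewrite -mulr_sumr ler_pdivlMl.
  rewrite /J mulr_sumr; apply: eq_bigr => i _; rewrite mulr_sumr.
  by apply: eq_bigr => k _; rewrite mulrA.
have [_ [phi phiF <-] Jphi] := inf_adherent e0 infS.
(* The multipliers of the cells form the plan. Evaluated at unit potentials, the identity of forms
   yields its marginals; evaluated at [(0, 1)], it shows that the cost of the plan is at least the
   infimum. *)
exists (fun c => lam (Some c)), phi; split => //.
- move=> i k.
  pose v : V := ([ffun p => (p == (i, k))%:R], 0).
  have := Hlam v; rewrite /gamma mul0r sub0r.
  have -> : J (pot v) = m i k.
    rewrite /J (bigD1 i)//= (bigD1 k)//= big1 ?addr0; last first.
      by move=> k' k'k; rewrite /pot ffunE xpair_eqE (negbTE k'k) andbF mul0r.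
    rewrite big1 ?addr0; last first.
      move=> i' i'i; rewrite big1// => k' _.
      by rewrite /pot ffunE xpair_eqE (negbTE i'i) mul0r.
    by rewrite /pot ffunE eqxx mul1r.
  rewrite sum_option /= oppr0 mulr0 add0r => /eqP; rewrite eqr_oppLR => /eqP ->.
  rewrite big_mkcond -sumrN; apply: eq_bigr => c _.
  rewrite mul0r sub0r mulrN opprK (bigD1 i)//= big1 ?addr0.
    by rewrite /pot ffunE xpair_eqE eqxx /=; case: eqP; rewrite ?mulr1 ?mulr0.
  by move=> i' i'i; rewrite /pot ffunE xpair_eqE (negbTE i'i).
- apply: (le_trans (ltW Jphi)); rewrite lerD2r.
  have := Hlam (0, 1); rewrite /gamma mul1r.
  have pot0 i k : pot (0, 1) i k = 0 by rewrite /pot ffunE.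
  have -> : J (pot (0, 1)) = 0.
    by rewrite /J big1// => i _; rewrite big1// => k _; rewrite pot0 mul0r.
  rewrite subr0 sum_option /= => ->.
  rewrite mulrN1 (eq_bigr (fun c => lam (Some c) * w c)); last first.
    by move=> c _; rewrite mul1r big1 ?subr0.
  by rewrite gerDr oppr_le0.
Qed.

End transport_duality.

(** * Entropy *)

Section integral_transfer.
Local Open Scope ereal_scope.

(** Positive and negative parts are compared separately, so infinite integrals on either side are
    covered. Gibbs' inequality relies on this, as an entropy may be [-oo]. *)
Lemma le_integralT d (T : measurableType d) (R : realType)
    (m : {measure set T -> \bar R}) (f g : T -> \bar R) :
  measurable_fun setT f -> measurable_fun setT g -> (forall x, f x <= g x) ->
  \int[m]_x f x <= \int[m]_x g x.
Proof.
move=> mf mg fg; rewrite integralE [leRHS]integralE; apply: leeB.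
  apply: ge0_le_integral => //; [exact: measurable_funepos|
    exact: measurable_funepos|].
  by move=> x _; rewrite !funeposE ge_max !le_max lexx orbT fg.
apply: ge0_le_integral => //; [exact: measurable_funeneg|
  exact: measurable_funeneg|].
by move=> x _; rewrite !funenegE ge_max !le_max lexx orbT leeN2 fg.
Qed.

Lemma funepos_EFin (T : Type) (R : realDomainType) (f : T -> R) x :
  (fun x => (f x)%:E)^\+ x = (Num.max (f x) 0)%:E.
Proof. by rewrite funeposE EFin_max. Qed.

Lemma funeneg_EFin (T : Type) (R : realDomainType) (f : T -> R) x :
  (fun x => (f x)%:E)^\- x = (Num.max (- f x) 0)%:E.
Proof. by rewrite funenegE EFin_max. Qed.

Lemma integral_imageT d d' (T : measurableType d) (T' : measurableType d') (R : realType)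
    (P : {measure set T -> \bar R}) (P' : {measure set T' -> \bar R})
    (f : T -> T') (g : T' -> \bar R) :
  measurable_fun setT f -> (forall A, measurable A -> P' A = P (f @^-1` A)) ->
  measurable_fun setT g ->
  \int[P']_x g x = \int[P]_x g (f x).
Proof.
move=> mf PE mg; rewrite integralE [RHS](integralE _ _ (g \o f)).
rewrite (integral_image mf PE (measurable_funepos mg))//.
rewrite (integral_image mf PE (measurable_funeneg mg))//.
by rewrite (funepos_comp g f) (funeneg_comp g f).
Qed.

Lemma integrable_image d d' (T : measurableType d) (T' : measurableType d') (R : realType)
    (P : {measure set T -> \bar R}) (P' : {measure set T' -> \bar R})
    (f : T -> T') (g : T' -> \bar R) :
  measurable_fun setT f -> (forall A, measurable A -> P' A = P (f @^-1` A)) ->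
  P'.-integrable setT g -> P.-integrable setT (g \o f).
Proof.
move=> mf PE /integrableP[mg ig]; apply/integrableP; split.
  exact: measurableT_comp mg mf.
rewrite -(integral_image mf PE (g := fun x => `|g x|))//.
exact: measurableT_comp mg.
Qed.

Lemma integral_densityT d (T : measurableType d) (R : realType)
    (m nu : {measure set T -> \bar R}) (rho f : T -> R) :
  measurable_fun setT rho -> (forall x, 0 <= rho x)%R ->
  (forall A, measurable A -> nu A = \int[m]_(x in A) (rho x)%:E) ->
  measurable_fun setT f ->
  \int[nu]_x (f x)%:E = \int[m]_x (f x * rho x)%:E.
Proof.
move=> mrho rho0 nuE mf; rewrite integralE [RHS]integralE.
have mfE : measurable_fun setT (fun x => (f x)%:E) by exact/measurable_EFinP.
rewrite (integral_density mrho rho0 nuE (measurable_funepos mfE))//.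
rewrite (integral_density mrho rho0 nuE (measurable_funeneg mfE))//.
congr (_ - _); apply: eq_integral => x _.
  by rewrite !funepos_EFin -EFinM maxr_pMl// mul0r.
by rewrite !funeneg_EFin -EFinM maxr_pMl// mul0r mulNr.
Qed.

Lemma integrable_density d (T : measurableType d) (R : realType)
    (m nu : {measure set T -> \bar R}) (rho f : T -> R) :
  measurable_fun setT rho -> (forall x, 0 <= rho x)%R ->
  (forall A, measurable A -> nu A = \int[m]_(x in A) (rho x)%:E) ->
  nu.-integrable setT (fun x => (f x)%:E) ->
  m.-integrable setT (fun x => (f x * rho x)%:E).
Proof.
move=> mrho rho0 nuE /integrableP[mf fi]; apply/integrableP; split.
  by apply/measurable_EFinP/measurable_funM => //; exact/measurable_EFinP.
move: fi; rewrite (integral_density mrho rho0 nuE)//; last exact: measurableT_comp mf.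
move=> fi; under eq_integral => x _.
  rewrite EFinM abseM (@gee0_abs _ (rho x)%:E) ?lee_fin//; over.
exact: fi.
Qed.

End integral_transfer.

Section entropy.
Context {R : realType}.
Implicit Types (k : nat).

Lemma leb_int_EFin k (f : k.-tuple R -> R) :
  measurable_fun setT f -> (forall x, 0 <= f x) ->
  leb_int (fun x => (f x)%:E) = (\int[@leb R k]_x (f x)%:E)%E.
Proof.
by move=> mf f0; rewrite leb_intE//; exact/measurable_EFinP.
Qed.

Lemma dens_measE k (rho : k.-tuple R -> R) A : measurable_fun setT rho ->
  (forall x, 0 <= rho x) -> measurable A ->
  dens_meas rho A = (\int[@leb R k]_(x in A) (rho x)%:E)%E.
Proof.
move=> mrho rho0 mA; rewrite /dens_meas leb_int_EFin.
- rewrite [RHS]integral_mkcond; apply: eq_integral => x _.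
  by rewrite patchE indicE; case: ifPn; rewrite ?mul1r ?mul0r.
- by apply: measurable_funM.
- by move=> x; rewrite mulr_ge0.
Qed.

Lemma measurable_xlnx k (rho : k.-tuple R -> R) : measurable_fun setT rho ->
  measurable_fun setT (fun x => rho x * ln (rho x)).
Proof.
by move=> mrho; apply: measurable_funM => //; exact: measurableT_comp.
Qed.

Lemma entropyE k (rho : k.-tuple R -> R) : measurable_fun setT rho ->
  entropy rho = (\int[@leb R k]_x (- (rho x * ln (rho x)))%:E)%E.
Proof.
move=> mrho; rewrite integralE /entropy.
have mx := measurable_xlnx mrho.
have mN : measurable_fun setT (fun x => - (rho x * ln (rho x))) by exact: measurableT_comp.
rewrite !leb_int_EFin; last 4 first.
- by apply: measurable_maxr; [exact: mx|exact: measurable_cst].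
- by move=> x; rewrite le_max lexx orbT.
- by apply: measurable_maxr; [exact: mN|exact: measurable_cst].
- by move=> x; rewrite le_max lexx orbT.
congr (_ - _)%E; apply: eq_integral => x _.
  by rewrite funepos_EFin.
by rewrite funeneg_EFin opprK.
Qed.

Lemma Pdens_probability k (rho : k.-tuple R -> R) : is_Pdens rho ->
  exists P : probability (k.-tuple R) R,
    [/\ forall A, measurable A -> P A = (\int[@leb R k]_(x in A) (rho x)%:E)%E,
     forall A, measurable A -> P A = dens_meas rho A &
     P.-integrable setT (fun x => (sqnorm x)%:E)].
Proof.
move=> [mrho rho0 rho1 rho2].
have [|P HP] := @density_probability _ _ _ (@leb R k) _ mrho rho0.
  by rewrite -leb_int_EFin.
exists P; split => //; first by move=> A mA; rewrite dens_measE.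
have msq : measurable_fun setT (@sqnorm R k).
  apply: measurable_sum => j; apply: measurable_funX; exact: measurable_tnth.
have sq0 x : 0 <= @sqnorm R k x by apply: sumr_ge0 => j _; exact: sqr_ge0.
apply/integrableP; split; first exact/measurable_EFinP.
under eq_integral do rewrite gee0_abs ?lee_fin//.
rewrite (integral_density mrho rho0 (fun A _ => HP A)) => //; last first.
  exact/measurable_EFinP.
move: rho2; rewrite leb_int_EFin.
- apply: le_lt_trans; rewrite le_eqVlt; apply/orP; left; apply/eqP.
  by apply: eq_integral => x _; rewrite mulrC EFinM.
- exact: measurable_funM.
- by move=> x; rewrite mulr_ge0.
Qed.

End entropy.

Section gibbs.
Context {R : realType}.
Local Notation leb := (@leb R).

(** The integrand is positive everywhere, so a zero integral would make Lebesgue measure null,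
    against the total mass 1 of [rho]. *)
Lemma integral_expR_gt0 k (rho f : k.-tuple R -> R) :
  is_Pdens rho -> measurable_fun setT f ->
  (0 < \int[leb k]_x (expR (- f x))%:E)%E.
Proof.
move=> [mrho rho0 rho1 _] mf; rewrite lt0e integral_ge0 ?andbT; last first.
  by move=> x _; rewrite lee_fin expR_ge0.
apply/eqP => e0.
have me : measurable_fun setT (fun x => (expR (- f x))%:E).
  by apply/measurable_EFinP; do 2!apply: measurableT_comp => //.
have /ae_eq_integral_abs : (\int[leb k]_x `|(expR (- f x))%:E| = 0)%E.
  by under eq_integral do rewrite gee0_abs ?lee_fin ?expR_ge0//.
move=> /(_ measurableT me) ae0.
have : (\int[leb k]_x (rho x)%:E = \int[leb k]_x cst 0 x)%E.
  apply: ae_eq_integral => //; first exact/measurable_EFinP.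
  apply: filterS ae0 => x /(_ I) /eqP; rewrite eqe => /eqP /= e.
  by have := expR_gt0 (- f x); rewrite e ltxx.
by rewrite -leb_int_EFin// rho1 integral0 => /eqP; rewrite onee_eq0.
Qed.

(** Put [s = - f - ln z - ln rho]. Multiplying [1 + s <= exp s] by [rho] gives [- rho * ln rho <= f
    * rho + (ln z - 1) * rho + exp (- f) / z]. The last two terms integrate to [ln z - 1] and to
    1. *)
Lemma gibbs k (rho f : k.-tuple R -> R) (P : probability (k.-tuple R) R) (z : R) :
  is_Pdens rho ->
  (forall A, measurable A -> P A = \int[leb k]_(x in A) (rho x)%:E)%E ->
  P.-integrable setT (fun x => (f x)%:E) ->
  leb_int (fun x => (expR (- f x))%:E) = z%:E ->
  0 < z /\ (entropy rho <= \int[P]_x (f x)%:E + (ln z)%:E)%E.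
Proof.
move=> Hrho HP fi.
have mf : measurable_fun setT f by apply/measurable_EFinP; case/integrableP: fi.
have [mrho rho0 rho1 _] := Hrho.
have me : measurable_fun setT (fun x => expR (- f x)).
  by do 2!apply: measurableT_comp => //.
rewrite leb_int_EFin; [|exact: me|by move=> x; rewrite expR_ge0].
move=> Zz.
have z0 : 0 < z by rewrite -lte_fin -Zz (integral_expR_gt0 Hrho).
split=> //; rewrite entropyE//.
have rhoi : (leb k).-integrable setT (fun x => (rho x)%:E).
  apply/integrableP; split; first exact/measurable_EFinP.
  under eq_integral do rewrite gee0_abs ?lee_fin//.
  by rewrite -leb_int_EFin// rho1 ltry.
have frhoi := integrable_density mrho rho0 HP fi.
have ei : (leb k).-integrable setT (fun x => (expR (- f x))%:E).
  apply/integrableP; split; first exact/measurable_EFinP.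
  under eq_integral do rewrite gee0_abs ?lee_fin ?expR_ge0//.
  by rewrite Zz ltry.
pose h1 x : \bar R := ((ln z - 1)%:E * (rho x)%:E)%E.
pose h2 x : \bar R := ((z^-1)%:E * (expR (- f x))%:E)%E.
have h1i : (leb k).-integrable setT h1 by exact: integrableZl.
have h2i : (leb k).-integrable setT h2 by exact: integrableZl.
apply: (@le_trans _ _ (\int[leb k]_x ((f x * rho x)%:E + (h1 x + h2 x)))%E).
  apply: le_integralT.
  - by apply/measurable_EFinP; apply: measurableT_comp => //; exact: measurable_xlnx.
  - apply: emeasurable_funD; first by case/integrableP: frhoi.
    by apply: emeasurable_funD; [case/integrableP: h1i|case/integrableP: h2i].
  move=> x; rewrite /h1 /h2 -!EFinM -!EFinD lee_fin.
  have := rho0 x; rewrite le_eqVlt => /predU1P[<-|rx].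
    by rewrite !mul0r !mulr0 oppr0 !add0r mulr_ge0 ?invr_ge0 ?expR_ge0 ?ltW.
  have -> : z^-1 * expR (- f x) = rho x * expR (- f x - ln z - ln (rho x)).
    rewrite expRD expRD !expRN !lnK ?posrE// mulrCA mulfV ?gt_eqF// mulr1.
    by rewrite mulrC.
  have := ler_wpM2l (ltW rx) (expR_ge1Dx (- f x - ln z - ln (rho x))).
  lra.
rewrite integralD//; last exact: integrableD.
rewrite integralD// -(integral_densityT mrho rho0 HP)// integralZl// integralZl//.
rewrite Zz -leb_int_EFin// rho1 mule1 -EFinM mulVf ?gt_eqF// -EFinD subrK.
exact: lexx.
Qed.

End gibbs.

(** * Bounds on the quadratic form *)

Section quadratic.
Context {R : realType} {n : nat} {d : 'I_n -> nat}.
Local Notation E := (Espace R d).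
Implicit Types (x y : E) (Q : 'M[R]_(dimE d)).

(** The summand 1 keeps it positive, so that one can divide by it even when [Q = 0]. *)
Definition qnorm Q : R := 1 + \sum_a \sum_b `|Q a b|.

Lemma qnorm_gt0 Q : 0 < qnorm Q.
Proof.
by rewrite ltr_wpDr ?ltr01// sumr_ge0// => a _; exact: sumr_ge0.
Qed.

Lemma quad_lipschitz Q x y (S : R) : 0 <= S ->
  (forall a b, `|tnth x a * tnth x b - tnth y a * tnth y b| <= S) ->
  `|quad Q x - quad Q y| <= qnorm Q * S.
Proof.
move=> S0 H; rewrite /quad -sumrB.
apply: (@le_trans _ _ (\sum_a \sum_b `|Q a b| * S)); last first.
  under eq_bigr do rewrite -mulr_suml.
  by rewrite -mulr_suml ler_wpM2r// /qnorm lerDr.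
apply: le_trans (ler_norm_sum _ _ _) _; apply: ler_sum => a _.
rewrite -sumrB; apply: le_trans (ler_norm_sum _ _ _) _; apply: ler_sum => b _.
rewrite [X in `|X - _|]mulrAC [X in `|_ - X|]mulrAC -mulrBl mulrC normrM.
by rewrite ler_wpM2l.
Qed.

Lemma measurable_quad Q : measurable_fun setT (@quad R n d Q).
Proof.
apply: measurable_sum => a; apply: measurable_sum => b.
by apply: measurable_funM; [apply: measurable_funM => //|]; exact: measurable_tnth.
Qed.

Definition sqE x : R := \sum_(i < n) sqnorm (proj i x).

Lemma sqEE x : sqE x = \sum_a tnth x a ^+ 2.
Proof.
rewrite sum_blocks; apply: eq_bigr => i _; apply: eq_bigr => j _.
by rewrite tnth_proj.
Qed.

Lemma sqE_ge x a : tnth x a ^+ 2 <= sqE x.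
Proof.
by rewrite sqEE (bigD1 a)//= lerDl sumr_ge0// => b _; exact: sqr_ge0.
Qed.

Lemma quad0 Q : quad Q (joint (fun i => [tuple 0 | j < d i]) : E) = 0.
Proof.
rewrite /quad big1// => a _; rewrite big1// => b _.
by rewrite !tnth_mktuple !mul0r.
Qed.

Lemma quad_bound Q x : `|quad Q x| <= qnorm Q * sqE x.
Proof.
rewrite -[quad Q x]subr0 -[X in _ - X](quad0 Q); apply: quad_lipschitz.
  by rewrite sumr_ge0// => i _; rewrite sumr_ge0// => j _; exact: sqr_ge0.
move=> a b; rewrite !tnth_mktuple mul0r subr0 normrM.
have := sqE_ge x a; have := sqE_ge x b; rewrite -!(real_normK (num_real (tnth _ _))).
by have := sqr_ge0 (`|tnth x a| - `|tnth x b|); nra.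
Qed.

Lemma young (eta t w : R) : 0 < eta ->
  `|t * w| <= (eta * t ^+ 2 + eta^-1 * w ^+ 2) / 2.
Proof.
move=> e0; have ev : eta * eta^-1 = 1 by rewrite mulfV// gt_eqF.
have H s : eta * t ^+ 2 + eta^-1 * s ^+ 2 - 2 * (t * s) =
    eta * (t - eta^-1 * s) ^+ 2.
  rewrite [RHS](_ : _ = eta * t ^+ 2 - 2 * (eta * eta^-1) * (t * s)
    + (eta * eta^-1) * (eta^-1 * s ^+ 2)); last by ring.
  by rewrite ev; ring.
have H0 s : 0 <= eta * (t - eta^-1 * s) ^+ 2 by rewrite mulr_ge0 ?sqr_ge0// ltW.
have := H0 w; rewrite -H; have := H0 (- w); rewrite -H sqrrN mulrN.
by rewrite ler_norml => *; apply/andP; split; lra.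
Qed.

(** An error [u - v] in one factor of a product is multiplied by the other factor, which is
    unbounded. Young's inequality pays for that with an arbitrarily small multiple of [u ^+ 2], at
    the price of the large weight [1 + eta^-1] on the squared displacement. Here [v] will be the
    quantized value of [u]. *)
Definition quad_error (eta u v : R) : R := eta * u ^+ 2 + (1 + eta^-1) * (u - v) ^+ 2.

Lemma quad_error_ge0 eta u v : 0 < eta -> 0 <= quad_error eta u v.
Proof.
move=> e0; rewrite addr_ge0// mulr_ge0 ?sqr_ge0 ?ltW// addr_gt0// invr_gt0//.
Qed.

Lemma quad_approx Q x y (eta : R) : 0 < eta ->
  `|quad Q x - quad Q y| <=
    qnorm Q * \sum_a quad_error eta (tnth x a) (tnth y a).
Proof.
move=> e0; apply: quad_lipschitz.
  by apply: sumr_ge0 => a _; exact: quad_error_ge0.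
move=> a b; pose g a := quad_error eta (tnth x a) (tnth y a).
have g_le c : g c <= \sum_a g a.
  by rewrite (bigD1 c)//= lerDl sumr_ge0// => c' _; exact: quad_error_ge0.
apply: (@le_trans _ _ ((g a + g b) / 2)); last first.
  by rewrite ler_pdivrMr// mulr_natr mulr2n lerD.
rewrite /g /quad_error.
move: (tnth x a) (tnth x b) (tnth y a) (tnth y b) => p q r s.
(* Only [p] and [q], never [r] and [s], multiply a displacement, so the error bound is quadratic in
   the original point and not in the quantized one. *)
have -> : p * q - r * s = p * (q - s) + (p - r) * q - (p - r) * (q - s) by ring.
move: (p - r) (q - s) => u v.
apply: le_trans (ler_normB _ _) _; apply: le_trans (lerD (ler_normD _ _) (lexx _)) _.
have := young p v e0; have := young q u e0; have := @young 1 u v ltr01.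
rewrite invr1 [q * u]mulrC; lra.
Qed.

End quadratic.

(** * Discretization *)

Section quantizer.
Context {R : realType}.
Implicit Types (N : nat) (x : R).

(** The interval from [- N.+1] to [N.+1] is cut into this many cells of width [1 / N.+1]. *)
Definition code_size N := (2 * N.+1 ^ 2)%N.

(* [ord_max] encodes all the points outside the box. *)
Definition code N x : 'I_(code_size N).+1 :=
  if `|x| < N.+1%:R then inord (Num.truncn ((x + N.+1%:R) * N.+1%:R)) else ord_max.

Definition decode N (k : 'I_(code_size N).+1) : R :=
  if k == ord_max then 0 else k%:R / N.+1%:R - N.+1%:R.

Let pos N x : `|x| < N.+1%:R -> 0 <= (x + N.+1%:R) * N.+1%:R.
Proof.
rewrite ltr_norml => /andP[xl _]; rewrite mulr_ge0//.
by rewrite -lerBlDr sub0r ltW.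
Qed.

Let lt_size N x : `|x| < N.+1%:R ->
  (Num.truncn ((x + N.+1%:R) * N.+1%:R)%R < code_size N)%N.
Proof.
move=> xN; rewrite truncn_lt_nat ?pos// /code_size natrM natrX.
move: xN; rewrite ltr_norml => /andP[_ xr].
have N0 : 0 < N.+1%:R :> R by [].
nra.
Qed.

Let code_in N x : `|x| < N.+1%:R ->
  code N x = Num.truncn ((x + N.+1%:R) * N.+1%:R) :> nat.
Proof. by move=> xN; rewrite /code xN inordK// ltnS ltnW// lt_size. Qed.

(** In the box the decoded value is the left end of the cell, at distance at most one cell width.
    Outside, it is 0 and the whole of [x] is lost, which the second moment will control. *)
Lemma decode_err N x :
  (x - decode (code N x)) ^+ 2 <= (N.+1%:R ^+ 2)^-1 + x ^+ 2 * (N.+1%:R <= `|x|)%R%:R.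
Proof.
have N0 : 0 < N.+1%:R :> R by [].
case: (ltP `|x| N.+1%:R) => xN; last first.
  rewrite /code ltNge xN/= /decode eqxx subr0 mulr1 lerDr.
  by rewrite invr_ge0 sqr_ge0.
have -> : decode (code N x) = (code N x)%:R / N.+1%:R - N.+1%:R.
  rewrite /decode ifF//; apply/negbTE; rewrite -val_eqE /= code_in//.
  by rewrite neq_ltn lt_size.
rewrite mulr0 addr0 code_in//.
have /andP[] := truncn_itv (pos xN).
set k := Num.truncn _; set t : R := k%:R; rewrite -[k.+1]addn1 natrD -/t => t1 t2.
have -> : x - (t / N.+1%:R - N.+1%:R) = ((x + N.+1%:R) * N.+1%:R - t) / N.+1%:R.
  by field; rewrite gt_eqF.
rewrite -exprVn ler_sqr ?nnegrE ?invr_ge0//; last by rewrite divr_ge0// subr_ge0.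
by rewrite ler_pdivrMr// mulVf ?gt_eqF//; lra.
Qed.

Lemma measurable_code N k : measurable (code N @^-1` [set k]).
Proof.
have N0 : 0 < N.+1%:R :> R by [].
pose A := [set x : R | `|x| < N.+1%:R].
pose f x := (x + N.+1%:R) * N.+1%:R.
have mA : measurable A.
  rewrite (_ : A = (fun x : R => `|x|) @^-1` `]-oo, N.+1%:R[%classic).
    by rewrite -[X in measurable X]setTI; apply: (measurableT_comp (f := fun x : R => `|x|)) => //.
  by apply/seteqP; split => x; rewrite /A /= in_itv.
have mf : measurable_fun setT f.
  by apply: measurable_funM => //; exact: measurable_funD.
rewrite (_ : _ @^-1` _ = (A `&` f @^-1` `[k%:R, k.+1%:R[%classic) `|`
    (if k == ord_max then ~` A else set0)).
  apply: measurableU; last by case: ifP => // _; exact: measurableC.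
  by apply: measurableI => //; rewrite -[X in measurable X]setTI; exact: mf.
apply/seteqP; split => x.
  move=> /= <-; case: (ltP `|x| N.+1%:R) => xN.
    by left; split => //; rewrite /= in_itv /= code_in// truncn_itv// pos.
  by right; rewrite {1}/code ltNge xN /= eqxx /A /= => /lt_geF; rewrite xN.
case=> [[xN /=]|].
  rewrite in_itv/= -truncn_eq ?pos// => /eqP e.
  by apply/val_inj; rewrite /= code_in.
by case: eqP => // -> /negP; rewrite /= /code => /negbTE ->.
Qed.

End quantizer.

Section finite_code.
Context dT (T : measurableType dT) (K : finType) (kappa : T -> K).
Hypothesis mkappa : forall k, measurable (kappa @^-1` [set k]).

Lemma measurable_fun_coded d' (T' : measurableType d') (g : K -> T') :
  measurable_fun setT (g \o kappa).
Proof.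
move=> _ Y mY; rewrite setTI.
rewrite (_ : _ @^-1` _ = \bigcup_(k in [set k | Y (g k)]) (kappa @^-1` [set k])).
  by apply: fin_bigcup_measurable => //; exact: finite_finset.
apply/seteqP; split => [x Yx|x [k /= Yk xk]]; last by rewrite /= xk.
by exists (kappa x).
Qed.

End finite_code.

Section quantization_error.
Context {R : realType} {k : nat}.
Local Notation E := (k.-tuple R).

Definition tau N (x : R) : R := decode (code N x).

Lemma measurable_tau N : measurable_fun setT (tau N).
Proof. exact: (measurable_fun_coded (@measurable_code R N)). Qed.

Definition quant_err N (x : E) : R := \sum_(j < k) (tnth x j - tau N (tnth x j)) ^+ 2.

Lemma quant_err_ge0 N x : 0 <= quant_err N x.
Proof. by apply: sumr_ge0 => j _; exact: sqr_ge0. Qed.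

Lemma measurable_quant_err N : measurable_fun setT (quant_err N).
Proof.
apply: measurable_sum => j; apply: measurable_funX; apply: measurable_funB.
  exact: measurable_tnth.
by apply: measurableT_comp; [exact: measurable_tau|exact: measurable_tnth].
Qed.

Lemma quant_err_le N x : quant_err N x <= k%:R + sqnorm x.
Proof.
have -> : k%:R + sqnorm x = \sum_(j < k) (1 + tnth x j ^+ 2).
  by rewrite big_split/= sumr_const card_ord.
apply: ler_sum => j _; apply: le_trans (decode_err _ _) _; apply: lerD.
  by rewrite invf_le1 ?exprn_gt0// expr_ge1// ler1n.
by rewrite ler_piMr ?sqr_ge0 ?lern1 ?leq_b1.
Qed.

Lemma cvg_quant_err (x : E) : quant_err N x @[N --> \oo] --> 0.
Proof.
apply/cvgrPdist_lt => e e0; have ek : 0 < e / k.+1%:R by rewrite divr_gt0.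
near=> N; rewrite sub0r normrN ger0_norm ?quant_err_ge0//.
have N1 : N.+1%:R^-1 < e / k.+1%:R.
  by near: N; exact: (near_infty_natSinv_lt (PosNum ek)).
have xN j : `|tnth x j| < N.+1%:R.
  apply: (@le_lt_trans _ _ (\sum_(j < k) `|tnth x j|)).
    by rewrite (bigD1 j)//= lerDl sumr_ge0.
  apply: (@lt_trans _ _ N%:R); last by rewrite ltr_nat.
  by near: N; exact: nbhs_infty_gtr.
apply: (@le_lt_trans _ _ (\sum_(j < k) N.+1%:R^-1)).
  apply: ler_sum => j _; apply: le_trans (decode_err _ _) _.
  rewrite [(_ <= `|_|)%R]leNgt xN mulr0 addr0 lef_pV2 ?posrE ?exprn_gt0//.
  by rewrite expr2 ler_peMl ?ler1n.
rewrite sumr_const card_ord -[_ *+ _]mulr_natl.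
apply: (@le_lt_trans _ _ (k.+1%:R * N.+1%:R^-1)); last by rewrite mulrC -ltr_pdivlMr.
by rewrite ler_wpM2r ?invr_ge0// ler_nat.
Unshelve. all: by end_near.
Qed.

(** Dominated convergence under the bound [quant_err_le], which is uniform in [N]: this is where
    finite second moments make the discretization error small. *)
Lemma cvg_integral_quant_err (P : probability E R) :
  P.-integrable setT (fun x => (sqnorm x)%:E) ->
  (\int[P]_x (quant_err N x)%:E @[N --> \oo] --> 0)%E.
Proof.
move=> sqi.
rewrite [X in _ --> X](_ : 0%E = \int[P]_x (cst 0 x))%E; last by rewrite integral0.
have [] := @dominated_convergence _ _ _ P _ measurableT
  (fun N x => (quant_err N x)%:E) (cst 0%E) (fun x => (k%:R + sqnorm x)%:E) => //.
- by move=> N; apply/measurable_EFinP; exact: measurable_quant_err.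
- apply: aeW => x _; apply: cvg_EFin; [by near=> N|exact: cvg_quant_err].
- have -> : (fun x : E => (k%:R + sqnorm x)%:E) =
      (cst k%:R%:E \+ (fun x => (sqnorm x)%:E))%E by apply/funext => x.
  apply: integrableD => //.
  exact: finite_measure_integrable_cst.
- by apply: aeW => x N _; rewrite gee0_abs ?lee_fin ?quant_err_ge0// quant_err_le.
Unshelve. all: by end_near.
Qed.

End quantization_error.

(** * Gluing conditional laws along a discrete plan *)

Section conditional.
Local Open Scope ereal_scope.
Context d (T : measurableType d) (R : realType) (P : probability T R).

(** In product form the identity also makes sense on a null set [A], where any law, for instance
    [P], serves as [nu]. *)
Lemma conditional_probability (A : set T) : measurable A ->
  exists nu : probability T R,
    forall B, measurable B -> P A * nu B = P (A `&` B).
Proof.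
move=> mA; have [PA0|PA0] := eqVneq (P A) 0.
  exists P => B mB; rewrite PA0 mul0e; apply/esym/eqP.
  by rewrite eq_le measure_ge0 andbT -PA0 le_measure ?inE//; exact: measurableI.
have PAf : P A \is a fin_num by exact: fin_num_measure.
have PAp : (0 < fine (P A))%R by rewrite fine_gt0// lt0e PA0 measure_ge0 ltey_eq PAf.
pose rho x : R := ((fine (P A))^-1 * \1_A x)%R.
have mrho : measurable_fun setT rho by exact: measurable_funM.
have rho0 x : (0 <= rho x)%R by rewrite mulr_ge0// invr_ge0 ltW.
have Hint B : measurable B -> \int[P]_(x in B) (rho x)%:E = (fine (P A))^-1%:E * P (A `&` B).
  move=> mB; under eq_integral do rewrite EFinM.
  rewrite ge0_integralZl_EFin ?invr_ge0 ?ltW//; last first.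
    by apply/measurable_EFinP; exact: measurable_funTS.
  by rewrite integral_indic//.
have [|nu Hnu] := @density_probability _ _ _ P _ mrho rho0.
  by rewrite Hint// setIT -{2}(fineK PAf) -EFinM mulVf// gt_eqF.
exists nu => B mB; rewrite Hnu Hint// -{1}(fineK PAf) muleA -EFinM mulfV ?gt_eqF//.
by rewrite mul1e.
Qed.

End conditional.

Lemma sum_fibers d (T : measurableType d) (R : realType) (K : finType)
    (m : {measure set T -> \bar R}) (kappa : T -> K) A :
  (forall k, measurable (kappa @^-1` [set k])) -> measurable A ->
  (\sum_k m (A `&` kappa @^-1` [set k]) = m A)%E.
Proof.
move=> mk mA.
have {2}-> : A = \bigcup_(k in [set: K]) (A `&` kappa @^-1` [set k]).
  by rewrite -setI_bigcupr; apply/esym/setIidl => x _; exists (kappa x).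
rewrite measure_fin_bigcup//.
- rewrite [LHS]fsbig_seq ?index_enum_uniq//.
  suff -> : [set` index_enum K] = [set: K] by [].
  by apply/seteqP; split => // k _; exact: mem_index_enum.
- exact: finite_finset.
- by move=> k l _ _ [x [[_ /= <-] [_ /= <-]]].
- by move=> k _; exact: measurableI.
Qed.

Section cell_coupling.
Context {R : realType} {n : nat} {d : 'I_n.+1 -> nat} {K : finType}.
Local Notation E := (Espace R d).
Variables (P : forall i, probability ((d i).-tuple R) R).
Variables (kappa : forall i, (d i).-tuple R -> K).
Hypothesis mkappa : forall i k, measurable (@kappa i @^-1` [set k]).
Variable pi : {ffun 'I_n.+1 -> K} -> R.
Hypotheses (pi0 : forall c, 0 <= pi c)
  (mpi : forall i k, (\sum_(c : {ffun 'I_n.+1 -> K} | c i == k) pi c)%:E =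
    P i (@kappa i @^-1` [set k])).

(** The cells have weights [pi c]; given [c], the blocks are drawn independently, block [i] from
    [P i] conditioned on its cell [c i]. As the marginals of [pi] are the cell masses, the law of
    total probability returns [P i], and a cost that is constant on cells integrates to its discrete
    value. *)
Lemma cell_coupling : exists mu : probability E R,
  (forall i A, measurable A -> mu (proj i @^-1` A) = P i A) /\
  forall W : {ffun 'I_n.+1 -> K} -> R, (forall c, 0 <= W c) ->
    (\int[mu]_x (W [ffun i => kappa (proj i x)])%:E = (\sum_c pi c * W c)%:E)%E.
Proof.
pose nu i k := sval (cid (conditional_probability (P i) (mkappa (i := i) k))).
have Hnu i k B : measurable B ->
    (P i (@kappa i @^-1` [set k]) * nu i k B = P i (@kappa i @^-1` [set k] `&` B))%E.
  by rewrite /nu; case: cid => /= ? /[apply].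
pose M (c : {ffun 'I_n.+1 -> K}) := sval (cid (independent_coupling (fun i => nu i (c i)))).
have HM c i A : measurable A -> M c (proj i @^-1` A) = nu i (c i) A.
  by rewrite /M; case: cid => /= ? /[apply].
have sum_k (F : K -> \bar R) i : (forall k, 0 <= F k)%E ->
    (\sum_c (pi c)%:E * F (c i) = \sum_k P i (@kappa i @^-1` [set k]) * F k)%E.
  move=> F0; rewrite (partition_big (fun c : {ffun 'I_n.+1 -> K} => c i) predT)//=.
  apply: eq_bigr => k _; rewrite -mpi -sumEFin ge0_sume_distrl//.
    by apply: eq_bigr => c /eqP ->.
  by move=> c _; rewrite lee_fin.
have pi1 : \sum_c pi c = 1.
  apply: EFin_inj; rewrite -sumEFin.
  under eq_bigr do rewrite -[(pi _)%:E]mule1.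
  rewrite (sum_k (fun=> 1%E) ord0)//.
  under eq_bigr do rewrite mule1 -[_ @^-1` _]setTI.
  by rewrite sum_fibers; [exact: probability_setT|exact: mkappa|].
have [mu Hmu] := mixture_probability M pi0 pi1.
have mpre i A : measurable A -> measurable (@proj R _ d i @^-1` A).
  by move=> mA; rewrite -[X in measurable X]setTI; exact: measurable_proj.
exists mu; split.
  move=> i A mA; rewrite Hmu; last exact: mpre.
  under eq_bigr do rewrite HM//.
  rewrite (sum_k (fun k => nu i k A))//.
  under eq_bigr do rewrite Hnu// setIC.
  by rewrite sum_fibers//; exact: mkappa.
move=> W W0.
pose kap (x : E) : {ffun 'I_n.+1 -> K} := [ffun i => kappa (proj i x)].
have mkap c : measurable (kap @^-1` [set c]).
  rewrite (_ : _ @^-1` _ = \bigcap_(i in [set: 'I_n.+1])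
      (proj i @^-1` (@kappa i @^-1` [set c i]))).
    apply: fin_bigcap_measurable; first exact: finite_finset.
    by move=> i _; apply: mpre; exact: mkappa.
  apply/seteqP; split => [x /= <- i _|x H]; first by rewrite /= ffunE.
  by apply/ffunP => i; rewrite ffunE; exact: H.
have mW : measurable_fun setT (fun x => (W (kap x))%:E).
  by apply/measurable_EFinP; exact: (measurable_fun_coded mkap).
rewrite (integral_mixture pi0 Hmu)//; last by move=> x; rewrite lee_fin.
rewrite -sumEFin; apply: eq_bigr => c _; rewrite EFinM.
have [->|pic] := eqVneq (pi c) 0; first by rewrite !mul0e.
congr *%E.
(* [pi c] is positive, hence so is the mass of [c i] under [P i], and the conditional law lives on
   that cell. *)
have nu1 i : nu i (c i) (~` (@kappa i @^-1` [set c i])) = 0%E.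
  have := Hnu i (c i) _ (measurableC (mkappa (i := i) (c i))).
  rewrite setICr measure0 => /eqP; rewrite mule_eq0 => /orP[|/eqP//].
  rewrite -mpi eqe (bigD1 c)//= paddr_eq0 ?sumr_ge0//.
  by rewrite (negbTE pic).
transitivity (\int[M c]_x (cst (W c)%:E x))%E; last first.
  by rewrite integral_cst// [X in (_ * X)%E]probability_setT mule1.
apply: ae_eq_integral => //.
have : \forall x \ae M c, forall i, kappa (proj i x) = c i.
  apply: filter_forall => i.
  exists (proj i @^-1` (~` (@kappa i @^-1` [set c i]))); split.
  - by apply: mpre; apply: measurableC; exact: mkappa.
  - by rewrite HM//; apply: measurableC; exact: mkappa.
  - by move=> x.
apply: filterS => x H _ /=; congr (W _)%:E.
by apply/ffunP => i; rewrite ffunE.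
Qed.
End cell_coupling.

(** * Reflection and Gaussian tails *)

Section negation.
Context {R : realType} {k : nat}.
Local Notation E := (k.-tuple R).
Local Notation tneg := (@tneg R k).

Lemma tnth_tneg (x : E) j : tnth (tneg x) j = - tnth x j.
Proof. by rewrite tnth_map. Qed.

Lemma tnegK : involutive tneg.
Proof. by move=> x; apply: eq_from_tnth => j; rewrite !tnth_tneg opprK. Qed.

Lemma tneg_act : tneg = tuple_act (fun=> -%R).
Proof.
by apply/funext => x; apply: eq_from_tnth => j; rewrite tnth_tneg tnth_mktuple.
Qed.

Lemma measurable_tneg : measurable_fun setT tneg.
Proof.
rewrite tneg_act; apply: measurable_tuple_act => j.
by have [] := @preserves_lebesgueN R.
Qed.

Lemma tneg_image (A : set E) : tneg @` A = tneg @^-1` A.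
Proof.
apply/seteqP; split => [_ [x Ax <-]|x Ax] /=; first by rewrite tnegK.
by exists (tneg x) => //; rewrite tnegK.
Qed.

Lemma sqnorm_tneg x : sqnorm (tneg x) = sqnorm x.
Proof. by apply: eq_bigr => j _; rewrite tnth_tneg sqrrN. Qed.

Lemma sqnorm_ge0 (x : E) : 0 <= sqnorm x.
Proof. by apply: sumr_ge0 => j _; exact: sqr_ge0. Qed.

Lemma measurable_sqnorm : measurable_fun setT (@sqnorm R k).
Proof. by apply: measurable_sum => j; apply: measurable_funX; exact: measurable_tnth. Qed.

Lemma integral_leb_tneg (f : E -> \bar R) :
  measurable_fun setT f -> (forall x, 0 <= f x)%E ->
  (\int[leb k]_t f (tneg t) = \int[leb k]_t f t)%E.
Proof.
move=> mf f0; rewrite tneg_act integral_tuple_act//.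
by move=> j; exact: preserves_lebesgueN.
Qed.

(** Coercivity dominates [exp (- f)] by a multiple of a product of one-dimensional Gaussians; (A)
    asks for this integrability of the potentials. *)
Lemma gauss_lty (a b : R) (f : E -> R) : 0 < a -> measurable_fun setT f ->
  (forall x, a * sqnorm x - b <= f x) ->
  (leb_int (fun x => (expR (- f x))%:E) < +oo)%E.
Proof.
move=> a0 mf fge.
have mexp (g : E -> R) : measurable_fun setT g -> measurable_fun setT (fun x => expR (- g x)).
  by move=> mg; do 2!apply: measurableT_comp => //.
rewrite leb_int_EFin; [|exact: mexp|by move=> x; exact: expR_ge0].
pose g (t : R) := expR (- (a * t ^+ 2)).
have mg : measurable_fun setT g.
  by do 2!apply: measurableT_comp => //; apply: measurable_funM => //; exact: measurable_funX.
have g0 t : 0 <= g t by exact: expR_ge0.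
have [r Hr] : exists r, (\int[@lebesgue_measure R]_x (g x)%:E = r%:E)%E.
  (* Standard deviation of the normal law whose density is proportional to [g]:
     [2 * s ^+ 2 = 1 / a]. *)
  pose s := Num.sqrt ((2 * a)^-1).
  have s0 : s != 0 by rewrite gt_eqF// sqrtr_gt0 invr_gt0 mulr_gt0.
  have gE t : g t = (normal_peak s)^-1 * normal_pdf 0 s t.
    rewrite /normal_pdf (negbTE s0) mulrA mulVf ?mul1r; last first.
      by rewrite gt_eqF// normal_peak_gt0.
    rewrite /g /normal_fun; congr expR; rewrite subr0 /s sqr_sqrtr ?invr_ge0 ?mulr_ge0 ?ltW//.
    by field; rewrite gt_eqF.
  exists (normal_peak s)^-1; under eq_integral do rewrite gE EFinM.
  rewrite ge0_integralZl_EFin//; last 3 first.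
  - by move=> x _; rewrite lee_fin normal_pdf_ge0.
  - by apply/measurable_EFinP; exact: measurable_normal_pdf.
  - by rewrite invr_ge0 normal_peak_ge0.
  by rewrite integral_normal_pdf mule1.
have prodE x : \prod_(j < k) g (tnth x j) = expR (- (a * sqnorm x)).
  by rewrite -expR_sum sumrN -mulr_sumr.
apply: (@le_lt_trans _ _ (\int[leb k]_x ((expR b)%:E * (\prod_(j < k) g (tnth x j))%:E))%E).
  apply: le_integralT.
  - by apply/measurable_EFinP; exact: mexp.
  - apply: emeasurable_funM => //; apply/measurable_EFinP.
    apply: measurable_prod => j _; apply: measurableT_comp => //; exact: measurable_tnth.
  - move=> x; rewrite prodE -EFinM lee_fin -expRD ler_expR.
    by have := fge x; lra.
rewrite ge0_integralZl_EFin ?expR_ge0//; last 2 first.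
- by move=> x _; rewrite lee_fin prodr_ge0.
- apply/measurable_EFinP.
  by apply: measurable_prod => j _; apply: measurableT_comp => //; exact: measurable_tnth.
by rewrite (integral_leb_prod _ mg g0 Hr) -EFinM ltry.
Qed.

End negation.

Section coded_integral.
Context dT (T : measurableType dT) {R : realType} (K : finType) (kappa : T -> K).
Hypothesis mkappa : forall k, measurable (kappa @^-1` [set k]).
Variable P : probability T R.

Lemma integrable_coded (g : K -> R) : P.-integrable setT (fun x => (g (kappa x))%:E).
Proof.
apply: measurable_bounded_integrable => //.
- by rewrite ltey_eq fin_num_measure.
- exact: measurable_fun_coded.
exists (\sum_k `|g k|); split; [exact: num_real|] => M /ltW Mg x _ /=.
by rewrite (le_trans _ Mg)// (bigD1 (kappa x))//= lerDl sumr_ge0.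
Qed.

Lemma integral_coded (g : K -> R) :
  (\int[P]_x (g (kappa x))%:E = (\sum_k g k * fine (P (kappa @^-1` [set k])))%:E)%E.
Proof.
transitivity (\int[P]_x (\sum_k (g k)%:E * (\1_(kappa @^-1` [set k]) x)%:E))%E.
  apply: eq_integral => x _; rewrite (bigD1 (kappa x))//= big1 ?adde0.
    by rewrite indicE mem_set// mule1.
  move=> k kx; rewrite indicE memNset ?mule0//= => xk.
  by rewrite xk eqxx in kx.
rewrite integral_sum//; last first.
  move=> k; apply: integrableZl => //; exact: integrable_indic.
rewrite -sumEFin; apply: eq_bigr => k _; rewrite integralZl//; last exact: integrable_indic.
by rewrite integral_indic// setIT EFinM fineK// fin_num_measure.
Qed.

End coded_integral.

Section quad_integrable.
Context {R : realType} {n : nat} {d : 'I_n -> nat}.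
Local Notation E := (Espace R d).

Lemma quad_integrable (Q : 'M[R]_(dimE d)) (mu : {measure set E -> \bar R}) :
  (forall i, mu.-integrable setT (fun x => (sqnorm (proj i x))%:E)) ->
  mu.-integrable setT (fun x => (quad Q x)%:E).
Proof.
move=> sqi.
apply: (@le_integrable _ _ _ mu _ measurableT _
  (fun x => (qnorm Q)%:E * \sum_i (sqnorm (proj i x))%:E)%E).
- by apply/measurable_EFinP; exact: measurable_quad.
- move=> x _; rewrite sumEFin -EFinM abse_EFin lee_fin [leRHS]ger0_norm.
    exact: quad_bound.
  by rewrite mulr_ge0 ?(ltW (qnorm_gt0 _))// sumr_ge0// => i _; exact: sqnorm_ge0.
- apply: integrableZl => //; exact: integrable_sum.
Qed.

Lemma quad_tneg (Q : 'M[R]_(dimE d)) (x : E) : quad Q (tneg x) = quad Q x.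
Proof.
apply: eq_bigr => a _; apply: eq_bigr => b _.
by rewrite !tnth_tneg mulNr mulrN mulNr opprK.
Qed.

Lemma proj_tneg i (x : E) : proj i (tneg x) = tneg (proj i x).
Proof.
by apply: eq_from_tnth => j; rewrite tnth_proj !tnth_tneg tnth_proj.
Qed.

End quad_integrable.

(** * Kantorovich duality *)

Section block_code.
Context {R : realType} {n : nat} {d : 'I_n -> nat} (N : nat).
Local Notation E := (Espace R d).
Local Notation K := {ffun 'I_(dimE d) -> 'I_(code_size N).+1}.

(** The discrete duality has one finite type for all blocks, so a code has an entry for every
    coordinate of [E]. Entries of foreign blocks carry no meaning, and [bdecode] does not read
    them. *)
Definition bcode i (y : (d i).-tuple R) : K :=
  [ffun a => code N (nth 0 y (tagnat.sig2 a))].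

Definition bdecode (c : {ffun 'I_n -> K}) : E :=
  [tuple decode (c (tagnat.sig1 a) a) | a < dimE d].

Lemma tnth_proj_sig (x : E) a : tnth x a = nth 0 (proj (tagnat.sig1 a) x) (tagnat.sig2 a).
Proof.
by rewrite -(tnth_nth 0 (proj (tagnat.sig1 a) x)) tnth_proj /bidx tagnat.sig2K.
Qed.

Lemma tnth_bdecode (x : E) a :
  tnth (bdecode [ffun i => bcode (proj i x)]) a = tau N (tnth x a).
Proof. by rewrite tnth_mktuple !ffunE tnth_proj_sig. Qed.

Lemma measurable_bcode i (k : K) : measurable (@bcode i @^-1` [set k]).
Proof.
rewrite (_ : _ @^-1` _ = \bigcap_(a in [set: 'I_(dimE d)])
    ((fun y : (d i).-tuple R => nth 0 y (tagnat.sig2 a)) @^-1` (code N @^-1` [set k a]))).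
  apply: fin_bigcap_measurable; first exact: finite_finset.
  move=> a _; rewrite -[X in measurable X]setTI.
  suff: measurable_fun setT (fun y : (d i).-tuple R => nth 0 y (tagnat.sig2 a)).
    by apply => //; exact: measurable_code.
  case: (ltnP (tagnat.sig2 a) (d i)) => [lt|ge].
    rewrite (_ : (fun y => _) = (@tnth _ R ^~ (Ordinal lt))).
      exact: measurable_tnth.
    by apply/funext => y; rewrite (tnth_nth 0).
  rewrite (_ : (fun y => _) = cst 0); first exact: measurable_cst.
  by apply/funext => y; rewrite nth_default// size_tuple.
apply/seteqP; split => [y /= <- a _|y H]; first by rewrite /= ffunE.
by apply/ffunP => a; rewrite ffunE; exact: H.
Qed.

End block_code.

Section quant_err_integrable.
Context {R : realType} {k : nat} (P : probability (k.-tuple R) R).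
Hypothesis sqi : P.-integrable setT (fun x => (sqnorm x)%:E).

Lemma integrable_quant_err N : P.-integrable setT (fun x => (quant_err N x)%:E).
Proof.
apply: (@le_integrable _ _ _ P _ measurableT _ (cst k%:R%:E \+ (fun x => (sqnorm x)%:E))%E).
- by apply/measurable_EFinP; exact: measurable_quant_err.
- move=> x _; rewrite [leRHS](_ : _ = `|k%:R + sqnorm x|%:E)// lee_fin.
  rewrite !ger0_norm ?quant_err_ge0//.
    exact: quant_err_le.
  by rewrite addr_ge0// sqnorm_ge0.
- by apply: integrableD => //; exact: finite_measure_integrable_cst.
Qed.

Lemma quant_err_small (e : R) : 0 < e ->
  \forall N \near \oo, (\int[P]_x (quant_err N x)%:E <= e%:E)%E.
Proof.
move=> e0; have /fine_cvgP[Pfin /cvgrPdist_le Pcvg] := cvg_integral_quant_err sqi.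
near=> N.
have Nfin : (\int[P]_x (quant_err N x)%:E)%E \is a fin_num by near: N; exact: Pfin.
rewrite -(fineK Nfin) lee_fin (le_trans (ler_norm _))// -normrN -sub0r.
by near: N; exact: Pcvg.
Unshelve. all: by end_near.
Qed.

End quant_err_integrable.

Section duality.
Context {R : realType} {n : nat} {d : 'I_n.+1 -> nat}.
Local Notation E := (Espace R d).
Variables (c : 'I_n.+1 -> R) (Q : 'M[R]_(dimE d)).
Hypothesis c0 : forall i, 0 < c i.
Variable P : forall i, probability ((d i).-tuple R) R.
Hypothesis sqi : forall i, (P i).-integrable setT (fun x => (sqnorm x)%:E).
Hypothesis Psym : forall i A, measurable A -> P i A = P i (@tneg R (d i) @^-1` A).

Let scaled_small (M : R) (e : R) : 0 < e -> exists2 eta, 0 < eta & qnorm Q * (eta * M) <= e.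
Proof.
move=> e0; have M1 : 0 < `|M| + 1 by rewrite ltr_pwDr.
exists (e / (qnorm Q * (`|M| + 1))).
  by rewrite divr_gt0// mulr_gt0// qnorm_gt0.
rewrite (_ : qnorm Q * _ = e * (M / (`|M| + 1))); last first.
  by field; rewrite !gt_eqF// qnorm_gt0.
rewrite ler_piMr ?(ltW e0)// ler_pdivrMr// mul1r.
by rewrite (le_trans (ler_norm _))// lerDl.
Qed.

(* [G] bounds the discretization error of the cost blockwise; added to the discrete
   potentials, it makes them feasible and coercive. *)
Theorem kantorovich_duality (e : R) : 0 < e ->
  exists (mu : probability E R) (f : forall i, (d i).-tuple R -> R),
  [/\ forall i A, measurable A -> mu (proj i @^-1` A) = P i A,
      forall i, (P i).-integrable setT (fun y => (f i y)%:E),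
      forall i y, f i (tneg y) = f i y,
      forall i, exists a b, 0 < a /\ forall y, a * sqnorm y - b <= f i y &
      (forall x, quad Q x <= \sum_i c i * f i (proj i x)) /\
      (\sum_i (c i)%:E * \int[P i]_y (f i y)%:E <=
         \int[mu]_x (quad Q x)%:E + e%:E)%E].
Proof.
move=> e0.
pose M i := fine (\int[P i]_y (sqnorm y)%:E)%E.
(* Error budget: [G] costs at most [e / 6] through the second moments and [e / 6] through
   quantization. It is paid twice, for the feasibility of the potentials and for the cost under
   [mu]; discrete duality adds [e / 6], in all [5 * e / 6]. [N] is chosen after [eta], because the
   weight [1 + eta^-1] depends on [eta]. *)
have [eta eta0 Heta] := @scaled_small (\sum_i M i) (e / 6) ltac:(by rewrite divr_gt0).
have [N HN] : exists N, forall i,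
    (\int[P i]_y (quant_err N y)%:E <= (e / 6 / (n.+1%:R * qnorm Q * (1 + eta^-1)))%:E)%E.
  have d0 : 0 < e / 6 / (n.+1%:R * qnorm Q * (1 + eta^-1)).
    by rewrite !divr_gt0// !mulr_gt0 ?qnorm_gt0// addr_gt0// invr_gt0.
  have [N _ /(_ N (leqnn N)) HN] := filter_forall _ (fun i => quant_err_small (sqi i) d0).
  by exists N.
pose G i (y : (d i).-tuple R) := qnorm Q *
  \sum_(j < d i) quad_error eta (tnth y j) (tau N (tnth y j)).
have GE i y : G i y = qnorm Q * (eta * sqnorm y + (1 + eta^-1) * quant_err N y).
  by rewrite /G /quad_error big_split/= -!mulr_sumr.
have GEE i : (fun y => (G i y)%:E) = (fun y => (qnorm Q * eta)%:E * (sqnorm y)%:E +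
    (qnorm Q * (1 + eta^-1))%:E * (quant_err N y)%:E)%E.
  by apply/funext => y; rewrite GE -!EFinM -EFinD mulrDr !mulrA.
have Gi i : (P i).-integrable setT (fun y => (G i y)%:E).
  rewrite GEE; apply: integrableD => //; apply: integrableZl => //.
  exact: integrable_quant_err.
have GP i : exists2 g, (\int[P i]_y (G i y)%:E = g%:E)%E &
    g <= qnorm Q * (eta * M i) + e / 6 / n.+1%:R.
  have qi := integrable_quant_err (sqi i) N.
  have qf := integrable_fin_num measurableT qi.
  have mf := integrable_fin_num measurableT (sqi i).
  rewrite GEE integralD//; [|exact: integrableZl|exact: integrableZl].
  rewrite !integralZl// -(fineK qf) -(fineK mf) -!EFinM -EFinD; eexists; first by [].
  rewrite -/(M i) [qnorm Q * (eta * _)]mulrA lerD2l; have := HN i; rewrite -(fineK qf) lee_fin.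
  have Q0 := qnorm_gt0 Q; have ei0 : 0 < 1 + eta^-1 by rewrite addr_gt0// invr_gt0.
  rewrite ler_pdivlMr ?mulr_gt0// => h; rewrite ler_pdivlMr//.
  by apply: le_trans h; rewrite le_eqVlt; apply/orP; left; apply/eqP; ring.
pose K := {ffun 'I_(dimE d) -> 'I_(code_size N).+1}.
pose kap i : (d i).-tuple R -> K := bcode N (i := i).
pose m i (k : K) := fine (P i (kap i @^-1` [set k])).
have mkap i k : measurable (kap i @^-1` [set k]) by exact: measurable_bcode.
have mE i k : (m i k)%:E = P i (kap i @^-1` [set k]).
  by rewrite fineK//; apply: fin_num_measure; exact: mkap.
have m0 i k : 0 <= m i k by rewrite fine_ge0.
have m1 i : \sum_k m i k = 1.
  apply: EFin_inj; rewrite -sumEFin.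
  under eq_bigr do rewrite mE -[_ @^-1` _]setTI.
  rewrite (sum_fibers _ (mkap i) measurableT); exact: probability_setT.
pose w (cl : {ffun 'I_n.+1 -> K}) := quad Q (bdecode cl).
have e6 : 0 < e / 6 by rewrite divr_gt0.
have [pi [phi [pi0 mpi wphi dual]]] := transport_duality w m0 m1 e6.
have [|mu [Hmu Wmu]] := @cell_coupling R n d K P kap mkap pi pi0.
  by move=> i k; rewrite mpi mE.
pose f i y := (phi i (kap i y) + G i y) / c i.
(* Averaging with the reflection preserves the constraint, because [quad Q] is even, and the
   integrals, because [P i] is symmetric. *)
pose fe i y := (f i y + f i (tneg y)) / 2.
have fE i : (fun y => (f i y)%:E) =
    (fun y => (c i)^-1%:E * ((phi i (kap i y))%:E + (G i y)%:E))%E.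
  by apply/funext => y; rewrite -EFinD -EFinM mulrC.
have phii i : (P i).-integrable setT (fun y => (phi i (kap i y))%:E).
  by apply: integrable_coded => k; exact: mkap.
have fi i : (P i).-integrable setT (fun y => (f i y)%:E).
  by rewrite fE; apply: integrableZl => //; exact: integrableD.
have fint i : ((c i)%:E * \int[P i]_y (f i y)%:E =
    (\sum_k phi i k * m i k)%:E + \int[P i]_y (G i y)%:E)%E.
  rewrite fE integralZl//; last exact: integrableD.
  rewrite muleA -EFinM mulfV ?gt_eqF// mul1e integralD//.
  by rewrite (integral_coded (mkap i)).
have fti i : (P i).-integrable setT (fun y => (f i (tneg y))%:E).
  exact: (integrable_image measurable_tneg (Psym (i := i)) (fi i)).
have approx x : `|quad Q x - w [ffun i => kap i (proj i x)]| <= \sum_i G i (proj i x).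
  apply: le_trans (quad_approx Q x _ eta0) _.
  rewrite sum_blocks mulr_sumr; apply: ler_sum => i _.
  rewrite /G ler_wpM2l ?(ltW (qnorm_gt0 _))//; apply: ler_sum => j _.
  by rewrite tnth_bdecode tnth_proj.
have feasible x : quad Q x <= \sum_i c i * f i (proj i x).
  have -> : \sum_i c i * f i (proj i x) =
      \sum_i phi i (kap i (proj i x)) + \sum_i G i (proj i x).
    rewrite -big_split/=; apply: eq_bigr => i _.
    by rewrite /f mulrC divfK// gt_eqF.
  have := wphi [ffun i => kap i (proj i x)].
  under eq_bigr do rewrite ffunE.
  have := approx x; rewrite ler_norml => /andP[_]; lra.
have feE i : (fun y => (fe i y)%:E) =
    (fun y => (2^-1)%:E * ((f i y)%:E + (f i (tneg y))%:E))%E.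
  by apply/funext => y; rewrite -EFinD -EFinM mulrC.
exists mu, fe; split => //.
- move=> i; rewrite feE; apply: integrableZl => //; exact: integrableD.
- by move=> i y; rewrite /fe tnegK addrC.
(* The growth comes from the term of [G] in [sqnorm]; the discrete part takes finitely many values
   and is bounded below by minus the sum of their absolute values. *)
- move=> i; exists (qnorm Q * eta / c i), ((\sum_k `|phi i k|) / c i); split.
    by rewrite divr_gt0// mulr_gt0// qnorm_gt0.
  have fge y : qnorm Q * eta / c i * sqnorm y - (\sum_k `|phi i k|) / c i <= f i y.
    rewrite mulrAC -mulrBl ler_wpM2r ?invr_ge0 ?(ltW (c0 i))// GE.
    have := quant_err_ge0 N y; have := qnorm_gt0 Q.
    have ei0 : 0 < eta^-1 by rewrite invr_gt0.
    have : - phi i (kap i y) <= \sum_k `|phi i k|.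
      rewrite (le_trans (ler_norm _))// normrN (bigD1 (kap i y))//= lerDl.
      exact: sumr_ge0.
    move=> h1 h2 h3.
    have := mulr_ge0 (ltW h2) (mulr_ge0 (addr_ge0 ler01 (ltW ei0)) h3).
    by move=> h4; rewrite [qnorm Q * (_ + _)]mulrDr [qnorm Q * (eta * _)]mulrA; lra.
  move=> y; rewrite /fe ler_pdivlMr//.
  by have := fge y; have := fge (tneg y); rewrite sqnorm_tneg; lra.
split.
  move=> x; rewrite /fe.
  have := feasible x; have := feasible (tneg x); rewrite quad_tneg => h1 h2.
  have -> : \sum_i c i * ((f i (proj i x) + f i (tneg (proj i x))) / 2) =
      (\sum_i c i * f i (proj i x) + \sum_i c i * f i (proj i (tneg x))) / 2.
    rewrite -big_split/= mulr_suml; apply: eq_bigr => i _.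
    by rewrite proj_tneg mulrA mulrDr.
  lra.
have feint i : (\int[P i]_y (fe i y)%:E = \int[P i]_y (f i y)%:E)%E.
  have mf : measurable_fun setT (fun y => (f i y)%:E) by case/integrableP: (fi i).
  rewrite feE integralZl//; last exact: integrableD.
  rewrite integralD// -(integral_imageT measurable_tneg (Psym (i := i)) mf).
  rewrite -(fineK (integrable_fin_num measurableT (fi i))) -EFinD -EFinM.
  by congr EFin; move: (fine _) => r; lra.
under eq_bigr do rewrite feint fint.
pose g i := fine (\int[P i]_y (G i y)%:E)%E.
have gE i : (\int[P i]_y (G i y)%:E = (g i)%:E)%E.
  by rewrite fineK//; exact: integrable_fin_num.
have gsum : \sum_i g i <= e / 6 + e / 6.
  apply: (@le_trans _ _ (\sum_i (qnorm Q * (eta * M i) + e / 6 / n.+1%:R))).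
    apply: ler_sum => i _; have [g' g'E] := GP i.
    by rewrite /g g'E.
  rewrite big_split/= -mulr_sumr -mulr_sumr lerD//.
  by rewrite sumr_const card_ord -[_ *+ _]mulr_natr divfK.
have projm i : measurable_fun setT (@proj R _ d i) by exact: measurable_proj.
have sqmu i : mu.-integrable setT (fun x => (sqnorm (proj i x))%:E).
  exact: (integrable_image (projm i) (fun A mA => esym (Hmu i A mA)) (sqi i)).
have qi := quad_integrable Q sqmu.
have Gmu i : mu.-integrable setT (fun x => (G i (proj i x))%:E).
  exact: (integrable_image (projm i) (fun A mA => esym (Hmu i A mA)) (Gi i)).
have Gmuint i : (\int[mu]_x (G i (proj i x))%:E = (g i)%:E)%E.
  rewrite -gE; apply/esym/(integral_imageT (projm i)).
    by move=> A mA; exact/esym/Hmu.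
  by case/integrableP: (Gi i).
have pi1 : \sum_cl pi cl = 1.
  rewrite -(m1 ord0) (partition_big (fun cl : {ffun 'I_n.+1 -> K} => cl ord0) predT)//=.
  by apply: eq_bigr => k _; exact: mpi.
(* [cell_coupling] evaluates nonnegative costs, so [w] is shifted by a constant. *)
pose B := \sum_cl `|w cl|.
have WB cl : 0 <= w cl + B.
  rewrite -lerBlDr sub0r lerNl (le_trans (ler_norm _))// normrN /B.
  by rewrite (bigD1 cl)//= lerDl sumr_ge0.
have dualmu : \sum_cl pi cl * w cl <= fine (\int[mu]_x (quad Q x)%:E)%E + \sum_i g i.
  have := Wmu _ WB.
  under [in RHS]eq_bigr do rewrite mulrDr.
  rewrite big_split/= -mulr_suml pi1 mul1r => WBE.
  have quadf := integrable_fin_num measurableT qi.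
  rewrite -(lerD2r B) -lee_fin -WBE.
  have sumE : (fun x : E => (quad Q x + \sum_i G i (proj i x) + B)%:E) =
      (fun x => (quad Q x)%:E + (\sum_i (G i (proj i x))%:E + cst B%:E x))%E.
    by apply/funext => x; rewrite sumEFin -!EFinD addrA.
  apply: (@le_trans _ _ (\int[mu]_x (quad Q x + \sum_i G i (proj i x) + B)%:E)%E).
    apply: le_integralT.
    - apply/measurable_EFinP; apply: (measurable_fun_coded (kappa :=
        fun x : E => [ffun i => kap i (proj i x)]) _ (fun cl => w cl + B)).
      move=> cl; rewrite (_ : _ @^-1` _ = \bigcap_(i in [set: 'I_n.+1])
          (proj i @^-1` (kap i @^-1` [set cl i]))).
        apply: fin_bigcap_measurable; first exact: finite_finset.
        move=> i _; rewrite -[X in measurable X]setTI; apply: projm => //; exact: mkap.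
      apply/seteqP; split => [x /= <- i _|x H]; first by rewrite /= ffunE.
      by apply/ffunP => i; rewrite ffunE; exact: H.
    - rewrite sumE; apply: emeasurable_funD; first by case/integrableP: qi.
      apply: emeasurable_funD; last exact: measurable_cst.
      by apply: emeasurable_sum => i; case/integrableP: (Gmu i).
    - move=> x; rewrite lee_fin lerD2r.
      by have := approx x; rewrite ler_norml => /andP[]; lra.
  rewrite sumE integralD//; last first.
    apply: integrableD => //; first exact: integrable_sum.
    exact: finite_measure_integrable_cst.
  rewrite integralD//; last 2 first.
  - exact: integrable_sum.
  - exact: finite_measure_integrable_cst.
  rewrite integral_sum// integral_cst//.
  rewrite [X in (_ * X)%E]probability_setT mule1.
  rewrite (_ : (\sum_i _ = (\sum_i g i)%:E)%E); last first.
    by rewrite -sumEFin; apply: eq_bigr => i _; exact: Gmuint.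
  by rewrite -(fineK quadf) -!EFinD addrA.
rewrite big_split/= sumEFin.
under [X in (_ + X)%E]eq_bigr do rewrite gE.
rewrite sumEFin -EFinD -(fineK (integrable_fin_num measurableT qi)) -EFinD lee_fin.
lra.
Qed.

End duality.

(** * From the inequality for functions to the one for densities *)

Section condA_condB.
Context {R : realType}.

Lemma symm_dens_tneg k (rho : k.-tuple R -> R) (P : probability (k.-tuple R) R) :
  symm_dens rho -> (forall A, measurable A -> P A = dens_meas rho A) ->
  forall A, measurable A -> P A = P (@tneg R k @^-1` A).
Proof.
move=> sym HP A mA; have mtA : measurable (@tneg R k @^-1` A).
  by rewrite -[X in measurable X]setTI; exact: measurable_tneg.
transitivity (dens_meas rho A); first exact: HP.
by rewrite sym// tneg_image; exact/esym/HP.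
Qed.

Lemma coupling_sqnorm n (d : 'I_n -> nat) (rho : forall i, (d i).-tuple R -> R)
    (mu : probability (Espace R d) R) :
  (forall i, is_Pdens (rho i)) -> coupling rho mu ->
  forall i, mu.-integrable setT (fun x => (sqnorm (proj i x))%:E).
Proof.
move=> Hrho Hmu i; have [P [_ HP sqi]] := Pdens_probability (Hrho i).
apply: (integrable_image (measurable_proj (i := i)) _ sqi) => A mA.
by rewrite [RHS]Hmu//; exact: HP.
Qed.

Lemma exists_coupling n (d : 'I_n -> nat) (rho : forall i, (d i).-tuple R -> R) :
  (forall i, is_Pdens (rho i)) -> exists mu : probability (Espace R d) R, coupling rho mu.
Proof.
move=> Hrho; pose P i := sval (cid (Pdens_probability (Hrho i))).
have [mu Hmu] := independent_coupling P.
exists mu => i A mA; rewrite [LHS]Hmu//.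
by rewrite /P; case: cid => /= Pi [_ + _]; apply.
Qed.

(** The independent coupling has a finite value because of the second moments. For [D = +oo] this
    keeps the right-hand side of (B) from being a sum of opposite infinities. *)
Lemma sup_coupling_gtNy n (d : 'I_n -> nat) (Q : 'M[R]_(dimE d))
    (rho : forall i, (d i).-tuple R -> R) : (forall i, is_Pdens (rho i)) ->
  (ereal_sup [set \int[mu]_x (quad Q x)%:E
    | mu in [set mu : probability (Espace R d) R | coupling rho mu]] != -oo)%E.
Proof.
move=> Hrho; have [mu Hmu] := exists_coupling Hrho.
rewrite -ltNye; apply: (@lt_le_trans _ _ (\int[mu]_x (quad Q x)%:E)%E).
  rewrite ltNye_eq integrable_fin_num//.
  exact: (quad_integrable Q (coupling_sqnorm Hrho Hmu)).
by apply: ereal_sup_ubound; exists mu.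
Qed.

Lemma condA_condB n (d : 'I_n -> nat) (c : 'I_n -> R) (Q : 'M[R]_(dimE d)) D :
  (forall i, 0 < c i) -> D != -oo%E -> condA c Q D -> condB c Q D.
Proof.
move=> c0 DN A rho Hrho Hsym; rewrite /Bineq.
set S := ereal_sup _.
have SN : S != -oo%E by exact: sup_coupling_gtNy.
case: D DN A => [D _ A|_ _|//]; last first.
  by rewrite addey// leey.
(* Without blocks, (A) for the empty family is [0 <= D]. *)
case: n d c Q c0 rho Hrho Hsym @S SN A => [|n] d c Q c0 rho Hrho Hsym S SN A.
  have [mu Hmu] := exists_coupling Hrho.
  rewrite big_ord0.
  have quad0 x : quad Q x = 0.
    rewrite /quad big1// => a _.
    have dE : dimE d = 0%N by rewrite /dimE big_ord0.
    by have : (a < 0)%N by rewrite -[X in (_ < X)%N]dE; exact: ltn_ord.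
  have D0 : 0 <= D.
    have : ((\prod_(i < 0) (fine (leb_int (fun x : (d i).-tuple R =>
        expeR (- cst 0%E x)))) `^ c i)%:E <= expeR D%:E)%E.
      apply: (A (fun i => cst 0%E)); try by case.
      by move=> x; rewrite big_ord0 quad0.
    by rewrite big_ord0 /= lee_fin -expR0 ler_expR.
  apply: adde_ge0; last by rewrite lee_fin.
  apply: (@le_trans _ _ (\int[mu]_x (quad Q x)%:E)%E).
    by apply: integral_ge0 => x _; rewrite quad0.
  by apply: ereal_sup_ubound; exists mu.
pose P i := sval (cid (Pdens_probability (Hrho i))).
have HP i A' : measurable A' -> P i A' = (\int[leb (d i)]_(x in A') (rho i x)%:E)%E.
  by rewrite /P; case: cid => /= Pi [+ _ _]; apply.
have HPd i A' : measurable A' -> P i A' = dens_meas (rho i) A'.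
  by rewrite /P; case: cid => /= Pi [_ + _]; apply.
have sqi i : (P i).-integrable setT (fun x => (sqnorm x)%:E).
  by rewrite /P; case: cid => /= Pi [].
have Psym i := symm_dens_tneg (Hsym i) (HPd i).
apply/lee_addgt0Pr => e e0.
have [mu [f [Hmu fi feven fge [feas Hf]]]] := kantorovich_duality Q c0 sqi Psym e0.
have mf i : measurable_fun setT (f i).
  by apply/measurable_EFinP; case/integrableP: (fi i).
have Zlt i : (leb_int (fun x => (expR (- f i x))%:E) < +oo)%E.
  by have [a [b [a0 Hab]]] := fge i; exact: gauss_lty a0 (mf i) Hab.
have me i : measurable_fun setT (fun x => expR (- f i x)).
  by apply: measurableT_comp => //; apply: measurableT_comp => //; exact: mf.
have [z Hz] : exists z, forall i, leb_int (fun x => (expR (- f i x))%:E) = (z i)%:E.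
  exists (fun i => fine (leb_int (fun x => (expR (- f i x))%:E))) => i.
  rewrite fineK// ge0_fin_numE; first exact: Zlt.
  rewrite leb_int_EFin; [|exact: me|by move=> x; exact: expR_ge0].
  by apply: integral_ge0 => x _; rewrite lee_fin expR_ge0.
have gibbsi i := gibbs (Hrho i) (HP i) (fi i) (Hz i).
have lnD : \sum_i c i * ln (z i) <= D.
  have := A (fun i => EFin \o f i).
  have -> : (\prod_(i < n.+1) (fine (leb_int (fun x => expeR (- (EFin \o f i) x))%E)) `^ c i =
     expR (\sum_i c i * ln (z i))).
    rewrite expR_sum; apply: eq_bigr => i _.
    have -> : leb_int (fun x => expeR (- (EFin \o f i) x))%E = (z i)%:E by exact: Hz.
    by rewrite /= /powR gt_eqF//; case: (gibbsi i).
  move=> H; rewrite -ler_expR -lee_fin; apply: H => //.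
  - by move=> i; apply/measurable_EFinP; exact: mf.
  - by move=> i x; rewrite /= feven.
  - by move=> x; under eq_bigr do rewrite -EFinM; rewrite sumEFin lee_fin feas.
apply: (@le_trans _ _ (\sum_i ((c i)%:E * \int[P i]_y (f i y)%:E + (c i * ln (z i))%:E)))%E.
  apply: lee_sum => i _; rewrite EFinM -muleDr//; last first.
    by rewrite fin_num_adde_defl.
  by apply: lee_wpmul2l; [rewrite lee_fin ltW|case: (gibbsi i)].
rewrite big_split/= sumEFin addeAC; apply: leeD; last by rewrite lee_fin.
apply: le_trans Hf _; apply: leeD => //.
apply: ereal_sup_ubound; exists mu => // i A' mA'.
by rewrite [LHS]Hmu//; exact: HPd.
Qed.

End condA_condB.

(** * Uniform densities on slabs *)

Section uniform_density.
Context {R : realType} {k : nat}.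
Local Notation E := (k.-tuple R).

Definition cube (r : R) : set E := [set x | forall j, `|tnth x j| < r].

Lemma measurable_coord_lt (f : E -> R) (r : R) : measurable_fun setT f ->
  measurable [set x | `|f x| < r].
Proof.
move=> mf; rewrite (_ : [set x | _] = (fun x => `|f x|) @^-1` `]-oo, r[%classic).
  rewrite -[X in measurable X]setTI.
  by apply: (measurableT_comp (f := fun x : R => `|x|)).
by apply/seteqP; split => x /=; rewrite in_itv.
Qed.

Lemma measurable_forall (I : finType) (F : I -> set E) :
  (forall i, measurable (F i)) -> measurable [set x | forall i, F i x].
Proof.
move=> mF; rewrite (_ : [set x | _] = \bigcap_(i in [set: I]) F i).
  by apply: fin_bigcap_measurable => //; exact: finite_finset.
by apply/seteqP; split => x H i; [move=> _; exact: H|exact: H].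
Qed.

Lemma measurable_cube r : measurable (cube r).
Proof.
by apply: measurable_forall => j; apply: measurable_coord_lt; exact: measurable_tnth.
Qed.

Lemma leb_cube r : 0 < r -> (leb k (cube r) = ((2 * r) ^+ k)%:E)%E.
Proof.
move=> r0; rewrite -[cube r]setIT -integral_indic//; last exact: measurable_cube.
pose g (t : R) : R := \1_(`](- r), r[%classic) t.
have mg : measurable_fun setT g by exact: measurable_indic.
have gr : (\int[@lebesgue_measure R]_x (g x)%:E = (2 * r)%:E)%E.
  rewrite /g integral_indic//= setIT lebesgue_measure_itv/= lte_fin gtrN// -EFinD opprK.
  by congr EFin; lra.
rewrite -(integral_leb_prod k mg _ gr); last by move=> x; rewrite /g indicE.
apply: eq_integral => x _; congr EFin; rewrite indicE.
have [/[!inE] xr|xr] := boolP (x \in cube r).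
  by rewrite big1// => j _; rewrite /g indicE mem_set//= in_itv/= -ltr_norml xr.
have /existsNP[j xj] : ~ forall j, `|tnth x j| < r.
  by move=> H; move: xr; rewrite notin_setE.
rewrite (bigD1 j)//= /g indicE memNset ?mul0r//= in_itv/= -ltr_norml.
exact/negP/negP.
Qed.

Variables (A : set E) (V : R) (r : R).
Hypotheses (mA : measurable A) (V0 : 0 < V) (AV : leb k A = V%:E)
  (Ar : A `<=` cube r) (Asym : forall x, A x -> A (tneg x))
  (Aconv : forall x y t, 0 <= t <= 1 -> A x -> A y ->
    A [tuple t * tnth x j + (1 - t) * tnth y j | j < k]).

Definition unif (x : E) : R := \1_A x / V.

Lemma measurable_unif : measurable_fun setT unif.
Proof. exact: measurable_funM. Qed.

Lemma unif_ge0 x : 0 <= unif x.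
Proof. by rewrite divr_ge0// ltW. Qed.

Lemma integral_unif (B : set E) : measurable B ->
  (\int[leb k]_(x in B) (unif x)%:E = V^-1%:E * leb k (A `&` B))%E.
Proof.
move=> mB; under eq_integral do rewrite /unif mulrC EFinM.
rewrite ge0_integralZl_EFin ?invr_ge0 ?(ltW V0)//; last first.
  by apply/measurable_EFinP; exact: measurable_funTS.
by rewrite integral_indic.
Qed.

Lemma integral_unifT : (\int[leb k]_x (unif x)%:E = 1)%E.
Proof. by rewrite integral_unif// setIT [leb k A]AV -EFinM mulVf// gt_eqF. Qed.

Lemma sqnorm_cube x : cube r x -> sqnorm x <= k%:R * r ^+ 2.
Proof.
move=> xr; apply: (@le_trans _ _ (\sum_(j < k) r ^+ 2)).
  apply: ler_sum => j _; have := xr j; rewrite ltr_norml => /andP[].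
  by move: (tnth x j) => t h1 h2; nra.
by rewrite sumr_const card_ord mulr_natl.
Qed.

Lemma Pdens_unif : is_Pdens unif.
Proof.
have mu := measurable_unif; have u0 := unif_ge0.
split => //; first by rewrite leb_int_EFin// integral_unifT.
rewrite leb_int_EFin; last 2 first.
- by apply: measurable_funM => //; exact: measurable_sqnorm.
- by move=> x; rewrite mulr_ge0// sqnorm_ge0.
apply: (@le_lt_trans _ _ (\int[leb k]_x ((`|k%:R * r ^+ 2|)%:E * (unif x)%:E))%E).
  apply: le_integralT.
  - by apply/measurable_EFinP/measurable_funM => //; exact: measurable_sqnorm.
  - by apply: emeasurable_funM => //; exact/measurable_EFinP.
  - move=> x; rewrite -EFinM lee_fin /unif indicE.
    have [/[!inE] /Ar/sqnorm_cube xA|_] := boolP (x \in A); last by rewrite !mul0r mulr0.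
    by rewrite mulrC ler_wpM2r ?divr_ge0 ?(ltW V0)// (le_trans xA)// ler_norm.
rewrite ge0_integralZl_EFin//; last exact/measurable_EFinP.
  by rewrite integral_unifT mule1 ltry.
by move=> x _; rewrite lee_fin.
Qed.

Lemma even_symm_dens (rho : E -> R) : measurable_fun setT rho -> (forall x, 0 <= rho x) ->
  (forall x, rho (tneg x) = rho x) -> symm_dens rho.
Proof.
move=> mrho rho0 even B mB.
have mtB : measurable (@tneg R k @^-1` B).
  by rewrite -[X in measurable X]setTI; exact: measurable_tneg.
rewrite tneg_image !dens_measE// integral_mkcond [RHS]integral_mkcond.
rewrite -integral_leb_tneg.
- apply: eq_integral => x _; rewrite !patchE even.
  by congr (if _ then _ else _); apply/idP/idP; rewrite !inE.
- by apply/(measurable_restrictT _ _).1 => //; exact/measurable_EFinP/measurable_funTS.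
- by move=> x; rewrite patchE; case: ifP => // _; rewrite lee_fin.
Qed.

Lemma symm_unif : symm_dens unif.
Proof.
apply: even_symm_dens; [exact: measurable_unif|exact: unif_ge0|].
move=> x; rewrite /unif !indicE; congr (_%:R / _).
by congr nat_of_bool; apply/idP/idP; rewrite !inE => /Asym; rewrite ?tnegK.
Qed.

Lemma log_concave_unif : log_concave_fun unif.
Proof.
move=> x y t t01; rewrite /unif !indicE.
(* Zero to the power zero is 1, so at [t = 0] and [t = 1] a point outside [A] does not make the
   left-hand side vanish. *)
have [->|t0] := eqVneq t 0.
  rewrite powRr0 mul1r subr0 powRr1 ?divr_ge0 ?(ltW V0)//.
  rewrite (_ : [tuple _ | _ < _] = y)//.
  by apply: eq_from_tnth => j; rewrite tnth_mktuple mul0r add0r mul1r.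
have [->|t1] := eqVneq t 1.
  rewrite subrr powRr0 mulr1 powRr1 ?divr_ge0 ?(ltW V0)//.
  rewrite (_ : [tuple _ | _ < _] = x)//.
  by apply: eq_from_tnth => j; rewrite tnth_mktuple mul0r addr0 mul1r.
have [/[!inE] xA|_] := boolP (x \in A); last first.
  by rewrite mul0r powR0// mul0r divr_ge0// ltW.
have [/[!inE] yA|_] := boolP (y \in A); last first.
  by rewrite mul0r [X in _ * X]powR0 ?mulr0 ?divr_ge0 ?(ltW V0)// subr_eq0 eq_sym.
rewrite mem_set; last exact: Aconv.
rewrite -powRD; last by rewrite addrC subrK oner_eq0.
by rewrite addrC subrK powRr1// divr_ge0// ltW.
Qed.

Lemma logconcave_unif : logconcave_dens unif.
Proof.
exists unif; split => //; [exact: measurable_unif|exact: unif_ge0|exact: log_concave_unif].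
Qed.

Lemma entropy_unif : entropy unif = (ln V)%:E.
Proof.
have mu := measurable_unif.
rewrite entropyE//; under eq_integral => x _.
  rewrite (_ : - (unif x * ln (unif x)) = ln V * unif x); last first.
    rewrite /unif indicE; case: (x \in A); last by rewrite !mul0r mulr0 oppr0.
    by rewrite mul1r lnV ?posrE// mulrN opprK mulrC.
  rewrite EFinM; over.
rewrite integralZl//; first by rewrite integral_unifT mule1.
apply/integrableP; split; first exact/measurable_EFinP.
under eq_integral do rewrite gee0_abs ?lee_fin ?unif_ge0//.
by rewrite integral_unifT ltry.
Qed.

End uniform_density.

Section slab.
Context {R : realType} {k : nat}.
Local Notation E := (k.-tuple R).
Variables (v : E) (j0 : nat).

Lemma normr_convex_lt (a b t r : R) : 0 <= t <= 1 -> `|a| < r -> `|b| < r ->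
  `|t * a + (1 - t) * b| < r.
Proof.
move=> /andP[t0 t1] ar br.
have [ab|/ltW ab] := leP `|a| `|b|.
  apply: le_lt_trans br; apply: le_trans (ler_normD _ _) _.
  rewrite !normrM (ger0_norm t0) (@ger0_norm _ (1 - t)) ?subr_ge0//.
  have : t * `|a| <= t * `|b| by exact: ler_wpM2l.
  lra.
apply: le_lt_trans ar; apply: le_trans (ler_normD _ _) _.
rewrite !normrM (ger0_norm t0) (@ger0_norm _ (1 - t)) ?subr_ge0//.
have t1' : 0 <= 1 - t by rewrite subr_ge0.
have : (1 - t) * `|b| <= (1 - t) * `|a| by exact: ler_wpM2l.
lra.
Qed.

(** A neighbourhood of a segment along [v], the multiple of [v] being read off from the coordinate
    [j0]. The index [j0] is a plain number read by [nth 0], so that one index serves for blocks of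
    all dimensions; where [v] vanishes and [1 <= L], the slab is just [cube 1]. *)
Definition slab (L : R) : set E :=
  [set x : E | `|nth 0 x j0| < L /\ forall j, `|tnth x j - tnth v j * nth 0 x j0| < 1].

Lemma measurable_nth0 : measurable_fun setT (fun x : E => nth 0 x j0).
Proof.
case: (ltnP j0 k) => [lt|ge].
  rewrite (_ : (fun x => _) = (@tnth _ R ^~ (Ordinal lt))).
    exact: measurable_tnth.
  by apply/funext => y; rewrite (tnth_nth 0).
rewrite (_ : (fun x => _) = cst 0); first exact: measurable_cst.
by apply/funext => y; rewrite nth_default// size_tuple.
Qed.

Lemma measurable_slab L : measurable (slab L).
Proof.
rewrite (_ : slab L = [set x : E | `|nth 0 x j0| < L] `&`
    [set x : E | forall j, `|tnth x j - tnth v j * nth 0 x j0| < 1])//.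
apply: measurableI; first by apply: measurable_coord_lt; exact: measurable_nth0.
apply: measurable_forall => j; apply: measurable_coord_lt.
apply: measurable_funB; first exact: measurable_tnth.
by apply: measurable_funM; [exact: measurable_cst|exact: measurable_nth0].
Qed.

Lemma nth0_linear (f : R -> R -> R) (x y : E) : f 0 0 = 0 ->
  nth 0 [tuple f (tnth x j) (tnth y j) | j < k] j0 = f (nth 0 x j0) (nth 0 y j0).
Proof.
move=> f0; case: (ltnP j0 k) => [lt|ge].
  by rewrite -(tnth_nth _ _ (Ordinal lt)) tnth_mktuple !(tnth_nth 0).
by rewrite !nth_default ?size_tuple.
Qed.

Lemma slab_sym L (x : E) : slab L x -> slab L (tneg x).
Proof.
have -> : tneg x = [tuple (fun a _ => - a) (tnth x j) (tnth x j) | j < k].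
  by apply: eq_from_tnth => j; rewrite tnth_tneg tnth_mktuple.
move=> [xL H]; split; first by rewrite (nth0_linear (f := fun a _ => - a)) ?oppr0// normrN.
move=> j; rewrite (nth0_linear (f := fun a _ => - a)) ?oppr0// tnth_mktuple.
by rewrite mulrN -opprD normrN.
Qed.

Lemma slab_convex L (x y : E) t : 0 <= t <= 1 -> slab L x -> slab L y ->
  slab L [tuple t * tnth x j + (1 - t) * tnth y j | j < k].
Proof.
move=> t01 [xL Hx] [yL Hy].
have e : nth 0 [tuple t * tnth x j + (1 - t) * tnth y j | j < k] j0 =
    t * nth 0 x j0 + (1 - t) * nth 0 y j0.
  by rewrite (nth0_linear (f := fun a b => t * a + (1 - t) * b)) ?mulr0 ?addr0.
split; rewrite ?e; first exact: normr_convex_lt.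
move=> j; rewrite tnth_mktuple.
have := normr_convex_lt t01 (Hx j) (Hy j).
by congr (`|_| < _); ring.
Qed.

Let sv : R := \sum_j `|tnth v j|.

Let v_le j : `|tnth v j| <= sv.
Proof. by rewrite /sv (bigD1 j)//= lerDl sumr_ge0. Qed.

Let sv0 : 0 <= sv.
Proof. exact: sumr_ge0. Qed.

Lemma slab_cube L : slab L `<=` cube (1 + sv * L).
Proof.
move=> x [xL H] j; have := H j.
rewrite -[tnth x j in X in _ -> X](subrK (tnth v j * nth 0 x j0)) => Hj.
apply: le_lt_trans (ler_normD _ _) _; apply: ltr_leD => //.
by rewrite normrM ler_pM// ltW.
Qed.

(** The radius [rho] satisfies [rho * (1 + sv) < 1], which bounds the deviation from the line. A
    cube inside makes the volume of the slab positive, as [slab_cube] makes it finite. *)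
Lemma cube_slab L : 1 <= L -> cube (2 + sv)^-1 `<=` slab L.
Proof.
move=> L1 x Hx; have s2 : 0 < 2 + sv by rewrite ltr_wpDr.
have x0 : `|nth 0 x j0| < (2 + sv)^-1.
  case: (ltnP j0 k) => [lt|ge]; first by have := Hx (Ordinal lt); rewrite (tnth_nth 0).
  by rewrite nth_default ?size_tuple// normr0 invr_gt0.
split.
  apply: lt_le_trans x0 _; apply: le_trans _ L1; rewrite invf_le1//.
  by rewrite ler_wpDr// ler1n.
move=> j; apply: le_lt_trans (ler_normB _ _) _.
have h : (2 + sv)^-1 * (2 + sv) = 1 by rewrite mulVf// gt_eqF.
have h1 : `|tnth v j * nth 0 x j0| <= sv * (2 + sv)^-1.
  by rewrite normrM ler_pM// ltW.
have := Hx j; have : 0 < (2 + sv)^-1 by rewrite invr_gt0.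
lra.
Qed.

Definition slab_vol L : R := fine (leb k (slab L)).

Lemma leb_slab L : 0 < L -> (leb k (slab L) = (slab_vol L)%:E)%E.
Proof.
move=> L0; rewrite fineK// ge0_fin_numE//.
apply: (@le_lt_trans _ _ (leb k (cube (1 + sv * L)))).
  by apply: le_measure; rewrite ?inE;
    [exact: measurable_slab|exact: measurable_cube|exact: slab_cube].
rewrite [X in (X < _)%E]leb_cube ?ltry//.
by rewrite ltr_wpDr// mulr_ge0// ltW.
Qed.

Lemma slab_vol_gt0 L : 1 <= L -> 0 < slab_vol L.
Proof.
move=> L1; rewrite -lte_fin -leb_slab ?(lt_le_trans ltr01)//.
have s2 : 0 < (2 + sv)^-1 by rewrite invr_gt0 ltr_wpDr.
apply: (@lt_le_trans _ _ (leb k (cube (2 + sv)^-1))).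
  by rewrite [X in (_ < X)%E]leb_cube// lte_fin exprn_gt0// mulr_gt0.
by apply: le_measure; rewrite ?inE;
  [exact: measurable_cube|exact: measurable_slab|exact: cube_slab].
Qed.

Lemma slab_vol_le L L' : 0 < L -> L <= L' -> slab_vol L <= slab_vol L'.
Proof.
move=> L0 LL'; rewrite -lee_fin -!leb_slab//; last exact: lt_le_trans LL'.
apply: le_measure; rewrite ?inE; [exact: measurable_slab|exact: measurable_slab|].
by move=> x [xL H]; split => //; exact: lt_le_trans LL'.
Qed.

(** The translate of the slab of length [L] by [2 * L] times [v] is disjoint from it, and both lie
    in the slab of length [3 * L]. Under the uniform law of the latter the coordinate [j0] is thus
    at least [L] in absolute value with probability at least one half. *)
Lemma slab_vol_double L : nth 0 v j0 = 1 -> 0 < L -> 2 * slab_vol L <= slab_vol (3 * L).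
Proof.
move=> v1 L0; pose T := tuple_act (fun j x => x + - (2 * L * tnth v j)) : E -> E.
have mT : measurable_fun setT T.
  by apply: measurable_tuple_act => j; exact: measurable_funD.
have Tn x : nth 0 (T x) j0 = nth 0 x j0 - 2 * L.
  rewrite (nth0_linear (f := fun a b => a + - (2 * L * b)) x v); last first.
    by rewrite mulr0 subr0.
  by rewrite v1 mulr1.
have mTS : measurable (T @^-1` slab L).
  by rewrite -[X in measurable X]setTI; apply: mT => //; exact: measurable_slab.
have TE : (leb k (T @^-1` slab L) = leb k (slab L))%E.
  have lebE (B : set E) : measurable B -> (leb k B = \int[leb k]_x (\1_B x)%:E)%E.
    by move=> mB; rewrite integral_indic// setIT.
  rewrite (lebE _ mTS) (lebE _ (measurable_slab L)).
  rewrite -(@integral_tuple_act R k (fun j x => x + - (2 * L * tnth v j))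
    (fun x => (\1_(slab L) x)%:E))//.
  - by move=> j; exact: preserves_lebesgueD.
  - by apply/measurable_EFinP/measurable_indic; exact: measurable_slab.
rewrite -lee_fin EFinM -leb_slab// -leb_slab ?mulr_gt0//.
rewrite (_ : (2%:E * leb k (slab L) = leb k (slab L) + leb k (T @^-1` slab L))%E); last first.
  by rewrite TE (_ : 2%:E = 1%E + 1%E)%E// ge0_muleDl// mul1e.
rewrite -measureU//; last 2 first.
- exact: measurable_slab.
- apply/seteqP; split => // x [[xL _] []]; rewrite Tn.
  by move: xL; rewrite !ltr_norml => /andP[_ h1] /andP[h2 _]; lra.
apply: le_measure; rewrite ?inE.
- by apply: measurableU => //; exact: measurable_slab.
- exact: measurable_slab.
move=> x [[xL H]|[]].
  by split => //; apply: lt_le_trans xL _; lra.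
rewrite Tn => xL H; split.
  by move: xL; rewrite !ltr_norml => /andP[h1 h2]; apply/andP; split; lra.
move=> j; have := H j; rewrite tnth_mktuple.
by congr (`|_| < _); ring.
Qed.

End slab.

Lemma le_integral_ae d (T : measurableType d) (R : realType)
    (m : {measure set T -> \bar R}) (f g : T -> R) :
  measurable_fun setT f -> measurable_fun setT g ->
  {ae m, forall x, f x <= g x} ->
  (\int[m]_x (f x)%:E <= \int[m]_x (g x)%:E)%E.
Proof.
move=> mf mg fg.
have mfg : measurable_fun setT (fun x => Num.min (f x) (g x)) by exact: measurable_minr.
have -> : (\int[m]_x (f x)%:E = \int[m]_x (Num.min (f x) (g x))%:E)%E.
  apply: ae_eq_integral => //; [exact/measurable_EFinP|exact/measurable_EFinP|].
  by apply: filterS fg => x fgx _; rewrite min_l.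
apply: le_integralT; [exact/measurable_EFinP|exact/measurable_EFinP|].
by move=> x; rewrite lee_fin ge_min lexx orbT.
Qed.

(** * The form along one block: convexity and negative directions *)

Section quad_algebra.
Context {R : realType} {n : nat} {d : 'I_n -> nat}.
Local Notation E := (Espace R d).
Variable Q : 'M[R]_(dimE d).
Implicit Types (x y z v : E).

Definition lcomb (a b : R) x y : E := [tuple a * tnth x j + b * tnth y j | j < dimE d].

(** Two points that differ in one block only have their difference supported there, so nonnegativity
    of the form on a block is convexity along it. *)
Lemma quad_convex_identity t x y :
  t * quad Q x + (1 - t) * quad Q y - quad Q (lcomb t (1 - t) x y) =
  t * (1 - t) * quad Q (lcomb 1 (- 1) x y).
Proof.
rewrite /quad !mulr_sumr -big_split/= -sumrB; apply: eq_bigr => a _.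
rewrite !mulr_sumr -big_split/= -sumrB; apply: eq_bigr => b _.
by rewrite !tnth_mktuple; ring.
Qed.

(** A point of a slab along [v] is [z + s * v] with [z] bounded: besides the square term, the form
    grows at most linearly in [s]. *)
Lemma quad_line s z v : (forall a, `|tnth z a| <= 1) ->
  quad Q (lcomb 1 s z v) <= s ^+ 2 * quad Q v +
    `|s| * (\sum_a \sum_b (`|Q a b| * (`|tnth v a| + `|tnth v b|))) +
    \sum_a \sum_b `|Q a b|.
Proof.
move=> z1; rewrite /quad !mulr_sumr -!big_split/=; apply: ler_sum => a _.
rewrite !mulr_sumr -!big_split/=; apply: ler_sum => b _.
rewrite !tnth_mktuple.
set q := Q a b; set va := tnth v a; set vb := tnth v b.
set za := tnth z a; set zb := tnth z b.
have -> : (1 * za + s * va) * q * (1 * zb + s * vb) =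
   s ^+ 2 * (va * q * vb) + (s * q * (za * vb + va * zb) + q * (za * zb)) by ring.
rewrite -addrA lerD2l; apply: lerD.
  apply: le_trans (ler_norm _) _; rewrite !normrM -mulrA ler_wpM2l// ler_wpM2l//.
  apply: le_trans (ler_normD _ _) _; rewrite !normrM addrC.
  by apply: lerD; [rewrite ler_piMr ?z1|rewrite ler_piMl ?z1].
apply: le_trans (ler_norm _) _; rewrite !normrM ler_piMr//.
by rewrite mulr_ile1 ?z1.
Qed.

Lemma quad_scale s v : quad Q [tuple tnth v a / s | a < dimE d] = quad Q v / s ^+ 2.
Proof.
rewrite /quad mulr_suml; apply: eq_bigr => a _; rewrite mulr_suml.
apply: eq_bigr => b _; rewrite !tnth_mktuple expr2 invfM; ring.
Qed.

(* On the slab of length [3 * A] along [v], [quad Q y] is at most [K] minus a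
   multiple of the squared length coordinate, which is at least [A ^+ 2] with
   probability at least 1/2; the volume of the slab does not decrease with [A]. *)
Lemma negative_direction (c : 'I_n -> R) (D : R) i v :
  (forall k, 0 < c k) -> (forall k, k != i -> forall j, tnth (proj k v) j = 0) ->
  quad Q v < 0 -> ~ condB_lc c Q D%:E.
Proof.
move=> c0 vi qv H.
have [j1 vj1] : exists j1, tnth (proj i v) j1 != 0.
  apply: contrapT => /forallNP v0; move: qv; rewrite ltNge => /negP; apply.
  rewrite /quad big1// => a _; rewrite big1// => b _.
  suff -> : tnth v a = 0 by rewrite !mul0r.
  rewrite -(tagnat.sig2K a) -/(bidx _) -tnth_proj.
  have [e|/vi->//] := eqVneq (tagnat.sig1 a) i.
  move: (tagnat.sig2 a); rewrite e => j.
  by apply/eqP/negPn/negP; exact: v0.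
pose s0 := tnth (proj i v) j1.
(* The coordinate [j1] of block [i] becomes 1, as [slab_vol_double] requires, and the form stays
   negative. *)
pose u : E := [tuple tnth v a / s0 | a < dimE d].
have pu k j : tnth (proj k u) j = tnth (proj k v) j / s0.
  by rewrite !tnth_proj tnth_mktuple.
have qu : quad Q u < 0.
  by rewrite quad_scale pmulr_llt0// invr_gt0 exprn_even_gt0.
pose j0 : nat := j1.
have u1 : nth 0 (proj i u) j0 = 1 by rewrite -(tnth_nth 0) pu divff.
have ui k : k != i -> forall j, tnth (proj k u) j = 0.
  by move=> ki j; rewrite pu vi// mul0r.
pose lam := - quad Q u; have lam0 : 0 < lam by rewrite oppr_gt0.
pose K1 := \sum_a \sum_b (`|Q a b| * (`|tnth u a| + `|tnth u b|)).
pose K2 := \sum_a \sum_b `|Q a b|.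
(* Completing the square absorbs the linear term: [- lam * s ^+ 2 + K1 * s + K2 <= K - lam / 2 * s
   ^+ 2]. *)
pose K := K2 + K1 ^+ 2 / (2 * lam).
pose S L k := slab (proj k u) j0 L.
pose V L k := slab_vol (proj k u) j0 L.
pose sc (y : E) := nth 0 (proj i y) j0.
have quadle L y : (forall k, S L k (proj k y)) -> quad Q y <= K - lam / 2 * sc y ^+ 2.
  move=> yS; pose z := lcomb 1 (- sc y) y u.
  have z1 a : `|tnth z a| <= 1.
    rewrite tnth_mktuple mul1r -(tagnat.sig2K a) -/(bidx _) -!tnth_proj.
    have [_ /(_ (tagnat.sig2 a)) /ltW] := yS (tagnat.sig1 a).
    have [e|/ui ->] := eqVneq (tagnat.sig1 a) i; last by rewrite mul0r subr0 mulr0 addr0.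
    move: (tagnat.sig2 a); rewrite e => j; by rewrite mulNr [sc y * _]mulrC.
  have yE : y = lcomb 1 (sc y) z u.
    apply: eq_from_tnth => a; rewrite !tnth_mktuple; ring.
  rewrite {1}yE; apply: le_trans (quad_line (sc y) u z1) _.
  rewrite -/K1 -/K2 /K -(real_normK (num_real (sc y))).
  have -> : quad Q u = - lam by rewrite opprK.
  have : 0 <= lam / 2 * (`|sc y| - K1 / lam) ^+ 2.
    by rewrite mulr_ge0 ?sqr_ge0// divr_ge0// ltW.
  have -> : lam / 2 * (`|sc y| - K1 / lam) ^+ 2 =
     lam / 2 * `|sc y| ^+ 2 - `|sc y| * K1 + K1 ^+ 2 / (2 * lam).
    by field; rewrite gt_eqF.
  lra.
pose C0 := \sum_k c k * ln (V 1 k).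
suff key A : 1 <= A -> C0 <= K - lam / 4 * A ^+ 2 + D.
  pose X := K + D - C0.
  (* Chosen so that [lam / 4 * A] exceeds [X]; as [A <= A ^+ 2], this contradicts [key]. *)
  pose A := 1 + 4 / lam * `|X|.
  have A1 : 1 <= A by rewrite lerDl mulr_ge0// divr_ge0// ltW.
  have := key A A1.
  have : lam / 4 * A <= lam / 4 * A ^+ 2.
    by rewrite ler_wpM2l ?divr_ge0 ?(ltW lam0)// expr2 ler_peMl// (le_trans ler01).
  have -> : lam / 4 * A = lam / 4 + `|X| by rewrite /A; field; rewrite gt_eqF.
  have := ler_norm X; rewrite /X; lra.
move=> A1; pose L := 3 * A.
have A0 : 0 < A by exact: lt_le_trans A1.
have L1 : 1 <= L by rewrite /L; lra.
have L0 : 0 < L by exact: lt_le_trans L1.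
have V0 k : 0 < V L k by exact: slab_vol_gt0.
pose r k := 1 + (\sum_j `|tnth (proj k u) j|) * L.
have mS k : measurable (S L k) by exact: measurable_slab.
have SV k : leb (d k) (S L k) = (V L k)%:E by exact: leb_slab.
have Sr k : S L k `<=` cube (r k) by exact: slab_cube.
pose rho k := unif (S L k) (V L k).
have Hrho k : is_Pdens (rho k) by exact: (Pdens_unif (mS k) (V0 k) (SV k) (Sr k)).
have := H rho Hrho (fun k => symm_unif (mS k) (V0 k) (@slab_sym _ _ _ _ L))
  (fun k => logconcave_unif (mS k) (V0 k) (@slab_convex _ _ _ _ L)).
rewrite /Bineq => B; rewrite -lee_fin.
apply: (@le_trans _ _ (\sum_k (c k)%:E * entropy (rho k))%E).
  under eq_bigr do rewrite (entropy_unif (mS _) (V0 _) (SV _)) -EFinM.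
  rewrite sumEFin lee_fin; apply: ler_sum => k _; rewrite ler_wpM2l ?(ltW (c0 k))//.
  by rewrite ler_ln ?posrE//; [exact: slab_vol_le|exact: slab_vol_gt0].
apply: (le_trans B); rewrite EFinD leeD2r//.
apply: ge_ereal_sup => _ [mu Hmu <-].
have mupre k X : measurable X -> mu (proj k @^-1` X) = ((V L k)^-1%:E * leb (d k) (S L k `&` X))%E.
  move=> mX; rewrite [LHS]Hmu// dens_measE//; last 2 first.
  - exact: measurable_unif.
  - by move=> x; exact: unif_ge0.
  by rewrite (integral_unif (mS k)).
pose G : set E := [set y | `|sc y| < A].
have mG : measurable G.
  rewrite -[X in measurable X]/(proj i @^-1` [set x : (d i).-tuple R | `|nth 0 x j0| < A]).
  rewrite -[X in measurable X]setTI; apply: measurable_proj => //.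
  by apply: measurable_coord_lt; exact: measurable_nth0.
have muG : fine (mu G) <= 2^-1.
  rewrite -lee_fin fineK ?fin_num_measure//.
  rewrite -[G]/(proj i @^-1` [set x : (d i).-tuple R | `|nth 0 x j0| < A]).
  rewrite mupre; last by apply: measurable_coord_lt; exact: measurable_nth0.
  have -> : S L i `&` [set x : (d i).-tuple R | `|nth 0 x j0| < A] = S A i.
    apply/seteqP; split => [x [[_ xH] xA]|x [xA xH]]; first by split.
    by split=> //; split => //; apply: lt_le_trans xA _; rewrite /L; lra.
  rewrite [leb _ _]leb_slab// -EFinM lee_fin mulrC ler_pdivrMr ?V0//.
  have := slab_vol_double u1 A0; rewrite /V -/L; lra.
apply: (@le_trans _ _ (\int[mu]_y (K - lam / 2 * A ^+ 2 * (1 - \1_G y))%:E)%E).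
  apply: le_integral_ae.
  - exact: measurable_quad.
  - apply: measurable_funB => //; apply: measurable_funM => //.
    by apply: measurable_funB => //; exact: measurable_indic.
  have : \forall y \ae mu, forall k, S L k (proj k y).
    apply: filter_forall => k.
    exists (proj k @^-1` (~` (S L k))); split.
    - rewrite -[X in measurable X]setTI; apply: measurable_proj => //.
      by apply: measurableC; exact: mS.
    - by rewrite mupre; [rewrite setICr measure0 mule0|apply: measurableC; exact: mS].
    - by move=> x.
  apply: filterS => y /quadle yq; apply: le_trans yq _.
  rewrite lerD2l lerN2 indicE -mulrA.
  rewrite ler_wpM2l ?divr_ge0 ?(ltW lam0)//.
  have [|/negP] := boolP (y \in G); first by rewrite subrr mulr0 sqr_ge0.
  rewrite subr0 mulr1 inE /G /= => /negP; rewrite -leNgt => Ay.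
  by rewrite -[leRHS](real_normK (num_real _)) ler_sqr ?nnegrE ?(ltW A0).
have -> : (fun y => (K - lam / 2 * A ^+ 2 * (1 - \1_G y))%:E) =
    (fun y => cst (K - lam / 2 * A ^+ 2)%:E y + (lam / 2 * A ^+ 2)%:E * (\1_G y)%:E)%E.
  by apply/funext => y; rewrite -EFinM -EFinD; congr EFin; ring.
have i1 : mu.-integrable setT (fun y => (\1_G y)%:E) by exact: integrable_indic.
rewrite integralD//; last 2 first.
- exact: finite_measure_integrable_cst.
- exact: integrableZl.
rewrite integral_cst// [X in (_ * X)%E]probability_setT mule1 integralZl//.
have -> : (\int[mu]_y (\1_G y)%:E = (fine (mu G))%:E)%E.
  by rewrite integral_indic// setIT fineK//; exact: fin_num_measure.
rewrite -EFinM -EFinD lee_fin.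
have : lam / 2 * A ^+ 2 * fine (mu G) <= lam / 2 * A ^+ 2 * 2^-1.
  by rewrite ler_wpM2l// mulr_ge0 ?sqr_ge0// divr_ge0// ltW.
lra.
Qed.

End quad_algebra.

(** * Log-concave majorants *)

Section open_tuples.
Context {R : realType} {k : nat}.
Local Notation E := (k.-tuple R).

Definition tuple_open (U : set E) := forall x, U x -> exists2 e, 0 < e &
  forall z, (forall j, `|tnth z j - tnth x j| < e) -> U z.

(** An open set is the union of the boxes inside it with rational centre and radius [1 / m.+1], a
    countable family. A radius below [e / 2] suffices around [x], since two points of a box are
    within twice its radius. This serves for an infimum over an uncountable family of continuous
    functions, whose strict sublevel sets are open. *)
Lemma measurable_tuple_open (U : set E) : tuple_open U -> measurable U.
Proof.
move=> Uo.
pose box (q : k.-tuple rat) (m : nat) : set E :=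
  [set z | forall j, `|tnth z j - ratr (tnth q j)| < m.+1%:R^-1].
pose F (p : nat) : set E :=
  if @choice.unpickle (k.-tuple rat * nat)%type p is Some (q, m) then
    if `[< box q m `<=` U >] then box q m else set0
  else set0.
have mbox q m : measurable (box q m).
  apply: measurable_forall => j.
  by apply: measurable_coord_lt; apply: measurable_funB => //; exact: measurable_tnth.
suff -> : U = \bigcup_p F p.
  apply: bigcupT_measurable => p; rewrite /F.
  by case: choice.unpickle => [[q m]|//]; case: ifP.
apply/seteqP; split => [x /[dup] Ux /Uo[e e0 eU]|x [p _]]; last first.
  by rewrite /F; case: choice.unpickle => [[q m]|//]; case: ifPn => // /asboolP; apply.
have e2 : 0 < e / 2 by rewrite divr_gt0.
have [m _ /(_ m (leqnn m)) /= me] := near_infty_natSinv_lt (PosNum e2).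
have m0 : 0 < m.+1%:R^-1 :> R by rewrite invr_gt0.
have /choice[q Hq] : forall j : 'I_k, exists q : rat, `|tnth x j - ratr q| < m.+1%:R^-1.
  move=> j; have [|q] := @rat_in_itvoo R (tnth x j - m.+1%:R^-1) (tnth x j + m.+1%:R^-1).
    by rewrite ltrBlDr -addrA ltrDl addr_gt0.
  rewrite in_itv/= => /andP[h1 h2]; exists q; rewrite ltr_norml.
  by move: h1 h2; move: (m.+1%:R^-1) (ratr q) => w q' h1 h2; apply/andP; split; lra.
exists (choice.pickle ([tuple q j | j < k], m)) => //.
have xb : box [tuple q j | j < k] m x by move=> j; rewrite tnth_mktuple.
rewrite /F choice.pickleK asboolT// => z zb; apply: eU => j.
rewrite (_ : _ - _ = (tnth z j - ratr (q j)) + (ratr (q j) - tnth x j)); last by ring.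
have := zb j; rewrite tnth_mktuple => zj.
apply: le_lt_trans (ler_normD _ _) _; rewrite [X in _ + X]distrC.
by move: zj (Hq j) me; move: (`|_|) (`|_|) (m.+1%:R^-1) => a b w; lra.
Qed.

Lemma measurable_fun_sublevel (f : E -> R) :
  (forall a, measurable [set x | f x < a]) -> measurable_fun setT f.
Proof.
move=> H mD; apply: (measurability _ (RGenInftyO.measurableE R)) => //.
move=> _ [_ [r ->] <-]; rewrite setTI (_ : _ @^-1` _ = [set x | f x < r]); first exact: H.
by apply/seteqP; split => x /=; rewrite in_itv.
Qed.

End open_tuples.

Section quad_continuous.
Context {R : realType} {n : nat} {d : 'I_n -> nat}.
Local Notation E := (Espace R d).
Variable Q : 'M[R]_(dimE d).

Lemma quad_continuous (u : E) (eps : R) : 0 < eps -> exists2 e, 0 < e &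
  forall v, (forall a, `|tnth v a - tnth u a| < e) -> `|quad Q v - quad Q u| < eps.
Proof.
move=> eps0; pose M : R := 1 + 2 * \sum_a `|tnth u a|.
have M0 : 0 < M by rewrite ltr_pwDl// mulr_ge0// sumr_ge0.
have Q0 := qnorm_gt0 Q.
have e10 : 0 < eps / (2 * qnorm Q * M) by rewrite divr_gt0// !mulr_gt0.
exists (Num.min 1 (eps / (2 * qnorm Q * M))); first by rewrite lt_min ltr01.
move=> v Hv; set e := Num.min _ _ in Hv.
have e1 : e <= 1 by rewrite ge_min lexx.
have e0 : 0 < e by rewrite lt_min ltr01.
have u_le a : `|tnth u a| <= \sum_a `|tnth u a| by rewrite (bigD1 a)//= lerDl sumr_ge0.
apply: le_lt_trans (@quad_lipschitz _ _ _ Q v u (e * M) _ _) _.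
- by rewrite mulr_ge0// ltW.
- move=> a b.
  have -> : tnth v a * tnth v b - tnth u a * tnth u b =
    (tnth v a - tnth u a) * (tnth v b - tnth u b) + tnth u a * (tnth v b - tnth u b)
    + (tnth v a - tnth u a) * tnth u b by ring.
  have va := ltW (Hv a); have vb := ltW (Hv b).
  apply: le_trans (ler_normD _ _) _; apply: le_trans (lerD (ler_normD _ _) (lexx _)) _.
  rewrite !normrM.
  have h1 : `|tnth v a - tnth u a| * `|tnth v b - tnth u b| <= e * 1.
    by rewrite ler_pM// (le_trans vb).
  have h2 : `|tnth u a| * `|tnth v b - tnth u b| <= (\sum_a `|tnth u a|) * e.
    by rewrite ler_pM.
  have h3 : `|tnth v a - tnth u a| * `|tnth u b| <= e * (\sum_a `|tnth u a|).
    by rewrite ler_pM.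
  by rewrite /M; lra.
- apply: (@le_lt_trans _ _ (qnorm Q * (eps / (2 * qnorm Q * M) * M))).
    by rewrite ler_pM2l// ler_pM2r// ge_min lexx orbT.
  rewrite (_ : _ * _ = eps / 2); last by field; rewrite !gt_eqF.
  by rewrite ltr_pdivrMr// ltr_pMr// ltr1n.
Qed.

End quad_continuous.

Section concave_step.
Context {R : realType} {n : nat} {d : 'I_n -> nat}.
Local Notation E := (Espace R d).
Variables (c : 'I_n -> R) (Q : 'M[R]_(dimE d)) (r : R).
Hypothesis c0 : forall i, 0 < c i.
Hypothesis psd : forall k (v : E),
  (forall i, i != k -> forall j, tnth (proj i v) j = 0) -> 0 <= quad Q v.

(** The constraint of (A) for [f i = - ln (g i)]. It is imposed only where all [g i] are positive: a
    zero of [g i] stands for [f i = +oo], while the default value is [ln 0 = 0]. *)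
Definition admissible (g : forall i, (d i).-tuple R -> R) : Prop :=
  [/\ forall i, measurable_fun setT (g i), forall i x, 0 <= g i x,
      forall i x, g i (tneg x) = g i x, forall i x, 0 < g i x -> cube r x &
      (forall i, exists x, 0 < g i x) /\
      forall y : E, (forall i, 0 < g i (proj i y)) ->
        quad Q y <= - \sum_i c i * ln (g i (proj i y))].

Definition bounded_log_concave k (h : k.-tuple R -> R) :=
  log_concave_fun h /\ exists M, forall x, h x <= M.

Lemma dfwith_ind (P : forall i, ((d i).-tuple R -> R) -> Prop) g k h :
  P k h -> (forall i, P i (g i)) -> forall i, P i (dfwith g k h i).
Proof.
move=> Pk Pg i; case: (eqVneq k i) => [|ki]; last by rewrite dfwithout.
by case: i /; rewrite dfwithin.
Qed.

Lemma upd_close (y : E) k (x z : (d k).-tuple R) (e : R) : 0 < e ->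
  (forall j, `|tnth z j - tnth x j| < e) ->
  forall a, `|tnth (upd y z) a - tnth (upd y x) a| < e.
Proof.
move=> e0 H a; rewrite -(tagnat.sig2K a) -/(bidx _) -!tnth_proj.
case: (eqVneq k (tagnat.sig1 a)) => [ki|ki].
  by move: (tagnat.sig2 a); rewrite -ki => j; rewrite !proj_upd.
by rewrite !proj_upd_neq// subrr normr0.
Qed.

Lemma upd_self (y : E) k (x : (d k).-tuple R) : proj k y = x -> upd y x = y.
Proof.
move=> yx; apply: eq_proj => i; case: (eqVneq k i) => [|ki].
  by case: i /; rewrite proj_upd.
by rewrite proj_upd_neq.
Qed.

Lemma upd_tneg (y : E) k (x : (d k).-tuple R) : upd (tneg y) (tneg x) = tneg (upd y x).
Proof.
apply: eq_proj => i; rewrite proj_tneg; case: (eqVneq k i) => [|ki].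
  by case: i /; rewrite !proj_upd.
by rewrite !proj_upd_neq// proj_tneg.
Qed.

Lemma upd_lcomb (y : E) k (x z : (d k).-tuple R) t :
  upd y [tuple t * tnth x j + (1 - t) * tnth z j | j < d k] =
  lcomb t (1 - t) (upd y x) (upd y z).
Proof.
apply: eq_from_tnth => a; rewrite [RHS]tnth_mktuple -(tagnat.sig2K a) -/(bidx _) -!tnth_proj.
case: (eqVneq k (tagnat.sig1 a)) => [ki|ki].
  move: (tagnat.sig2 a); rewrite -ki => j; by rewrite !proj_upd tnth_mktuple.
by rewrite !proj_upd_neq//; ring.
Qed.

Lemma quad_upd_convex (y : E) k (x z : (d k).-tuple R) t : 0 <= t <= 1 ->
  quad Q (upd y [tuple t * tnth x j + (1 - t) * tnth z j | j < d k]) <=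
  t * quad Q (upd y x) + (1 - t) * quad Q (upd y z).
Proof.
move=> /andP[t0 t1]; rewrite upd_lcomb -subr_ge0 quad_convex_identity.
rewrite !mulr_ge0 ?subr_ge0//; apply: (psd (k := k)) => i ik j.
rewrite tnth_proj [tnth (lcomb _ _ _ _) _]tnth_mktuple -!tnth_proj.
by rewrite !proj_upd_neq ?(eq_sym k)//; ring.
Qed.

(* The constraint on the [k]-th function reads [g k x <= Gam y x] for all [y : Y];
   each [Gam y] is log-concave because [quad Q] is convex along the block [k]. *)
Lemma concave_step g k : admissible g -> exists h : (d k).-tuple R -> R,
  [/\ admissible (dfwith g k h), bounded_log_concave h & forall x, g k x <= h x].
Proof.
move=> [mg g0 geven gr [gpos gfeas]].
pose Y := [set y : E | forall i, i != k -> 0 < g i (proj i y)].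
pose s (y : E) := \sum_(i | i != k) c i * ln (g i (proj i y)).
pose Gam y (x : (d k).-tuple R) := expR ((- quad Q (upd y x) - s y) / c k).
pose I x := inf [set Gam y x | y in Y].
pose h x := \1_(cube r) x * I x.
have ck := c0 k.
(* A point of [Y] makes the infimum that of a nonempty set; [Gam y0] will also bound [h] from
   above. *)
pose y0 : E := joint (fun i => sval (cid (gpos i))).
have Yy0 : Y y0 by move=> i _; rewrite proj_joint; case: cid.
have hasinf x : has_inf [set Gam y x | y in Y].
  split; first by exists (Gam y0 x), y0.
  by exists 0 => _ [y _ <-]; exact: expR_ge0.
have I0 x : 0 <= I x.
  by apply: lb_le_inf (hasinf x).1 _ => _ [y _ <-]; exact: expR_ge0.
have h0 x : 0 <= h x by rewrite mulr_ge0.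
have I_le x y : Y y -> I x <= Gam y x.
  by move=> Yy; apply: (ge_inf (hasinf x).2); exists y.
have h_le x y : Y y -> h x <= Gam y x.
  move=> Yy; apply: le_trans (I_le x y Yy); rewrite /h indicE.
  by case: (x \in _); rewrite ?mul1r// mul0r.
have le_h x a : cube r x -> (forall y, Y y -> a <= Gam y x) -> a <= h x.
  move=> xr H; rewrite /h indicE mem_set// mul1r.
  by apply: lb_le_inf (hasinf x).1 _ => _ [y Yy <-]; exact: H.
have hr x : 0 < h x -> cube r x.
  by rewrite /h indicE; case: (boolP (x \in cube r)) => [/[!inE]//|_]; rewrite mul0r ltxx.
have sum_k (F : 'I_n -> R) : \sum_i F i = F k + \sum_(i | i != k) F i by rewrite (bigD1 k).
have gh x : g k x <= h x.
  have := g0 k x; rewrite le_eqVlt => /predU1P[<-//|gx].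
  apply: le_h => [|y Yy]; first exact: (gr k).
  rewrite /Gam -[leLHS]lnK ?posrE// ler_expR ler_pdivlMr// mulrC.
  have := gfeas (upd y x); rewrite sum_k proj_upd => H.
  have -> : s y = \sum_(i | i != k) c i * ln (g i (proj i (upd y x))).
    by apply: eq_bigr => i ik; rewrite proj_upd_neq// eq_sym.
  rewrite lerBrDr -lerN2 opprK H// => i.
  case: (eqVneq k i) => [|ki]; first by case: i /; rewrite proj_upd.
  by rewrite proj_upd_neq//; apply: Yy; rewrite eq_sym.
have mI : measurable_fun setT I.
  (* If the infimum is below [a] at [x], then some [Gam y] is, and by continuity it stays below [a]
     near [x]. *)
  apply: measurable_fun_sublevel => a; apply: measurable_tuple_open => x Ixa.
  have [_ [y Yy <-] Ga] := inf_lt (hasinf x).1 Ixa.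
  have a0 : 0 < a by apply: lt_trans Ga; exact: expR_gt0.
  pose eps := c k * ln a + quad Q (upd y x) + s y.
  have eps0 : 0 < eps.
    move: Ga; rewrite /Gam -[a in X in X -> _]lnK ?posrE// ltr_expR ltr_pdivrMr//.
    by rewrite /eps; lra.
  have [e e0 He] := quad_continuous Q (upd y x) eps0.
  exists e; first exact: e0.
  move=> z Hz; apply: (le_lt_trans (I_le z y Yy)).
  rewrite /Gam -[ltRHS]lnK ?posrE// ltr_expR ltr_pdivrMr//.
  have := He _ (upd_close y e0 Hz); rewrite ltr_norml /eps => /andP[].
  lra.
have mh : measurable_fun setT h.
  by apply: measurable_funM => //; apply: measurable_indic; exact: measurable_cube.
have cube_tneg (x : (d k).-tuple R) : cube r x -> cube r (tneg x).
  by move=> xr j; rewrite tnth_tneg normrN.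
have heven x : h (tneg x) = h x.
  (* [Y] is symmetric and [Gam y (tneg z) = Gam (tneg y) z]; the inequality at [x] and at [tneg x]
     gives equality. *)
  suff H z : h z <= h (tneg z).
    have h1 := H x; have h2 := H (tneg x); rewrite (tnegK x) in h2.
    exact: (le_anti (introT andP (conj h2 h1))).
  have := h0 z; rewrite le_eqVlt => /predU1P[<-//|hz].
  apply: le_h => [|y Yy]; first by apply: cube_tneg; exact: hr.
  have -> : Gam y (tneg z) = Gam (tneg y) z.
    have sE : s (tneg y) = s y.
      by apply: eq_bigr => i _; rewrite (proj_tneg i y) (geven i).
    have uE : upd y (tneg z) = tneg (upd (tneg y) z).
      by have := upd_tneg (tneg y) z; rewrite (tnegK y).
    by rewrite /Gam sE uE (quad_tneg Q (upd (tneg y) z)).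
  by apply: h_le => i ik; rewrite (proj_tneg i y) (geven i); exact: Yy.
clearbody h; exists h; split => //.
- split.
  + by apply: (dfwith_ind (P := fun i (f : (d i).-tuple R -> R) => measurable_fun setT f)).
  + by apply: (dfwith_ind (P := fun i f => forall x, 0 <= f x)).
  + by apply: (dfwith_ind (P := fun i f => forall x, f (tneg x) = f x)).
  + by apply: (dfwith_ind (P := fun i f => forall x, 0 < f x -> cube r x)).
  + split.
      apply: (dfwith_ind (P := fun i f => exists x, 0 < f x)) => //.
      by have [x gx] := gpos k; exists x; exact: lt_le_trans (gh x).
    move=> y Hy; have Yy : Y y.
      by move=> i ik; have := Hy i; rewrite dfwithout// eq_sym.
    have hy := Hy k; rewrite dfwithin in hy.
    rewrite sum_k dfwithin (eq_bigr (fun i => c i * ln (g i (proj i y)))); last first.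
      by move=> i ik; rewrite dfwithout// eq_sym.
    have := h_le (proj k y) y Yy.
    rewrite /Gam upd_self// -[X in X <= _]lnK ?posrE// ler_expR ler_pdivlMr//.
    by rewrite -/(s y) [_ * c k]mulrC; lra.
- split.
    move=> x y t t01; have /andP[t0 t1] := t01.
    have [tE|tN0] := eqVneq t 0.
      rewrite tE powRr0 mul1r subr0 powRr1//.
      rewrite (_ : [tuple _ | _ < _] = y)//.
      by apply: eq_from_tnth => j; rewrite tnth_mktuple mul0r add0r mul1r.
    have [tE|tN1] := eqVneq t 1.
      rewrite tE subrr powRr0 mulr1 powRr1//.
      rewrite (_ : [tuple _ | _ < _] = x)//.
      by apply: eq_from_tnth => j; rewrite tnth_mktuple mul0r addr0 mul1r.
    have := h0 x; rewrite le_eqVlt => /predU1P[<-|hx].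
      by rewrite powR0// mul0r.
    have := h0 y; rewrite le_eqVlt => /predU1P[<-|hy].
      by rewrite [X in _ * X]powR0 ?mulr0// subr_eq0 eq_sym.
    apply: le_h => [j|y' Yy'].
      by rewrite tnth_mktuple; apply: normr_convex_lt => //; [exact: (hr _ hx)|exact: (hr _ hy)].
    have t1' : 0 <= 1 - t by rewrite subr_ge0.
    apply: (@le_trans _ _ (Gam y' x `^ t * Gam y' y `^ (1 - t))).
      apply: ler_pM; rewrite ?powR_ge0//; apply: ge0_ler_powR => //;
        by rewrite ?nnegrE ?expR_ge0 ?h0 ?h_le.
    rewrite /Gam -!expRM -expRD ler_expR.
    rewrite -!mulrA ![(c k)^-1 * _]mulrC !mulrA -mulrDl ler_wpM2r ?invr_ge0 ?(ltW ck)//.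
    have := quad_upd_convex y' x y t01; lra.
(* On the cube, [upd y0 x] has squared norm at most that of [y0] plus [(d k)%:R * r ^+ 2]. *)
- exists (expR ((qnorm Q * (sqE y0 + (d k)%:R * r ^+ 2) + `|s y0|) / c k)) => x.
  have := h0 x; rewrite le_eqVlt => /predU1P[<-|/hr xr]; first exact: expR_ge0.
  apply: le_trans (h_le x y0 Yy0) _; rewrite ler_expR ler_wpM2r ?invr_ge0 ?(ltW ck)//.
  apply: lerD; last by rewrite (le_trans (ler_norm _))// normrN.
  apply: le_trans (ler_norm _) _; rewrite normrN; apply: le_trans (quad_bound _ _) _.
  rewrite ler_wpM2l ?(ltW (qnorm_gt0 _))// /sqE sum_k proj_upd addrC.
  apply: lerD; last exact: sqnorm_cube.
  rewrite [leRHS](bigD1 k)//= -[leLHS]add0r; apply: lerD; first exact: sqnorm_ge0.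
  by apply: ler_sum => i ik; rewrite proj_upd_neq// eq_sym.
Qed.

(** A single pass over the blocks suffices: a replacement changes one function only, so those
    already made log-concave remain so, and admissibility is kept. *)
Lemma log_concave_majorant g : admissible g -> exists h,
  [/\ admissible h, forall i, bounded_log_concave (h i) & forall i x, g i x <= h i x].
Proof.
move=> gadm.
suff H m : (m <= n)%N -> exists h : forall i, (d i).-tuple R -> R,
    [/\ admissible h, forall i : 'I_n, (i < m)%N -> bounded_log_concave (h i) &
      forall i x, g i x <= h i x].
  have [h [h1 h2 h3]] := H n (leqnn n).
  by exists h; split => // i; exact: h2.
elim: m => [_|m IH mn]; first by exists g.
have [h [hadm hlc gh]] := IH (ltnW mn).
have [f [fadm flc hf]] := concave_step (Ordinal mn) hadm.
exists (dfwith h (Ordinal mn) f); split => // i.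
  rewrite ltnS leq_eqVlt => im; case: (eqVneq (Ordinal mn) i) => [e|mi].
    by move=> {im}; case: i / e; rewrite dfwithin.
  rewrite dfwithout//; apply: hlc; case/orP: im => // /eqP im.
  by case/eqP: mi; exact/val_inj.
case: (eqVneq (Ordinal mn) i) => [|mi]; last by rewrite dfwithout.
by case: i / => x; rewrite dfwithin; exact: le_trans (hf x).
Qed.

End concave_step.

(** * Entropy of normalized bounded functions on a cube *)

Section normalized_density.
Context {R : realType} {k : nat}.
Local Notation E := (k.-tuple R).
Variables (h : E -> R) (r M z : R).
Hypotheses (mh : measurable_fun setT h) (h0 : forall x, 0 <= h x)
  (heven : forall x, h (tneg x) = h x) (hr : forall x, 0 < h x -> cube r x)
  (hM : forall x, h x <= M) (r0 : 0 < r)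
  (hz : (\int[leb k]_x (h x)%:E = z%:E)%E) (z0 : 0 < z).

Definition ndens (x : E) : R := h x / z.

Lemma measurable_ndens : measurable_fun setT ndens.
Proof. exact: measurable_funM. Qed.

Lemma ndens_ge0 x : 0 <= ndens x.
Proof. by rewrite divr_ge0// ltW. Qed.

Let h_supp x : ~ cube r x -> h x = 0.
Proof.
move=> xr; have := h0 x; rewrite le_eqVlt => /predU1P[//|/hr]; by move/xr.
Qed.

Lemma integral_ndens : (\int[leb k]_x (ndens x)%:E = 1)%E.
Proof.
under eq_integral do rewrite /ndens mulrC EFinM.
rewrite ge0_integralZl_EFin ?invr_ge0 ?(ltW z0)//; last exact/measurable_EFinP.
  by rewrite hz -EFinM mulVf// gt_eqF.
by move=> x _; rewrite lee_fin.
Qed.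

Lemma Pdens_ndens : is_Pdens ndens.
Proof.
have mu := measurable_ndens; have u0 := ndens_ge0.
split => //; first by rewrite leb_int_EFin// integral_ndens.
rewrite leb_int_EFin; last 2 first.
- by apply: measurable_funM => //; exact: measurable_sqnorm.
- by move=> x; rewrite mulr_ge0// sqnorm_ge0.
apply: (@le_lt_trans _ _ (\int[leb k]_x ((`|k%:R * r ^+ 2|)%:E * (ndens x)%:E))%E).
  apply: le_integralT.
  - by apply/measurable_EFinP/measurable_funM => //; exact: measurable_sqnorm.
  - by apply: emeasurable_funM => //; exact/measurable_EFinP.
  - move=> x; rewrite -EFinM lee_fin.
    have [xr|/h_supp xr] := pselect (cube r x); last by rewrite /ndens xr !mul0r mulr0.
    by rewrite mulrC ler_wpM2r// (le_trans (sqnorm_cube xr))// ler_norm.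
rewrite ge0_integralZl_EFin//; last exact/measurable_EFinP.
  by rewrite integral_ndens mule1 ltry.
by move=> x _; rewrite lee_fin.
Qed.

Lemma symm_ndens : symm_dens ndens.
Proof.
apply: even_symm_dens; [exact: measurable_ndens|exact: ndens_ge0|].
by move=> x; rewrite /ndens heven.
Qed.

Lemma logconcave_ndens : log_concave_fun h -> logconcave_dens ndens.
Proof.
move=> hlc; exists ndens; split => //; [exact: measurable_ndens|exact: ndens_ge0|].
move=> x y t t01; have /andP[t0 t1] := t01.
rewrite /ndens !powRM ?invr_ge0 ?(ltW z0)// mulrACA -powRD; last first.
  by rewrite addrC subrK oner_eq0.
rewrite (_ : t + (1 - t) = 1) ?powRr1 ?invr_ge0 ?(ltW z0)//; last by ring.
by rewrite ler_wpM2r ?invr_ge0 ?(ltW z0)//; exact: hlc.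
Qed.

(** For [0 < a <= M], [ln a <= a - 1] gives [a * ln a <= M ^+ 2], and [- ln a <= 1 / a - 1] gives
    [- a * ln a <= 1]. *)
Let xlnx_le x : `|- ln (h x) * h x| <= (1 + M ^+ 2) * \1_(cube r) x.
Proof.
rewrite indicE; have := h0 x; rewrite le_eqVlt => /predU1P[<-|hx].
  by rewrite mulr0 normr0 mulr_ge0// addr_ge0// sqr_ge0.
rewrite mem_set; last exact: hr.
rewrite mulr1; have := expR_ge1Dx (ln (h x)); have := expR_ge1Dx (- ln (h x)).
rewrite expRN lnK ?posrE// => l1 l2.
have := ler_wpM2l (ltW hx) l1; rewrite mulfV ?gt_eqF// => l3.
have := ler_wpM2l (ltW hx) l2 => l4.
have := hM x; move: (h x) (ln (h x)) hx l1 l2 l3 l4 => a l a0 l1 l2 l3 l4 aM.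
have aa : a * a <= M ^+ 2 by rewrite expr2 ler_pM// ltW.
have M2 := sqr_ge0 M.
rewrite ler_norml; apply/andP; split; nra.
Qed.

(** The equality case of Gibbs' inequality, for the potential [- ln h]: with [rho = h / z],
    [- rho * ln rho = ln z * rho - ln h * rho], also where [h = 0]. Boundedness and support in a
    cube make [- ln h] integrable, which will permit its cancellation. *)
Lemma ndens_logE (P : probability E R) :
  (forall A, measurable A -> P A = \int[leb k]_(x in A) (ndens x)%:E)%E ->
  P.-integrable setT (fun x => (- ln (h x))%:E) /\
  entropy ndens = ((ln z)%:E + \int[P]_x (- ln (h x))%:E)%E.
Proof.
move=> HP; have mu := measurable_ndens; have u0 := ndens_ge0.
have ml : measurable_fun setT (fun x => - ln (h x)).
  by apply: measurableT_comp => //; exact: measurableT_comp.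
have hli : (leb k).-integrable setT (fun x => (- ln (h x) * h x)%:E).
  apply: (@le_integrable _ _ _ (leb k) _ measurableT _
    (fun x => ((1 + M ^+ 2)%:E * (\1_(cube r) x)%:E)%E)).
  - by apply/measurable_EFinP/measurable_funM.
  - move=> x _; rewrite -EFinM !abse_EFin lee_fin (le_trans (xlnx_le x))//.
    exact: ler_norm.
  - apply: integrableZl => //; apply/integrableP; split.
      by apply/measurable_EFinP; apply: measurable_indic; exact: measurable_cube.
    under eq_integral do rewrite gee0_abs ?lee_fin//.
    rewrite integral_indic//; last exact: measurable_cube.
    by rewrite setIT [X in (X < _)%E]leb_cube// ltry.
have lE : (fun x => (- ln (h x) * ndens x)%:E) =
    (fun x => z^-1%:E * (- ln (h x) * h x)%:E)%E.
  by apply/funext => x; rewrite -EFinM /ndens mulrA mulrC.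
have lni : (leb k).-integrable setT (fun x => (- ln (h x) * ndens x)%:E).
  by rewrite lE; exact: integrableZl.
split.
  apply/integrableP; split; first exact/measurable_EFinP.
  have := integral_density mu u0 HP.
  move=> /(_ (fun x => `|(- ln (h x))%:E|)%E) ->//.
    case/integrableP: lni => _; apply: le_lt_trans.
    rewrite le_eqVlt; apply/orP; left; apply/eqP; apply: eq_integral => x _.
    by rewrite (EFinM (- ln (h x)) (ndens x)) abseM (@gee0_abs _ (ndens x)%:E) ?lee_fin.
  by apply: measurableT_comp => //; exact/measurable_EFinP.
rewrite entropyE// (integral_densityT mu u0 HP ml).
have -> : (fun x => (- (ndens x * ln (ndens x)))%:E) =
    (fun x => (ln z)%:E * (ndens x)%:E + (- ln (h x) * ndens x)%:E)%E.
  apply/funext => x; rewrite -EFinM -EFinD; congr EFin.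
  have := h0 x; rewrite le_eqVlt => /predU1P[hx|hx].
    by rewrite /ndens -hx !mul0r !mulr0 addr0 oppr0.
  by rewrite {2}/ndens lnM ?posrE ?invr_gt0// lnV ?posrE//; ring.
have ui : (leb k).-integrable setT (fun x => (ndens x)%:E).
  apply/integrableP; split; first exact/measurable_EFinP.
  under eq_integral do rewrite gee0_abs ?lee_fin//.
  by rewrite integral_ndens ltry.
rewrite integralD//; last exact: integrableZl.
by rewrite integralZl// integral_ndens mule1.
Qed.

End normalized_density.

Section mass_bound.
Context {R : realType} {n : nat} {d : 'I_n -> nat}.
Local Notation E := (Espace R d).
Variables (c : 'I_n -> R) (Q : 'M[R]_(dimE d)) (r D : R).
Hypotheses (c0 : forall i, 0 < c i) (r0 : 0 < r).

(** The entropies contribute [ln (z i)] and the integrals [L i] of [- ln (h i)]. The constraint,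
    integrated against any coupling, bounds the supremum in (B) by the sum of the [c i * L i], and
    these finite terms cancel. *)
Lemma log_concave_mass_bound (h : forall i, (d i).-tuple R -> R) (z : 'I_n -> R) :
  condB_lc c Q D%:E -> admissible c Q r h ->
  (forall i, bounded_log_concave (h i)) ->
  (forall i, \int[leb (d i)]_x (h i x)%:E = (z i)%:E)%E -> (forall i, 0 < z i) ->
  \sum_i c i * ln (z i) <= D.
Proof.
move=> B [mh h0 heven hr [_ hfeas]] hlc hz z0.
pose M i := sval (cid (hlc i).2).
have hM i x : h i x <= M i by rewrite /M; case: cid.
pose rho i := ndens (h i) (z i).
have Hrho i : is_Pdens (rho i) := Pdens_ndens (mh i) (h0 i) (hr i) (hz i) (z0 i).
have := B rho Hrho (fun i => symm_ndens (mh i) (h0 i) (heven i) (z0 i))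
  (fun i => logconcave_ndens (mh i) (h0 i) (z0 i) (hlc i).1).
rewrite /Bineq => Bi.
pose P i := sval (cid (Pdens_probability (Hrho i))).
have HP i A : measurable A -> P i A = (\int[leb (d i)]_(x in A) (rho i x)%:E)%E.
  by rewrite /P; case: cid => /= Pi [+ _ _]; apply.
have HPd i A : measurable A -> P i A = dens_meas (rho i) A.
  by rewrite /P; case: cid => /= Pi [_ + _]; apply.
have logE i := ndens_logE (mh i) (h0 i) (hr i) (hM i) r0 (hz i) (z0 i) (HP i).
have li i : (P i).-integrable setT (fun x => (- ln (h i x))%:E) := (logE i).1.
pose L i := fine (\int[P i]_x (- ln (h i x))%:E)%E.
have LE i : (\int[P i]_x (- ln (h i x))%:E = (L i)%:E)%E.
  by rewrite fineK//; exact: integrable_fin_num.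
have lhsE : (\sum_i (c i)%:E * entropy (rho i) =
    (\sum_i c i * ln (z i) + \sum_i c i * L i)%:E)%E.
  rewrite EFinD -!sumEFin -big_split/=; apply: eq_bigr => i _.
  by rewrite (logE i).2 LE -EFinD -EFinM mulrDr EFinD.
suff sup_le : (ereal_sup [set \int[mu]_x (quad Q x)%:E
    | mu in [set mu : probability E R | coupling rho mu]] <= (\sum_i c i * L i)%:E)%E.
  have := le_trans Bi (leeD2r D%:E sup_le).
  by rewrite lhsE -EFinD lee_fin addrC lerD2l.
apply: ge_ereal_sup => _ [mu Hmu <-].
have muP i A : measurable A -> P i A = mu (proj i @^-1` A).
  by move=> mA; rewrite [RHS]Hmu//; exact: HPd.
have projm i : measurable_fun setT (@proj R _ d i) by exact: measurable_proj.
have lmu i : mu.-integrable setT (fun y => (- ln (h i (proj i y)))%:E).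
  exact: (integrable_image (projm i) (muP i) (li i)).
have ml i : measurable_fun setT (fun x => (- ln (h i x))%:E) by case/integrableP: (li i).
apply: (@le_trans _ _ (\int[mu]_y (\sum_i c i * - ln (h i (proj i y)))%:E)%E).
  apply: le_integral_ae.
  - exact: measurable_quad.
  - apply: measurable_sum => i; apply: measurable_funM => //.
    by case/integrableP: (lmu i) => /measurable_EFinP.
  (* The constraint is known where all [h i] are positive; this is almost sure, since the [i]-th
     marginal has density proportional to [h i]. *)
  have : \forall y \ae mu, forall i, 0 < h i (proj i y).
    apply: filter_forall => i.
    have mZ : measurable [set x | h i x = 0].
      rewrite (_ : [set x | _] = h i @^-1` [set 0])//.
      by rewrite -[X in measurable X]setTI; apply: mh => //; exact: measurable_set1.
    exists (proj i @^-1` [set x | h i x = 0]); split.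
    - by rewrite -[X in measurable X]setTI; exact: projm.
    - rewrite -muP// HP// integral0_eq// => x /= hx.
      by rewrite /rho /ndens hx mul0r.
    - move=> y /= /negP; rewrite -leNgt => hy.
      by apply/eqP; rewrite eq_le hy h0.
  apply: filterS => y /hfeas; rewrite -sumrN => /le_trans; apply.
  by apply: ler_sum => i _; rewrite mulrN.
have -> : (fun y => (\sum_i c i * - ln (h i (proj i y)))%:E) =
    (fun y => \sum_i (c i)%:E * (- ln (h i (proj i y)))%:E)%E.
  by apply/funext => y; rewrite -sumEFin; apply: eq_bigr => i _; rewrite EFinM.
rewrite integral_sum//; last by move=> i; exact: integrableZl.
rewrite -sumEFin; apply: lee_sum => i _; rewrite integralZl// EFinM -LE.
by rewrite (integral_imageT (projm i) (muP i) (ml i)).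
Qed.

End mass_bound.

(** * From log-concave densities back to functions *)

Section exp_neg.
Context {R : realType} {k : nat} (f : k.-tuple R -> \bar R).
Hypotheses (mf : measurable_fun setT f) (fN : forall x, f x != -oo%E).

(** As [-oo] is excluded, [fine] loses nothing; the value is 0 where [f = +oo]. *)
Definition exp_neg (x : k.-tuple R) : R := fine (expeR (- f x)).

Lemma exp_negE x : (exp_neg x)%:E = expeR (- f x).
Proof. by rewrite /exp_neg; case: (f x) (fN x) => [a||]. Qed.

Lemma exp_neg_ge0 x : 0 <= exp_neg x.
Proof. by rewrite /exp_neg fine_ge0// expeR_ge0. Qed.

Lemma exp_neg_gt0 x : 0 < exp_neg x -> f x = (- ln (exp_neg x))%:E.
Proof.
rewrite /exp_neg; case: (f x) (fN x) => [a _ _||] //=; last by rewrite ltxx.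
by rewrite expRK opprK.
Qed.

Lemma measurable_exp_neg : measurable_fun setT exp_neg.
Proof.
apply: measurable_fun_sublevel => a.
have [a0|a0] := leP a 0.
  rewrite (_ : [set x | _] = set0)//; apply/seteqP; split => // x /=.
  by rewrite ltNge (le_trans a0 (exp_neg_ge0 x)).
rewrite (_ : [set x | _] = setT `&` [set x | ((- ln a)%:E < f x)%E]).
  exact: emeasurable_fun_o_infty.
have aE : a%:E = expeR (ln a)%:E by rewrite /= lnK.
rewrite setTI; apply/seteqP; split => x;
  by rewrite /mkset -lte_fin exp_negE aE lte_expeR lteNl EFinN.
Qed.

End exp_neg.

Lemma cube_covers {R : realType} {k : nat} (x : k.-tuple R) :
  \forall m \near \oo, cube m.+1%:R x.
Proof.
near=> m => j; apply: (@lt_trans _ _ m%:R); last by rewrite ltr_nat.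
apply: (@le_lt_trans _ _ (\sum_(j < k) `|tnth x j|)).
  by rewrite (bigD1 j)//= lerDl sumr_ge0.
by near: m; exact: nbhs_infty_gtr.
Unshelve. all: by end_near.
Qed.

Section condB_lc_condA.
Context {R : realType} {n : nat} {d : 'I_n -> nat}.
Local Notation E := (Espace R d).
Variables (c : 'I_n -> R) (Q : 'M[R]_(dimE d)).
Hypothesis c0 : forall i, 0 < c i.

Lemma condB_lc_condA_fin (D : R) : condB_lc c Q D%:E -> condA c Q D%:E.
Proof.
move=> B f mf fN feven fint ffeas.
have psd k (v : E) : (forall i, i != k -> forall j, tnth (proj i v) j = 0) -> 0 <= quad Q v.
  by move=> vk; rewrite leNgt; apply/negP => /(negative_direction c0 vk)/(_ B).
pose e i := exp_neg (f i).
have eE i x : (e i x)%:E = expeR (- f i x) by exact: exp_negE.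
have e0 i x : 0 <= e i x by exact: exp_neg_ge0.
have me i : measurable_fun setT (e i) by exact: measurable_exp_neg.
have lebE i : leb_int (fun x => expeR (- f i x)) = (\int[leb (d i)]_x (e i x)%:E)%E.
  by rewrite -leb_int_EFin//; congr leb_int; apply/funext => x; rewrite eE.
pose Z i := fine (leb_int (fun x => expeR (- f i x))).
have ZE i : (\int[leb (d i)]_x (e i x)%:E = (Z i)%:E)%E.
  rewrite /Z fineK ?lebE// ge0_fin_numE -?lebE//.
  by rewrite lebE; apply: integral_ge0 => x _; rewrite lee_fin.
have Z0 i : 0 <= Z i.
  by rewrite -lee_fin -ZE; apply: integral_ge0 => x _; rewrite lee_fin.
change ((\prod_(i < n) Z i `^ c i)%:E <= (expR D)%:E)%E; rewrite lee_fin.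
(* A vanishing mass makes the product 0; otherwise one may take logarithms. *)
have [[i Zi]|Zpos] := pselect (exists i, Z i = 0).
  by rewrite (bigD1 i)//= Zi powR0 ?mul0r ?expR_ge0// gt_eqF.
have {}Z0 i : 0 < Z i.
  by rewrite lt_neqAle Z0 andbT; apply/eqP => Zi; apply: Zpos; exists i.
pose g m i x : R := e i x * \1_(cube m.+1%:R) x.
have mg m i : measurable_fun setT (g m i).
  by apply: measurable_funM; [exact: me|apply: measurable_indic; exact: measurable_cube].
have g0 m i x : 0 <= g m i x by rewrite mulr_ge0.
have gcvg i : (\int[leb (d i)]_x (g m i x)%:E @[m --> \oo] --> (Z i)%:E)%E.
  rewrite -ZE; apply: cvg_integral_nondecreasing => [m|m x|x p q pq|x].
  - by apply/measurable_EFinP; exact: mg.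
  - by rewrite lee_fin.
  - rewrite lee_fin ler_wpM2l// !indicE.
    have [/[!inE] xp|_] := boolP (x \in cube p.+1%:R); last by rewrite ler0n.
    rewrite mem_set// => j; apply: lt_le_trans (xp j) _.
    by rewrite ler_nat ltnS.
  - apply: cvg_near_cst; near=> m; rewrite /g indicE mem_set ?mulr1//.
    by near: m; exact: cube_covers.
pose z m i := fine (\int[leb (d i)]_x (g m i x)%:E)%E.
have zE m i : (\int[leb (d i)]_x (g m i x)%:E = (z m i)%:E)%E.
  rewrite fineK// ge0_fin_numE; last by apply: integral_ge0 => x _; rewrite lee_fin.
  apply: (@le_lt_trans _ _ (Z i)%:E); last exact: ltry.
  rewrite -ZE; apply: le_integralT;
    [by apply/measurable_EFinP; exact: mg|by apply/measurable_EFinP; exact: me|].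
  move=> x; rewrite lee_fin /g indicE; case: (x \in _); rewrite ?mulr1// mulr0.
  exact: e0.
have zcvg i : z m i @[m --> \oo] --> Z i by have /fine_cvgP[_] := gcvg i.
(* Truncation keeps the constraint, since it only enlarges the potentials, and passing to the
   majorants only increases the masses. *)
have bound m : (forall i, 0 < z m i) -> \sum_i c i * ln (z m i) <= D.
  move=> zm0.
  have gsupp i x : 0 < g m i x -> 0 < e i x /\ cube m.+1%:R x.
    rewrite /g indicE; have [/[!inE] xm|_] := boolP (x \in cube _).
      by rewrite mulr1.
    by rewrite mulr0 ltxx.
  have gadm : admissible c Q m.+1%:R (g m).
    split => //.
    - move=> i x; rewrite /g /e /exp_neg feven !indicE; congr (_ * _%:R).
      congr nat_of_bool; apply/idP/idP; rewrite !inE => xm j;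
        by have := xm j; rewrite tnth_tneg normrN.
    - by move=> i x /gsupp[].
    - split.
        move=> i; apply: contrapT => /forallNP H.
        have := zm0 i; rewrite -lte_fin -zE integral0_eq ?ltxx// => x _.
        by have := g0 m i x; rewrite le_eqVlt => /predU1P[<-//|gx]; case: (H x).
      move=> y Hy; rewrite -lee_fin; apply: le_trans (ffeas y) _.
      rewrite -sumrN -sumEFin; apply: lee_sum => i _.
      have [ey ym] := gsupp i _ (Hy i).
      rewrite (exp_neg_gt0 (fN i) ey) /g indicE mem_set// mulr1 -EFinM lee_fin.
      by rewrite mulrN.
  have [h [hadm hlc gh]] := log_concave_majorant c0 psd gadm.
  have [mh h0 _ hr _] := hadm.
  have hfin i : exists zh, (\int[leb (d i)]_x (h i x)%:E = zh%:E)%E.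
    have [_ [M hM]] := hlc i.
    exists (fine (\int[leb (d i)]_x (h i x)%:E)); rewrite fineK// ge0_fin_numE.
      apply: (@le_lt_trans _ _ (\int[leb (d i)]_x (`|M|%:E * (\1_(cube m.+1%:R) x)%:E))%E).
        apply: le_integralT; first by apply/measurable_EFinP; exact: mh.
          apply: emeasurable_funM => //; apply/measurable_EFinP; apply: measurable_indic.
          exact: measurable_cube.
        move=> x; rewrite -EFinM lee_fin indicE.
        have := h0 i x; rewrite le_eqVlt => /predU1P[<-|hx]; first by rewrite mulr_ge0.
        by rewrite mem_set ?mulr1 ?(le_trans (hM x)) ?ler_norm//; exact: hr.
      rewrite ge0_integralZl_EFin//; last first.
        by apply/measurable_EFinP; apply: measurable_indic; exact: measurable_cube.
      rewrite integral_indic//; last exact: measurable_cube.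
      by rewrite setIT [X in (_ * X)%E]leb_cube// -EFinM ltry.
    by apply: integral_ge0 => x _; rewrite lee_fin.
  pose zh i := sval (cid (hfin i)).
  have zhE i : (\int[leb (d i)]_x (h i x)%:E = (zh i)%:E)%E by rewrite /zh; case: cid.
  have zle i : z m i <= zh i.
    rewrite -lee_fin -zE -zhE; apply: le_integralT;
      [by apply/measurable_EFinP; exact: mg|by apply/measurable_EFinP; exact: mh|].
    by move=> x; rewrite lee_fin.
  have zh0 i : 0 < zh i by exact: lt_le_trans (zle i).
  have m0 : 0 < m.+1%:R :> R by rewrite ltr0n.
  have := log_concave_mass_bound m0 B hadm hlc zhE zh0; apply: le_trans.
  by apply: ler_sum => i _; rewrite ler_wpM2l ?(ltW (c0 i))// ler_ln ?posrE.
have -> : \prod_(i < n) Z i `^ c i = expR (\sum_i c i * ln (Z i)).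
  by rewrite expR_sum; apply: eq_bigr => i _; rewrite /powR gt_eqF.
rewrite ler_expR; apply/ler_addgt0Pr => eps eps0.
(* The summand 1 makes [C] positive even without blocks, and the errors [c i * (eps / C)] add up to
   at most [eps]. *)
pose C := 1 + \sum_i c i.
have C0 : 0 < C by rewrite ltr_pwDl// sumr_ge0// => i _; exact: ltW.
have epsC : 0 < eps / C by rewrite divr_gt0.
have lcvg i : ln (z m i) @[m --> \oo] --> ln (Z i).
  exact: (cvg_comp _ _ (zcvg i) (continuous_ln (Z0 i))).
have : \forall m \near \oo, forall i, 0 < z m i /\ ln (Z i) <= ln (z m i) + eps / C.
  apply: filter_forall => i; near=> m; split.
    by near: m; apply: (cvgr_gt (Z i)) => //; exact: zcvg.
  rewrite -lerBlDl (le_trans (ler_norm _))//; near: m.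
  by move/cvgrPdist_le : (lcvg i); apply.
move=> [m _ /(_ m (leqnn m)) /= Hm].
have zm0 i : 0 < z m i by have [] := Hm i.
apply: (@le_trans _ _ (\sum_i c i * (ln (z m i) + eps / C))).
  by apply: ler_sum => i _; rewrite ler_wpM2l ?(ltW (c0 i))//; have [] := Hm i.
under eq_bigr do rewrite mulrDr.
rewrite big_split/= -mulr_suml lerD ?bound//.
rewrite mulrA ler_pdivrMr// mulrC ler_wpM2l ?(ltW eps0)//.
by rewrite lerDr.
Unshelve. all: by end_near.
Qed.

Lemma condB_lc_condA (D : \bar R) : D != -oo%E -> condB_lc c Q D -> condA c Q D.
Proof.
case: D => [D _|_ _ f _ _ _ _ _|//]; first exact: condB_lc_condA_fin.
by rewrite leey.
Qed.

End condB_lc_condA.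

Theorem theorem12 (R : realType) (n : nat) (d : 'I_n -> nat) (c : 'I_n -> R)
  (Q : 'M[R]_(dimE d)) :
  (forall i, (0 < d i)%N) -> (forall i, 0 < c i) -> Q^T = Q ->
  (forall D : \bar R, D != -oo%E -> (condA c Q D <-> condB c Q D)) /\
  D_s c Q = ereal_inf [set D : \bar R | D != -oo%E /\ condB_lc c Q D].
Proof.
move=> _ c0 _.
have B_lc D : condB c Q D -> condB_lc c Q D by move=> B rho h1 h2 _; exact: B.
split=> [D DN|].
  split; first exact: condA_condB.
  by move=> /B_lc; exact: condB_lc_condA.
(* The two sets of constants coincide: the log-concave case gives (A), and (A) gives (B) for all
   symmetric densities. *)
rewrite /D_s; congr ereal_inf; apply/seteqP; split => D [DN H]; split => //.
  exact: B_lc.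
by apply: condA_condB => //; exact: condB_lc_condA.
Qed.
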